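(* Let $\epsilon>0$, $\zeta\in(0,1)$, $\sigma>0$, and choose $$N=\left\lceil\frac12\cdot\frac{\log\left(\frac{2\|Q_N-P^*\|_*\,\kappa_{P^*}\,\|A_K^*\|\,\|B\|}{\epsilon\,\lambda_{\min}(R)}\right)}{\log\left(\frac1{\|A_K^*\|_*}\right)}+1\right\rceil,$$ where $Q_N\succeq P^*$ (and it is assumed that this expression is well defined, i.e. $A\ne0$, $B\ne0$, $Q_N\neq P^*$, and $N\ge1$). Then the algorithm RHPG-RL (see context), run with arbitrary deterministic initial policies $K_{h,0}$ and with $$\alpha_{h,i}=\frac2\mu\,\frac1{i+\theta_h},\qquad \theta_h=\max\left\{2,\frac{2L\xi_{h,3}}{\mu^2\widetilde J_h(K_{h,0})}\right\},\qquad T_h=\left\lceil\frac{40}{7\mu\,\varsigma_{h,\epsilon}^2\,\zeta}\,\theta_h\,\widetilde J_h(K_{h,0})\right\rceil$$ for each $h\in\{0,1,\dots,N-1\}$, outputs a control policy $\widetilde K_0$ that satisfies $\|\widetilde K_0-K^*\|\le\epsilon$ with probability at least $1-N\zeta$. Additionally, if $\epsilon<\dfrac{1-\|A-BK^*\|_*}{\kappa_{P^*}^{1/2}\|B\|}$, then (on the same event) $\widetilde K_0$ is stabilizing, i.e. $A-B\widetilde K_0$ has spectral radius less than $1$.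
   Context: Norms: $\|X\|$ is the spectral norm, $\|X\|_F$ the Frobenius norm, $\sigma_{\min}$ the minimum singular value, $\kappa_X$ the condition number; $\|X\|_*^2:=\sup_{z\ne0}\frac{z^\top X^\top P^*Xz}{z^\top P^*z}$. $e$ is Euler's number. Setting: system $x_{t+1}=Ax_t+Bu_t$, $A\in\mathbb{R}^{n\times n}$, $B\in\mathbb{R}^{n\times m}$, $(A,B)$ stabilizable; $Q\in\mathbb{R}^{n\times n}$, $R\in\mathbb{R}^{m\times m}$ symmetric positive definite. The initial state distribution $\mathcal D$ on $\mathbb{R}^n$ satisfies $\mathbb E[x_0]=0$, $\mathbb E[x_0x_0^\top]=\Sigma_0\succ0$, $\|x_0\|^2\le C_m$ a.s. for some $C_m>0$. $P^*$ is the unique positive definite solution of $P=A^\top PA-A^\top PB(R+B^\top PB)^{-1}B^\top PA+Q$, $K^*:=(R+B^\top P^*B)^{-1}B^\top P^*A$, $A_K^*:=A-BK^*$. $Q_N$ is symmetric. Riccati difference equation: $P_N^*:=Q_N$ and, for $t=N-1,\dots,0$, $K_t^*:=(R+B^\top P_{t+1}^*B)^{-1}B^\top P_{t+1}^*A$, $P_t^*:=(A-BK_t^* )^\top P_{t+1}^*(A-BK_t^* )+(K_t^* )^\top RK_t^*+Q$. Algorithm RHPG-RL: set $\widetilde P_N:=Q_N$. For $h=N-1,\dots,0$: start from $K_{h,0}$; for $i=0,\dots,T_h-1$ draw fresh independent $x_0\sim\mathcal D$, $\eta\sim\mathcal N(0,I_m)$ (independent of all the past), simulate one trajectory with $u_0=-K_{h,i}x_0+\sigma\eta$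 and $u_t=-\widetilde K_{h+t}x_t$ for $t\ge1$, observe the cost-to-go $Q_h(x_0,u_0)=x_0^\top Qx_0+u_0^\top Ru_0+(Ax_0+Bu_0)^\top\widetilde P_{h+1}(Ax_0+Bu_0)$, and update $K_{h,i+1}=K_{h,i}+\frac{\alpha_{h,i}}{\sigma}Q_h(x_0,u_0)\,\eta x_0^\top$. Then set $\widetilde K_h:=K_{h,T_h}$ and $\widetilde P_h:=(A-B\widetilde K_h)^\top\widetilde P_{h+1}(A-B\widetilde K_h)+\widetilde K_h^\top R\widetilde K_h+Q$. Output $\widetilde K_0$. Surrogate cost: $\widetilde J_h(K):=\mathbb E_{x_0\sim\mathcal D}\big[x_0^\top\big(Q+K^\top RK+(A-BK)^\top\widetilde P_{h+1}(A-BK)\big)x_0\big]$, with minimizer $\widetilde K_h^*=(R+B^\top\widetilde P_{h+1}B)^{-1}B^\top\widetilde P_{h+1}A$. Constants: $P_{\max}:=\|P^*\|+\kappa_{P^*}\|Q_N-P^*\|_*$, $a:=\sigma_{\min}(Q)/2$, $\varphi:=\max_{0\le t\le N-1}\|A-BK_t^*\|$, $C_1:=\varphi\|B\|/\lambda_{\min}(R)$, $C_3:=2(\|R\|+(P_{\max}+a)\|B\|^2)$, $\mu:=4\sigma_{\min}(\Sigma_0)\sigma_{\min}(R)$, $L:=C_3\|\Sigma_0\|$, $\widetilde C_h:=\frac{10\zeta^{-1}\widetilde J_h(K_{h,0})+\widetilde J_h(\widetilde K_h^* )}{\sigma_{\min}(\Sigma_0)\sigma_{\min}(R)}$, $\xi_{h,1}:=\big(\|Q\|+2\|R\|\widetilde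 C_h+2(P_{\max}+a)(\|A\|^2+2\|B\|^2\widetilde C_h)\big)C_m^{3/2}$, $\xi_{h,2}:=2(\|R\|+2(P_{\max}+a)\|B\|^2)C_m^{1/2}$, $\xi_{h,3}:=\frac1{\sigma^2}\xi_{h,1}^2m+2\xi_{h,1}\xi_{h,2}m(m+2)+\sigma^2\xi_{h,2}^2m(m+2)(m+4)$. Target accuracies: $\varsigma_{0,\epsilon}:=\epsilon/4$ and, for $h\ge1$, $\varsigma_{h,\epsilon}:=\min\big\{\sqrt{\tfrac{a}{C_3}\tfrac1N},\sqrt{\tfrac{a}{C_3}\tfrac{a}{2eNP_{\max}}},\sqrt{\tfrac{a}{C_3}\tfrac{\epsilon}{8eNC_1P_{\max}}},\sqrt{\tfrac{\epsilon}{4C_1C_3}}\big\}$. *)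

(* Defs.v *)
From HB Require Import structures.
From mathcomp Require Import all_boot all_order all_algebra.
From mathcomp Require Import all_classical all_reals all_analysis.
From mathcomp.real_closed Require Import complex.

Set Implicit Arguments.
Unset Strict Implicit.
Unset Printing Implicit Defensive.

Import Order.TTheory GRing.Theory Num.Theory.
Import numFieldNormedType.Exports.

Local Open Scope classical_set_scope.
Local Open Scope ring_scope.

Section matrix_notions.
Context {R : realType}.

Definition quad n (M : 'M[R]_n) (z : 'cV[R]_n) : R := (z^T *m M *m z) 0 0.

Definition posdef n (M : 'M[R]_n) : Prop :=
  M^T = M /\ forall z, z != 0 -> 0 < quad M z.

Definition possemidef n (M : 'M[R]_n) : Prop :=
  M^T = M /\ forall z, 0 <= quad M z.

(* The Euclidean norm; the library's norm on matrices is the max norm. *)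
Definition l2norm n (z : 'cV[R]_n) : R := Num.sqrt (\sum_i z i 0 ^+ 2).

Definition spectral_norm p q (X : 'M[R]_(p, q)) : R :=
  sup [set l2norm (X *m z) | z in [set z | l2norm z <= 1]].

Definition singular_value n (X : 'M[R]_n) (s : R) : Prop :=
  0 <= s /\ eigenvalue (X^T *m X) (s ^+ 2).

Definition sigma_min n (X : 'M[R]_n) : R := inf [set s | singular_value X s].

Definition lambda_min n (X : 'M[R]_n) : R := inf [set l | eigenvalue X l].

Definition condition_number n (X : 'M[R]_n) : R :=
  spectral_norm X / sigma_min X.

(* The norm ||X||_* induced by the inner product of a positive definite P. *)
Definition norm_wrt n (P X : 'M[R]_n) : R :=
  Num.sqrt (sup [set quad (X^T *m P *m X) z / quad P z | z in [set z | z != 0]]).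

Definition spectral_radius n (X : 'M[R]_n) : R :=
  sup [set Normc.normc z | z in
        [set z : R[i] | eigenvalue (map_mx (real_complex R) X) z]].

Definition stabilizable n m (A : 'M[R]_n) (B : 'M[R]_(n, m)) : Prop :=
  exists K : 'M[R]_(m, n), spectral_radius (A - B *m K) < 1.

(* Distributions on R^n live on n.-tuple R, which carries the product Borel
   sigma-algebra; linear algebra is done on the associated column vectors. *)
Definition vec n (t : n.-tuple R) : 'cV[R]_n := \col_i tnth t i.

End matrix_notions.

Section probability_notions.
Local Open Scope ereal_scope.
Context {R : realType}.

Definition standard_gaussian m (mu : set (m.-tuple R) -> \bar R) : Prop :=
  forall U : 'I_m -> set R, (forall j, measurable (U j)) ->
    mu [set v | forall j, U j (tnth v j)] =
    \prod_(j < m) normal_prob 0%R 1%R (U j).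

Definition mutually_independent d (T : measurableType d) (P : probability T R)
    (I : eqType) (F : I -> set_system T) : Prop :=
  forall (s : seq I) (E : I -> set T), uniq s ->
    (forall i, i \in s -> F i (E i)) ->
    P (\bigcap_(i in [set` s]) E i) = \prod_(i <- s) P (E i).

Definition generated_by d d' (T : measurableType d) (T' : measurableType d')
    (X : T -> T') : set_system T := preimage_set_system setT X measurable.

End probability_notions.

Section riccati.
Context {R : realType} {n m : nat}.
Variables (A : 'M[R]_n) (B : 'M[R]_(n, m)) (Q : 'M[R]_n) (W : 'M[R]_m).

Definition gain (P : 'M[R]_n) : 'M[R]_(m, n) :=
  invmx (W + B^T *m P *m B) *m B^T *m P *m A.

Definition solves_riccati (P : 'M[R]_n) : Prop :=
  P = A^T *m P *m A
      - A^T *m P *m B *m invmx (W + B^T *m P *m B) *m B^T *m P *m A + Q.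

Definition policy_cost (P : 'M[R]_n) (K : 'M[R]_(m, n)) : 'M[R]_n :=
  (A - B *m K)^T *m P *m (A - B *m K) + K^T *m W *m K + Q.

End riccati.

Record rhpg_setting (R : realType) (n m : nat) := RHPGSetting {
  sysA : 'M[R]_n;
  sysB : 'M[R]_(n, m);
  costQ : 'M[R]_n;
  costR : 'M[R]_m;
  terminalQ : 'M[R]_n;                     (* Q_N *)
  optimalP : 'M[R]_n;                      (* P^* *)
  init_law : probability (n.-tuple R) R;   (* the distribution of x_0 *)
  init_cov : 'M[R]_n;                      (* Sigma_0 *)
  init_bound : R;                          (* C_m *)
  accuracy : R;                            (* epsilon *)
  failure : R;                             (* zeta *)
  smoothing : R;                           (* sigma *)
  horizon : nat;                           (* N *)
  init_policy : nat -> 'M[R]_(m, n)        (* h |-> K_{h,0} *)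
}.

Section rhpg.
Context {R : realType} {n m : nat}.
Variable p : rhpg_setting R n m.

Local Notation A := (sysA p).
Local Notation B := (sysB p).
Local Notation Q := (costQ p).
Local Notation W := (costR p).
Local Notation QN := (terminalQ p).
Local Notation Pst := (optimalP p).
Local Notation D := (init_law p).
Local Notation Sigma0 := (init_cov p).
Local Notation Cm := (init_bound p).
Local Notation eps := (accuracy p).
Local Notation zeta := (failure p).
Local Notation sigma := (smoothing p).
Local Notation N := (horizon p).
Local Notation K0 := (init_policy p).

(* P_t^* and K_t^*, meaningful for t <= N and t < N respectively. *)
Definition riccati_P (t : nat) : 'M[R]_n :=
  iter (N - t) (fun P => policy_cost A B Q W P (gain A B W P)) QN.

Definition riccati_K (t : nat) : 'M[R]_(m, n) := gain A B W (riccati_P t.+1).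

Definition cst_Pmax : R :=
  spectral_norm Pst + condition_number Pst * norm_wrt Pst (QN - Pst).

Definition cst_a : R := sigma_min Q / 2.

(* Norms are nonnegative, so starting the maximum at 0 is harmless. *)
Definition cst_phi : R :=
  \big[Num.max/0]_(t < N) spectral_norm (A - B *m riccati_K t).

Definition cst_C1 : R := cst_phi * spectral_norm B / lambda_min W.

Definition cst_C3 : R :=
  2 * (spectral_norm W + (cst_Pmax + cst_a) * spectral_norm B ^+ 2).

Definition cst_mu : R := 4 * sigma_min Sigma0 * sigma_min W.

Definition cst_L : R := cst_C3 * spectral_norm Sigma0.

Definition target_accuracy (h : nat) : R :=
  if h == 0%N then eps / 4 else
  Num.min (Num.sqrt (cst_a / cst_C3 * (1 / N%:R)))
 (Num.min (Num.sqrt (cst_a / cst_C3 * (cst_a / (2 * expR 1 * N%:R * cst_Pmax))))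
 (Num.min (Num.sqrt (cst_a / cst_C3 * (eps / (8 * expR 1 * N%:R * cst_C1 * cst_Pmax))))
          (Num.sqrt (eps / (4 * cst_C1 * cst_C3))))).

(* In the rest of the section, h is the current stage and P stands for the
   (random) matrix \widetilde P_{h+1} produced by the later stages. *)

Definition surrogate_cost (P : 'M[R]_n) (K : 'M[R]_(m, n)) : R :=
  fine ('E_D[fun x => quad (policy_cost A B Q W P K) (vec x)])%E.

Definition Ctilde (P : 'M[R]_n) (h : nat) : R :=
  (10 * zeta^-1 * surrogate_cost P (K0 h) + surrogate_cost P (gain A B W P))
  / (sigma_min Sigma0 * sigma_min W).

Definition xi1 (P : 'M[R]_n) (h : nat) : R :=
  (spectral_norm Q + 2 * spectral_norm W * Ctilde P h
   + 2 * (cst_Pmax + cst_a)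
     * (spectral_norm A ^+ 2 + 2 * spectral_norm B ^+ 2 * Ctilde P h))
  * Cm `^ (3 / 2).

Definition xi2 : R :=
  2 * (spectral_norm W + 2 * (cst_Pmax + cst_a) * spectral_norm B ^+ 2)
  * Cm `^ (1 / 2).

Definition xi3 (P : 'M[R]_n) (h : nat) : R :=
  1 / sigma ^+ 2 * xi1 P h ^+ 2 * m%:R
  + 2 * xi1 P h * xi2 * m%:R * (m%:R + 2)
  + sigma ^+ 2 * xi2 ^+ 2 * m%:R * (m%:R + 2) * (m%:R + 4).

Definition theta (P : 'M[R]_n) (h : nat) : R :=
  Num.max 2 (2 * cst_L * xi3 P h / (cst_mu ^+ 2 * surrogate_cost P (K0 h))).

Definition stepsize (P : 'M[R]_n) (h i : nat) : R :=
  2 / cst_mu * (1 / (i%:R + theta P h)).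

(* T_h; the argument of the ceiling is positive when P is positive definite. *)
Definition num_iterations (P : 'M[R]_n) (h : nat) : nat :=
  `|Num.ceil (40 / (7 * cst_mu * target_accuracy h ^+ 2 * zeta)
              * theta P h * surrogate_cost P (K0 h))|%N.

(* Q_h(x, u), the cost of the trajectory that starts with x_0 = x, u_0 = u: from
   x_1 = A x + B u on, the later policies are followed, at cost quad P x_1. *)
Definition observed_cost (P : 'M[R]_n) (x : 'cV[R]_n) (u : 'cV[R]_m) : R :=
  quad Q x + quad W u + quad P (A *m x + B *m u).

(* K_{h,i}, when x i and eta i are the state and the perturbation drawn at
   iteration i of stage h. *)
Fixpoint policy_iterate (P : 'M[R]_n) (h : nat) (x : nat -> 'cV[R]_n)
    (eta : nat -> 'cV[R]_m) (i : nat) : 'M[R]_(m, n) :=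
  if i is j.+1 then
    let K := policy_iterate P h x eta j in
    let u := - (K *m x j) + sigma *: eta j in
    K + (stepsize P h j / sigma * observed_cost P (x j) u)
          *: (eta j *m (x j)^T)
  else K0 h.

Definition stage_policy (P : 'M[R]_n) (h : nat) (x : nat -> 'cV[R]_n)
    (eta : nat -> 'cV[R]_m) : 'M[R]_(m, n) :=
  policy_iterate P h x eta (num_iterations P h).

(* \widetilde P_{N-k}: the first k stages of the algorithm, which are the
   stages h = N-1, ..., N-k; x h i and eta h i are the draws of iteration i
   of stage h. *)
Fixpoint rhpg_P_after (x : nat -> nat -> 'cV[R]_n)
    (eta : nat -> nat -> 'cV[R]_m) (k : nat) : 'M[R]_n :=
  if k is k'.+1 then
    let P := rhpg_P_after x eta k' in
    let h := (N - k)%N in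
    policy_cost A B Q W P (stage_policy P h (x h) (eta h))
  else QN.

(* \widetilde K_h for h < N. *)
Definition rhpg_policy (x : nat -> nat -> 'cV[R]_n)
    (eta : nat -> nat -> 'cV[R]_m) (h : nat) : 'M[R]_(m, n) :=
  stage_policy (rhpg_P_after x eta (N - h.+1)) h (x h) (eta h).

End rhpg.

(* Main.v *)
(* Policy gradient for one stage is stochastic descent on a quadratic: with
   D = K - gain P and H = R + B^T P B, the surrogate cost exceeds its minimum by
   tr (D^T H D Sigma), and the one-point estimate is an unbiased multiple of the
   gradient 2 H D Sigma, so the expected gap contracts as in gradient descent up
   to a second moment xi3, valid as long as the cost stays below 10 J(K_0) / zeta.
   The minimum of 1 and an affine function of the gap (the potential) is a
   supermartingale: where the cost is too large the potential already exceeds 1, so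
   no exit time is needed. It starts below zeta and dominates the indicator of a
   missed target accuracy at the final iteration, hence each stage fails with
   probability at most zeta given accurate later stages (Tonelli between the
   sigma-algebras of the draws of different stages).
   If all N stages are accurate, the computed matrices stay between the iterates of
   the Riccati recursion and a multiple 1 + delta of them, the recursion converges to
   P^* at the rate |A_K^*|_*^2, and the gain is Lipschitz in P, which gives the error. *)
From HB Require Import structures.
Require Import Defs.
From mathcomp Require Import all_boot all_order all_algebra.
From mathcomp Require Import all_classical all_reals all_analysis.
From mathcomp.real_closed Require Import complex.
From mathcomp Require Import measurable_realfun.
From mathcomp Require Import ring lra.

Set Implicit Arguments.
Unset Strict Implicit.
Unset Printing Implicit Defensive.

Import Order.TTheory GRing.Theory Num.Theory.
Import numFieldNormedType.Exports.

Local Open Scope classical_set_scope.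
Local Open Scope ring_scope.

(** * Spectral and weighted norms *)

Section euclidean.
Context {R : realType}.

(** Two obstacles shape the argument. The step sizes and the number of iterations of a stage depend
    on the random matrix left by the later stages, so no conditional expectation is formed:
    independence turns the joint law into a product, the later draws are frozen, and a stage is
    analysed for a deterministic [P]. Moreover, the second moment is bounded through a bound on [K],
    which is available only while the cost is moderate; truncating the potential at 1 makes the
    remaining region harmless.

    The constants come from a split of the failure budget: the part of the potential that watches
    the cost starts at most at 3/10 [zeta], the part that watches the final gap at most at 7/10
    [zeta]; hence the 10 in [Ctilde] and the 40/7 in [num_iterations].

    Errors of successive stages do not pass through a perturbed contraction. The Riccati operator is
    monotone, and scaling its argument by [1 + c] scales its value by at most [1 + c]. An excess
    [e |z|^2] of one stage is at most [e / (2 a)] times [quad Q z], hence at most that fraction of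
    the next iterate. So relative errors merely add up over the [N] stages. *)

Definition bil p q (M : 'M[R]_(p, q)) (x : 'cV[R]_p) (y : 'cV[R]_q) : R :=
  (x^T *m M *m y) 0 0.

Definition sqn n (z : 'cV[R]_n) : R := \sum_i z i 0 ^+ 2.

Definition frob2 p q (X : 'M[R]_(p, q)) : R := \sum_i \sum_j X i j ^+ 2.

Lemma ler_pow2 (a b : R) : 0 <= a -> 0 <= b -> (a ^+ 2 <= b ^+ 2) = (a <= b).
Proof. by move=> a0 b0; rewrite ler_pXn2r. Qed.

Lemma quadE n (M : 'M[R]_n) z : quad M z = bil M z z.
Proof. by []. Qed.

Lemma bilDl p q (M : 'M[R]_(p, q)) x x' y :
  bil M (x + x') y = bil M x y + bil M x' y.
Proof. by rewrite /bil linearD /= !mulmxDl mxE. Qed.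

Lemma bilDr p q (M : 'M[R]_(p, q)) x y y' :
  bil M x (y + y') = bil M x y + bil M x y'.
Proof. by rewrite /bil mulmxDr mxE. Qed.

Lemma bilZl p q (M : 'M[R]_(p, q)) a x y : bil M (a *: x) y = a * bil M x y.
Proof. by rewrite /bil linearZ /= -!scalemxAl mxE. Qed.

Lemma bilZr p q (M : 'M[R]_(p, q)) a x y : bil M x (a *: y) = a * bil M x y.
Proof. by rewrite /bil -!scalemxAr mxE. Qed.


Lemma bil_tr p q (M : 'M[R]_(p, q)) x y : bil M^T y x = bil M x y.
Proof.
have tr00 (X : 'M[R]_1) : X 0 0 = X^T 0 0 by rewrite mxE.
by rewrite /bil tr00 !trmx_mul !trmxK mulmxA.
Qed.

Lemma bil_mulr p q s (M : 'M[R]_(p, q)) (X : 'M[R]_(q, s)) x y :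
  bil M x (X *m y) = bil (M *m X) x y.
Proof. by rewrite /bil !mulmxA. Qed.

Lemma bil_mull p q s (M : 'M[R]_(p, q)) (X : 'M[R]_(p, s)) x y :
  bil M (X *m x) y = bil (X^T *m M) x y.
Proof. by rewrite /bil trmx_mul !mulmxA. Qed.

Lemma bilDM p q (M M' : 'M[R]_(p, q)) x y :
  bil (M + M') x y = bil M x y + bil M' x y.
Proof. by rewrite /bil mulmxDr mulmxDl mxE. Qed.

Lemma bilNM p q (M : 'M[R]_(p, q)) x y : bil (- M) x y = - bil M x y.
Proof. by rewrite /bil mulmxN mulNmx mxE. Qed.

Lemma bilZM p q (M : 'M[R]_(p, q)) a x y : bil (a *: M) x y = a * bil M x y.
Proof. by rewrite /bil -scalemxAr -scalemxAl mxE. Qed.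

Lemma bilE p q (M : 'M[R]_(p, q)) x y :
  bil M x y = \sum_i \sum_j x i 0 * M i j * y j 0.
Proof.
rewrite /bil mxE exchange_big /=; apply: eq_bigr => j _.
rewrite mxE mulr_suml; apply: eq_bigr => i _; by rewrite mxE.
Qed.

Lemma quadDM n (M M' : 'M[R]_n) z : quad (M + M') z = quad M z + quad M' z.
Proof. exact: bilDM. Qed.

Lemma quadNM n (M : 'M[R]_n) z : quad (- M) z = - quad M z.
Proof. exact: bilNM. Qed.

Lemma quadBM n (M M' : 'M[R]_n) z : quad (M - M') z = quad M z - quad M' z.
Proof. by rewrite quadDM quadNM. Qed.

Lemma quadZM n (M : 'M[R]_n) a z : quad (a *: M) z = a * quad M z.
Proof. exact: bilZM. Qed.

Lemma quadZ n (M : 'M[R]_n) a z : quad M (a *: z) = a ^+ 2 * quad M z.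
Proof. by rewrite !quadE bilZl bilZr mulrA. Qed.

Lemma quad0 n (M : 'M[R]_n) : quad M 0 = 0.
Proof. by rewrite /quad mulmx0 mxE. Qed.

Lemma quad_conj p n (M : 'M[R]_p) (X : 'M[R]_(p, n)) z :
  quad (X^T *m M *m X) z = quad M (X *m z).
Proof. by rewrite !quadE -bil_mulr bil_mull. Qed.

Lemma quadD n (M : 'M[R]_n) x y : M^T = M ->
  quad M (x + y) = quad M x + 2 * bil M x y + quad M y.
Proof.
move=> Ms; rewrite !quadE bilDl !bilDr -(bil_tr M y x) Ms; ring.
Qed.

Lemma bil1 n (x y : 'cV[R]_n) : bil 1%:M x y = \sum_i x i 0 * y i 0.
Proof.
by rewrite /bil mulmx1 mxE; apply: eq_bigr => i _; rewrite mxE.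
Qed.

Lemma quad1 n (z : 'cV[R]_n) : quad 1%:M z = sqn z.
Proof. by rewrite quadE bil1; apply: eq_bigr => i _; rewrite expr2. Qed.

Lemma sqn_ge0 n (z : 'cV[R]_n) : 0 <= sqn z.
Proof. by apply: sumr_ge0 => i _; exact: sqr_ge0. Qed.

Lemma sqn_eq0 n (z : 'cV[R]_n) : (sqn z == 0) = (z == 0).
Proof.
rewrite psumr_eq0; last by move=> i _; exact: sqr_ge0.
apply/allP/eqP => [h|-> i _]; last by rewrite mxE expr0n eqxx.
apply/matrixP => i j; rewrite ord1 mxE.
by have /= := h i (mem_index_enum _); rewrite sqrf_eq0 => /eqP.
Qed.

Lemma sqn_gt0 n (z : 'cV[R]_n) : (0 < sqn z) = (z != 0).
Proof. by rewrite lt_neqAle sqn_ge0 andbT eq_sym sqn_eq0. Qed.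

Lemma sqnZ n a (z : 'cV[R]_n) : sqn (a *: z) = a ^+ 2 * sqn z.
Proof. by rewrite -!quad1 quadZ. Qed.

Lemma l2normE n (z : 'cV[R]_n) : l2norm z = Num.sqrt (sqn z).
Proof. by []. Qed.

Lemma l2norm_ge0 n (z : 'cV[R]_n) : 0 <= l2norm z.
Proof. exact: sqrtr_ge0. Qed.

Lemma l2norm_sqr n (z : 'cV[R]_n) : l2norm z ^+ 2 = sqn z.
Proof. by rewrite sqr_sqrtr // sqn_ge0. Qed.

Lemma l2norm0 n : l2norm (0 : 'cV[R]_n) = 0.
Proof.
by rewrite l2normE; apply/eqP; rewrite sqrtr_eq0 le_eqVlt sqn_eq0 eqxx.
Qed.

Lemma l2norm_gt0 n (z : 'cV[R]_n) : (0 < l2norm z) = (z != 0).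
Proof. by rewrite l2normE sqrtr_gt0 sqn_gt0. Qed.

Lemma l2normZ n a (z : 'cV[R]_n) : l2norm (a *: z) = `|a| * l2norm z.
Proof. by rewrite !l2normE sqnZ sqrtrM ?sqr_ge0// sqrtr_sqr. Qed.

Lemma possemidef1 n : possemidef (1%:M : 'M[R]_n).
Proof. by split=> [|z]; rewrite ?tr_scalar_mx// quad1 sqn_ge0. Qed.

Lemma posdef_possemidef n (M : 'M[R]_n) : posdef M -> possemidef M.
Proof.
case=> Ms Mp; split=> // z; have [->|/Mp/ltW//] := eqVneq z 0.
by rewrite quad0.
Qed.

Lemma possemidefD n (M M' : 'M[R]_n) :
  possemidef M -> possemidef M' -> possemidef (M + M').
Proof.
move=> [Ms Mp] [Ms' Mp']; split; first by rewrite linearD /= Ms Ms'.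
by move=> z; rewrite quadDM addr_ge0.
Qed.

Lemma possemidef_posdefD n (M M' : 'M[R]_n) :
  possemidef M -> posdef M' -> posdef (M + M').
Proof.
move=> [Ms Mp] [Ms' Mp']; split; first by rewrite linearD /= Ms Ms'.
by move=> z z0; rewrite quadDM ltr_wpDl// Mp'.
Qed.

Lemma possemidef_conj p n (M : 'M[R]_p) (X : 'M[R]_(p, n)) :
  possemidef M -> possemidef (X^T *m M *m X).
Proof.
move=> [Ms Mp]; split; first by rewrite !trmx_mul trmxK Ms mulmxA.
by move=> z; rewrite quad_conj.
Qed.

(** Semidefiniteness suffices: if [y] is isotropic, a nonzero [bil M x y] would make the form
    negative somewhere on the line [x + t y]. *)
Lemma bil_cauchy_schwarz n (M : 'M[R]_n) x y : possemidef M ->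
  bil M x y ^+ 2 <= quad M x * quad M y.
Proof.
move=> [Ms Mp]; set a := quad M x; set b := bil M x y; set c := quad M y.
have key s t : 0 <= s ^+ 2 * a + 2 * (s * t) * b + t ^+ 2 * c.
  have := Mp (s *: x + t *: y); rewrite quadD// !quadZ bilZl bilZr.
  by rewrite !mulrA.
have a0 : 0 <= a by exact: Mp.
have c0 : 0 <= c by exact: Mp.
have [c_gt0|c_le0] := ltP 0 c.
  have := key c (- b).
  have -> : c ^+ 2 * a + 2 * (c * - b) * b + (- b) ^+ 2 * c
    = c * (a * c - b ^+ 2) by ring.
  by rewrite pmulr_rge0// subr_ge0.
have cE : c = 0 by apply/eqP; rewrite eq_le c_le0 c0.
rewrite cE mulr0; have [->|b0] := eqVneq b 0; first by rewrite expr0n.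
(* With [c = 0] the form is affine in [t]; this is the [t] at which it equals -1. *)
have := key 1 (- (a + 1) / (2 * b)); rewrite cE mulr0 addr0.
have -> : 1 ^+ 2 * a + 2 * (1 * (- (a + 1) / (2 * b))) * b = -1 by field.
by rewrite ler0N1.
Qed.

Lemma cauchy_schwarz n (x y : 'cV[R]_n) :
  bil 1%:M x y <= l2norm x * l2norm y.
Proof.
have [b0|/ltW b0] := leP (bil 1%:M x y) 0.
  by rewrite (le_trans b0)// mulr_ge0// l2norm_ge0.
rewrite -ler_pow2 ?mulr_ge0 ?l2norm_ge0//.
rewrite exprMn !l2norm_sqr -!quad1.
exact: (bil_cauchy_schwarz _ _ (possemidef1 n)).
Qed.

Lemma l2normD n (x y : 'cV[R]_n) : l2norm (x + y) <= l2norm x + l2norm y.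
Proof.
rewrite -ler_pow2 ?addr_ge0 ?l2norm_ge0//.
rewrite sqrrD !l2norm_sqr -!quad1 quadD ?tr_scalar_mx//.
have := cauchy_schwarz x y; rewrite -mulr_natl; nra.
Qed.

Lemma frob2_ge0 p q (X : 'M[R]_(p, q)) : 0 <= frob2 X.
Proof. by do 2!(apply: sumr_ge0 => ? _); exact: sqr_ge0. Qed.

Lemma sqn_mulmx_frob2 p q (X : 'M[R]_(p, q)) z :
  sqn (X *m z) <= frob2 X * sqn z.
Proof.
rewrite /frob2 mulr_suml; apply: ler_sum => i _.
have -> : (X *m z) i 0 = bil 1%:M (row i X)^T z.
  by rewrite bil1 mxE; apply: eq_bigr => j _; rewrite !mxE.
apply: le_trans (bil_cauchy_schwarz _ _ (possemidef1 _)) _.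
rewrite !quad1 ler_wpM2r ?sqn_ge0//; apply: ler_sum => j _.
by rewrite !mxE.
Qed.

End euclidean.


Section spectral_norm.
Context {R : realType}.

Let sball n : set 'cV[R]_n := [set z | l2norm z <= 1].

(** The supremum is meaningful only for a bounded set; the Frobenius norm provides the bound. *)
Lemma spectral_norm_has_sup p q (X : 'M[R]_(p, q)) :
  has_sup [set l2norm (X *m z) | z in [set z | l2norm z <= 1]].
Proof.
split; first by exists (l2norm (X *m 0)), 0 => //=; rewrite l2norm0.
exists (Num.sqrt (frob2 X)) => _ [z /= z1 <-].
rewrite l2normE ler_wsqrtr// (le_trans (sqn_mulmx_frob2 X z))//.
by rewrite ler_piMr ?frob2_ge0// -l2norm_sqr exprn_ile1 ?l2norm_ge0.
Qed.

Lemma spectral_norm_ge0 p q (X : 'M[R]_(p, q)) : 0 <= spectral_norm X.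
Proof.
apply: ub_le_sup; first by have [] := spectral_norm_has_sup X.
by exists 0 => /=; rewrite ?mulmx0 l2norm0.
Qed.

Lemma l2norm_mulmx p q (X : 'M[R]_(p, q)) z :
  l2norm (X *m z) <= spectral_norm X * l2norm z.
Proof.
have [->|z0] := eqVneq z 0; first by rewrite mulmx0 !l2norm0 mulr0.
have z_gt0 : 0 < l2norm z by rewrite l2norm_gt0.
rewrite -ler_pdivrMr//; apply: ub_le_sup.
  by have [] := spectral_norm_has_sup X.
exists ((l2norm z)^-1 *: z) => /=.
  by rewrite l2normZ gtr0_norm ?invr_gt0// mulVf// gt_eqF.
by rewrite -scalemxAr l2normZ gtr0_norm ?invr_gt0// mulrC.
Qed.

Lemma sqn_mulmx p q (X : 'M[R]_(p, q)) z :
  sqn (X *m z) <= spectral_norm X ^+ 2 * sqn z.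
Proof.
rewrite -!l2norm_sqr -exprMn ler_pow2 ?mulr_ge0 ?spectral_norm_ge0 ?l2norm_ge0//.
exact: l2norm_mulmx.
Qed.

Lemma spectral_norm_le p q (X : 'M[R]_(p, q)) c : 0 <= c ->
  (forall z, l2norm (X *m z) <= c * l2norm z) -> spectral_norm X <= c.
Proof.
move=> c0 Xc; apply: ge_sup; first by have [] := spectral_norm_has_sup X.
by move=> _ [z /= z1 <-]; rewrite (le_trans (Xc z))// ler_piMr.
Qed.

Lemma spectral_norm_le_sqn p q (X : 'M[R]_(p, q)) c : 0 <= c ->
  (forall z, sqn (X *m z) <= c ^+ 2 * sqn z) -> spectral_norm X <= c.
Proof.
move=> c0 Xc; apply: spectral_norm_le => // z.
by rewrite -ler_pow2 ?mulr_ge0 ?l2norm_ge0// exprMn !l2norm_sqr.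
Qed.

Lemma spectral_normM p q s (X : 'M[R]_(p, q)) (Y : 'M[R]_(q, s)) :
  spectral_norm (X *m Y) <= spectral_norm X * spectral_norm Y.
Proof.
apply: spectral_norm_le => [|z]; first by rewrite mulr_ge0 ?spectral_norm_ge0.
rewrite -mulmxA (le_trans (l2norm_mulmx _ _))// -mulrA.
by rewrite ler_wpM2l ?spectral_norm_ge0// l2norm_mulmx.
Qed.

Lemma spectral_normD p q (X Y : 'M[R]_(p, q)) :
  spectral_norm (X + Y) <= spectral_norm X + spectral_norm Y.
Proof.
apply: spectral_norm_le => [|z]; first by rewrite addr_ge0 ?spectral_norm_ge0.
by rewrite mulmxDl (le_trans (l2normD _ _))// mulrDl lerD// l2norm_mulmx.
Qed.

Lemma spectral_norm_frob2 p q (X : 'M[R]_(p, q)) :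
  spectral_norm X <= Num.sqrt (frob2 X).
Proof.
apply: spectral_norm_le_sqn => [|z]; first exact: sqrtr_ge0.
by rewrite sqr_sqrtr ?frob2_ge0// sqn_mulmx_frob2.
Qed.

Lemma spectral_norm_gt0 p q (X : 'M[R]_(p, q)) : X != 0 -> 0 < spectral_norm X.
Proof.
apply: contra_neqT; rewrite -leNgt => X0; apply/matrixP => i j.
have := sqn_mulmx X (delta_mx j 0).
have -> : spectral_norm X = 0.
  by apply/eqP; rewrite eq_le X0 spectral_norm_ge0.
rewrite expr0n mul0r -colE => h.
have /eqP : sqn (col j X) == 0 by rewrite eq_le h sqn_ge0.
by move=> /eqP; rewrite sqn_eq0 => /eqP /matrixP /(_ i 0); rewrite !mxE.
Qed.

Lemma sqnE n (z : 'cV[R]_n) : sqn z = bil 1%:M z z.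
Proof. by rewrite -quad1. Qed.

Lemma quad_le_spectral_norm n (M : 'M[R]_n) z :
  quad M z <= spectral_norm M * sqn z.
Proof.
have -> : quad M z = bil 1%:M z (M *m z) by rewrite bil_mulr mul1mx.
rewrite (le_trans (cauchy_schwarz _ _))// -l2norm_sqr expr2.
have := l2norm_mulmx M z; have := l2norm_ge0 z; nra.
Qed.

(** |X^T z|^2 is the inner product of [z] with [X X^T z], hence at most |z| |X| |X^T z|, and one
    factor |X^T z| cancels. *)
Lemma spectral_norm_tr p q (X : 'M[R]_(p, q)) :
  spectral_norm X^T <= spectral_norm X.
Proof.
apply: spectral_norm_le => [|z]; first exact: spectral_norm_ge0.
have : sqn (X^T *m z) <= l2norm z * (spectral_norm X * l2norm (X^T *m z)).
  have -> : sqn (X^T *m z) = bil 1%:M z (X *m (X^T *m z)).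
    by rewrite sqnE bil_mull trmxK mulmx1 [RHS]bil_mulr mul1mx.
  rewrite (le_trans (cauchy_schwarz _ _))// ler_wpM2l ?l2norm_ge0//.
  exact: l2norm_mulmx.
rewrite -l2norm_sqr; set a := l2norm _; have [a0|a0] := ltP 0 a.
  by move=> h; rewrite -(ler_pM2r a0); rewrite expr2 in h; lra.
by move=> _; rewrite (le_trans a0)// mulr_ge0 ?l2norm_ge0 ?spectral_norm_ge0.
Qed.

(** This is [M^2 <= c M] without a square root of [M]: Cauchy-Schwarz for the form [M] at [M z] and
    [z] bounds |M z|^4 by quad M (M z) times quad M z, and the first factor is at most c |M z|^2. *)
Lemma sqn_mulmx_possemidef n (M : 'M[R]_n) z c : possemidef M -> 0 <= c ->
  (forall z, quad M z <= c * sqn z) -> sqn (M *m z) <= c * quad M z.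
Proof.
move=> Mp c0 Mc; have := bil_cauchy_schwarz (M *m z) z Mp.
have -> : bil M (M *m z) z = sqn (M *m z).
  by rewrite sqnE bil_mulr mul1mx.
have := Mc (M *m z); have := sqn_ge0 (M *m z).
set a := sqn _; set b := quad _ _; set d := quad _ _ => a0 bca abd.
have d0 : 0 <= d by exact: Mp.2.
have [a_gt0|] := ltP 0 a; last by move=> h; rewrite (le_trans h)// mulr_ge0.
rewrite -(ler_pM2l a_gt0); rewrite expr2 in abd; nra.
Qed.

Lemma spectral_norm_possemidef n (M : 'M[R]_n) c : possemidef M -> 0 <= c ->
  (forall z, quad M z <= c * sqn z) -> spectral_norm M <= c.
Proof.
move=> Mp c0 Mc; apply: spectral_norm_le_sqn => // z.
rewrite (le_trans (sqn_mulmx_possemidef z Mp c0 Mc))//.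
by rewrite expr2 -mulrA ler_wpM2l.
Qed.

End spectral_norm.

(** * Rayleigh quotients and smallest eigenvalues *)

Section rayleigh.
Context {R : realType}.

(** Write [z] as [invmx M *m (M *m z)] and bound |M z|^2 by |M| quad M z; no compactness of the
    sphere is involved. *)
Lemma possemidef_unit_coercive n (M : 'M[R]_n) :
  possemidef M -> M \in unitmx -> exists2 c, 0 < c & forall z, c * sqn z <= quad M z.
Proof.
move=> Mp Mu.
have h z : sqn z <= spectral_norm (invmx M) ^+ 2 * spectral_norm M * quad M z.
  rewrite -[in sqn z](mulKmx Mu z) (le_trans (sqn_mulmx _ _))// -mulrA.
  rewrite ler_wpM2l ?sqr_ge0// sqn_mulmx_possemidef ?spectral_norm_ge0//.
  exact: quad_le_spectral_norm.
set k := _ * _ in h; have k0 : 0 <= k.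
  by rewrite mulr_ge0 ?sqr_ge0 ?spectral_norm_ge0.
(* The [+ 1] keeps the constant positive even if [k = 0]. *)
exists (k + 1)^-1 => [|z]; first by rewrite invr_gt0 ltr_wpDl.
rewrite mulrC ler_pdivrMr ?ltr_wpDl//.
by have := h z; have := Mp.2 z; nra.
Qed.

Lemma posdef_unitmx n (M : 'M[R]_n) : posdef M -> M \in unitmx.
Proof.
move=> [Ms Mp]; rewrite -unitmx_tr -row_free_unit -kermx_eq0.
apply/eqP/row_matrixP => i; rewrite row0; apply/eqP.
have : row i (kermx M^T) *m M^T = 0 by rewrite -row_mul mulmx_ker row0.
set v := row i _ => vM; apply: contraT => v0.
have vT0 : v^T != 0 by rewrite trmx_eq0.
have := Mp _ vT0; rewrite /quad trmxK -Ms vM mul0mx mxE ltxx//.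
Qed.

Lemma eigenvalue_unitmx n (M : 'M[R]_n) a :
  M - a%:M \notin unitmx -> eigenvalue M a.
Proof.
move=> h; rewrite /eigenvalue /eigenspace kermx_eq0 row_free_unit; exact: h.
Qed.

(* The infimum of the Rayleigh quotient is an eigenvalue: otherwise
   M - inf is invertible and positive semidefinite, hence coercive. *)
Lemma rayleigh_eigenvalue n (M : 'M[R]_n) : (0 < n)%N -> M^T = M ->
  exists2 l, eigenvalue M l & forall z, l * sqn z <= quad M z.
Proof.
case: n M => // n M _ Ms.
pose S := [set quad M z | z in [set z | sqn z = 1]].
have S0 : S !=set0.
  exists (quad M (delta_mx 0 0)), (delta_mx 0 0) => //=.
  rewrite /sqn (bigD1 0)//= big1 ?mxE ?eqxx ?expr1n ?addr0// => i i0.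
  by rewrite mxE (negbTE i0) expr0n.
have Slb : has_lbound S.
  exists (- spectral_norm (- M)) => _ [z /= z1 <-].
  by rewrite lerNl -quadNM (le_trans (quad_le_spectral_norm _ _))// z1 mulr1.
have infP z : inf S * sqn z <= quad M z.
  have [->|z0] := eqVneq z 0.
    by rewrite quad0 -quad1 quad0 mulr0.
  have z_gt0 : 0 < sqn z by rewrite sqn_gt0.
  rewrite -ler_pdivlMr//; apply: ge_inf => //; exists ((l2norm z)^-1 *: z) => /=.
    by rewrite sqnZ exprVn l2norm_sqr mulVf// gt_eqF.
  by rewrite quadZ exprVn l2norm_sqr mulrC.
exists (inf S) => //; apply: eigenvalue_unitmx; apply/negP => Nu.
have Np : possemidef (M - (inf S)%:M).
  split; first by rewrite linearB /= tr_scalar_mx Ms.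
  by move=> z; rewrite quadBM -scalemx1 quadZM quad1 subr_ge0.
have [c c0 cP] := possemidef_unit_coercive Np Nu.
have : inf S + c <= inf S.
  apply: lb_le_inf => // _ [z /= z1 <-].
  by have := cP z; rewrite quadBM -scalemx1 quadZM quad1 z1; lra.
by rewrite gerDl leNgt c0.
Qed.

(** [eigenvalue] speaks of row eigenvectors; the transpose of one is a column eigenvector of
    [M^T]. *)
Lemma eigenvalue_quad n (M : 'M[R]_n) l : eigenvalue M l ->
  exists2 z, z != 0 & quad M z = l * sqn z /\ M^T *m z = l *: z.
Proof.
move=> /eigenvalueP[v vM v0]; exists v^T; first by rewrite trmx_eq0.
split; last by rewrite -trmx_mul vM linearZ.
by rewrite /quad trmxK vM -scalemxAl mxE -quad1 /quad trmxK mulmx1.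
Qed.

(** Both infima are attained at the minimum [l] of the Rayleigh quotient, so the constants of the
    statement can serve as coercivity bounds. In dimension 0 both sets are empty and the infima take
    the default value 0, hence [0 < n]. *)
Lemma lambda_minE n (M : 'M[R]_n) : (0 < n)%N -> posdef M ->
  [/\ 0 < lambda_min M, sigma_min M = lambda_min M
    & forall z, lambda_min M * sqn z <= quad M z].
Proof.
move=> n0 [Ms Mp]; have [l el lP] := rayleigh_eigenvalue n0 Ms.
have l0 : 0 < l.
  have [z z0 [zE _]] := eigenvalue_quad el; have := Mp _ z0.
  by rewrite zE pmulr_lgt0// sqn_gt0.
have lE : lambda_min M = l.
  apply/eqP; rewrite eq_le; apply/andP; split.
    apply: ge_inf => //; exists l => k /eigenvalue_quad[z z0 [zE _]].
    by have := lP z; rewrite zE ler_pM2r// sqn_gt0.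
  apply: lb_le_inf; first by exists l.
  move=> k /eigenvalue_quad[z z0 [zE _]].
  by have := lP z; rewrite zE ler_pM2r// sqn_gt0.
(* A singular value [s] with vector [z] has |M z| = s |z|, and l |z|^2 <= z^T M z <= |z| |M z| gives
   [l <= s]. *)
have slb : lbound [set s | singular_value M s] l.
  move=> s [s0 /eigenvalue_quad[z z0 [zE _]]].
  have zp : 0 < sqn z by rewrite sqn_gt0.
  have Mz : sqn (M *m z) = s ^+ 2 * sqn z.
    by rewrite -zE -(mulmx1 M^T) quad_conj quad1.
  have h : (l * sqn z) ^+ 2 <= sqn (M *m z) * sqn z.
    have : 0 <= l * sqn z by rewrite mulr_ge0// ltW.
    have := lP z; rewrite [quad M z](_ : _ = bil 1%:M z (M *m z)); last first.
      by rewrite bil_mulr mul1mx.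
    move=> h1 h2; have := bil_cauchy_schwarz z (M *m z) (possemidef1 n).
    rewrite !quad1 mulrC; apply: le_trans.
    by rewrite ler_pow2// (le_trans h2).
  rewrite -ler_pow2 ?(ltW l0)//.
  move: h; rewrite Mz exprMn [sqn z ^+ 2]expr2 !mulrA ler_pM2r// ler_pM2r//.
have ls : singular_value M l.
  split; first exact: ltW.
  have /eigenvalueP[v vM v0] := el; apply/eigenvalueP; exists v => //.
  by rewrite Ms mulmxA vM -scalemxAl vM scalerA expr2.
have sE : sigma_min M = l.
  apply/eqP; rewrite eq_le; apply/andP; split.
    exact: (ge_inf (ex_intro _ l slb) ls).
  exact: (lb_le_inf (ex_intro _ l ls) slb).
by rewrite lE sE; split.
Qed.

End rayleigh.

(** * Norms weighted by a positive definite matrix *)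

Section weighted_norm.
Context {R : realType}.

Lemma posdef_coercive n (P : 'M[R]_n) : posdef P ->
  exists2 c, 0 < c & forall z, c * sqn z <= quad P z.
Proof.
move=> Pp.
exact: possemidef_unit_coercive (posdef_possemidef Pp) (posdef_unitmx Pp).
Qed.

Lemma const_mx1_neq0 n : (0 < n)%N -> const_mx 1 != 0 :> 'cV[R]_n.
Proof.
move=> n0; apply/eqP => /matrixP h; have := h (Ordinal n0) 0; rewrite !mxE.
by move=> /eqP; rewrite oner_eq0.
Qed.

Lemma norm_wrt_ubound n (P X : 'M[R]_n) : posdef P ->
  has_ubound [set quad (X^T *m P *m X) z / quad P z | z in [set z | z != 0]].
Proof.
move=> Pp; have [c c0 cP] := posdef_coercive Pp.
exists (spectral_norm (X^T *m P *m X) / c) => _ [z /= z0 <-].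
have zp : 0 < quad P z by exact: Pp.2.
rewrite ler_pdivrMr// (le_trans (quad_le_spectral_norm _ _))// -mulrA.
by rewrite ler_wpM2l ?spectral_norm_ge0// mulrC ler_pdivlMr// mulrC.
Qed.

Lemma norm_wrt_ge0 n (P X : 'M[R]_n) : 0 <= norm_wrt P X.
Proof. exact: sqrtr_ge0. Qed.

Lemma quad_norm_wrt n (P X : 'M[R]_n) z : posdef P ->
  quad P (X *m z) <= norm_wrt P X ^+ 2 * quad P z.
Proof.
move=> Pp; have [->|z0] := eqVneq z 0; first by rewrite mulmx0 quad0 mulr0.
have zp : 0 < quad P z by exact: Pp.2.
rewrite -ler_pdivrMr// -quad_conj.
have h : quad (X^T *m P *m X) z / quad P z <=
    sup [set quad (X^T *m P *m X) z / quad P z | z in [set z | z != 0]].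
  by apply: ub_le_sup; [exact: norm_wrt_ubound|exists z].
rewrite sqr_sqrtr// (le_trans _ h)// divr_ge0 ?(ltW zp)// quad_conj.
by have [] := posdef_possemidef Pp.
Qed.

Lemma norm_wrt_le n (P X : 'M[R]_n) c : (0 < n)%N -> posdef P -> 0 <= c ->
  (forall z, quad P (X *m z) <= c ^+ 2 * quad P z) -> norm_wrt P X <= c.
Proof.
move=> n0 Pp c0 h; rewrite -[c]ger0_norm// -sqrtr_sqr ler_wsqrtr//.
apply: ge_sup.
  exists (quad (X^T *m P *m X) (const_mx 1) / quad P (const_mx 1)), (const_mx 1) => //=.
  exact: const_mx1_neq0.
move=> _ [z /= z0 <-]; have zp : 0 < quad P z by apply Pp.2.
by rewrite ler_pdivrMr// quad_conj.
Qed.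

Lemma norm_wrt_gt0 n (P X : 'M[R]_n) : posdef P -> X != 0 -> 0 < norm_wrt P X.
Proof.
move=> Pp; apply: contra_neqT; rewrite -leNgt => h.
have {h} nE : norm_wrt P X = 0 by apply/eqP; rewrite eq_le h norm_wrt_ge0.
apply/matrixP => i j.
have := quad_norm_wrt X (delta_mx j 0) Pp; rewrite nE expr0n => h.
have : X *m (delta_mx j 0 : 'cV[R]_n) = 0.
  by apply/eqP; apply: contraTT h => /Pp.2; rewrite -ltNge mul0r.
by rewrite -colE => /matrixP /(_ i 0); rewrite !mxE.
Qed.

Lemma condition_number_ge1 n (P : 'M[R]_n) : (0 < n)%N -> posdef P ->
  1 <= condition_number P.
Proof.
move=> n0 Pp; have [l0 sE lP] := lambda_minE n0 Pp.
rewrite /condition_number sE ler_pdivlMr// mul1r.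
pose z : 'cV[R]_n := const_mx 1.
have zp : 0 < sqn z by rewrite sqn_gt0 const_mx1_neq0.
by rewrite -(ler_pM2r zp) (le_trans (lP z))// quad_le_spectral_norm.
Qed.

(* The top eigenvector of a symmetric matrix X witnesses |X| <= |X|_P. *)
Lemma quad_le_norm_wrt n (P X : 'M[R]_n) z : (0 < n)%N -> posdef P ->
  X^T = X -> quad X z <= norm_wrt P X * sqn z.
Proof.
move=> n0 Pp Xs.
have [l el lP] := rayleigh_eigenvalue n0 (M := - X) ltac:(by rewrite linearN /= Xs).
have [y y0 [_]] := eigenvalue_quad el; rewrite linearN /= Xs mulNmx => yE.
have {}yE : X *m y = - l *: y by rewrite scaleNr -yE opprK.
have yp : 0 < quad P y by exact: Pp.2.
have := quad_norm_wrt X y Pp; rewrite yE quadZ ler_pM2r// => h.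
have ln : - l <= norm_wrt P X.
  have [l0|/ltW l0] := leP (- l) 0; first by rewrite (le_trans l0)// norm_wrt_ge0.
  by rewrite -ler_pow2 ?norm_wrt_ge0.
have := lP z; rewrite quadNM => h1.
have := sqn_ge0 z; nra.
Qed.

Lemma norm_wrt_triangle n (P X Y : 'M[R]_n) : (0 < n)%N -> posdef P ->
  norm_wrt P (X + Y) <= norm_wrt P X + norm_wrt P Y.
Proof.
move=> n0 Pp; apply: norm_wrt_le => // [|z]; first by rewrite addr_ge0 ?norm_wrt_ge0.
rewrite mulmxDl quadD ?Pp.1//.
have := bil_cauchy_schwarz (X *m z) (Y *m z) (posdef_possemidef Pp).
have := quad_norm_wrt X z Pp; have := quad_norm_wrt Y z Pp.
have Pn := (posdef_possemidef Pp).2.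
have := norm_wrt_ge0 P X; have := norm_wrt_ge0 P Y.
have := Pn (X *m z); have := Pn (Y *m z); have := Pn z.
set a := quad P (X *m z); set b := quad P (Y *m z); set c := quad P z.
set x := norm_wrt P X; set y := norm_wrt P Y; set k := bil _ _ _.
move=> c0 b0 a0 y0 x0 hb ha hk.
suff : k <= x * y * c by nra.
have [k0|k0] := leP k 0; first by rewrite (le_trans k0)// !mulr_ge0.
rewrite -ler_pow2 ?(ltW k0) ?mulr_ge0// (le_trans hk)//.
have -> : (x * y * c) ^+ 2 = (x ^+ 2 * c) * (y ^+ 2 * c) by ring.
by rewrite ler_pM.
Qed.

(** Going from the [P] norm to the Euclidean one and back costs the ratio of the extreme values of
    [P] on the sphere. This is the square root of the condition number in the stability
    threshold. *)
Lemma norm_wrt_le_spectral n (P X : 'M[R]_n) : (0 < n)%N -> posdef P ->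
  norm_wrt P X <= Num.sqrt (condition_number P) * spectral_norm X.
Proof.
move=> n0 Pp; have [l0 sE lP] := lambda_minE n0 Pp.
have k1 := condition_number_ge1 n0 Pp.
have kE : condition_number P * lambda_min P = spectral_norm P.
  by rewrite /condition_number sE mulfVK// gt_eqF.
apply: norm_wrt_le => // [|z]; first by rewrite mulr_ge0 ?sqrtr_ge0 ?spectral_norm_ge0.
rewrite exprMn sqr_sqrtr ?(le_trans ler01)//.
rewrite (le_trans (quad_le_spectral_norm _ _))//.
rewrite (@le_trans _ _ (spectral_norm P * (spectral_norm X ^+ 2 * sqn z)))//.
  by rewrite ler_wpM2l ?spectral_norm_ge0// sqn_mulmx.
rewrite -kE; move: (condition_number P) k1 => k k1.
have -> : k * lambda_min P * (spectral_norm X ^+ 2 * sqn z) =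
          k * spectral_norm X ^+ 2 * (lambda_min P * sqn z) by ring.
by apply: ler_wpM2l => //; rewrite mulr_ge0 ?sqr_ge0 ?(le_trans ler01).
Qed.

End weighted_norm.

(** * Spectral radius of a contraction *)

Section stability.
Context {R : realType}.

(** Split a complex eigenvector into real and imaginary parts [a] and [b]: [X] acts on them as a
    rotation scaled by |z|, so quad P a + quad P b is multiplied by |z|^2 exactly. *)
Lemma quad_contraction_eigenvalue n (P X : 'M[R]_n) (c : R) (z : R[i]) :
  posdef P -> 0 <= c -> (forall z, quad P (X *m z) <= c ^+ 2 * quad P z) ->
  eigenvalue (map_mx (real_complex R) X) z -> Normc.normc z <= c.
Proof.
move=> Pp c0 Xc; rewrite eigenvalue_root_char.
(* [X] and its transpose share their characteristic polynomial, so one may take a row eigenvector of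
   [X^T], that is, a column eigenvector of [X]. *)
have -> : char_poly (map_mx (real_complex R) X) =
          char_poly (map_mx (real_complex R) X^T).
  rewrite /char_poly -det_tr /char_poly_mx; congr (\det _).
  by rewrite linearB /= tr_scalar_mx -map_trmx -map_trmx.
rewrite -eigenvalue_root_char => /eigenvalueP[w wX w0].
pose a : 'cV[R]_n := \col_i complex.Re (w 0 i).
pose b : 'cV[R]_n := \col_i complex.Im (w 0 i).
have ReS (F : 'I_n -> R[i]) :
    complex.Re (\sum_i F i) = \sum_i complex.Re (F i).
  by apply: (big_morph (@complex.Re R)) => // -[? ?] [? ?].
have ImS (F : 'I_n -> R[i]) :
    complex.Im (\sum_i F i) = \sum_i complex.Im (F i).
  by apply: (big_morph (@complex.Im R)) => // -[? ?] [? ?].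
case: z wX => x y wX.
have Xa : X *m a = x *: a + (- y) *: b.
  apply/matrixP => i j; rewrite ord1.
  have /(congr1 (@complex.Re R)) := congr1 (fun M : 'rV[R[i]]_n => M 0 i) wX.
  rewrite !mxE ReS => h; transitivity (complex.Re ((x +i* y)%C * w 0 i)).
    rewrite -h; apply: eq_bigr => k _; rewrite !mxE.
    by case: (w 0 k) => u v /=; ring.
  by case: (w 0 i) => u v /=; ring.
have Xb : X *m b = y *: a + x *: b.
  apply/matrixP => i j; rewrite ord1.
  have /(congr1 (@complex.Im R)) := congr1 (fun M : 'rV[R[i]]_n => M 0 i) wX.
  rewrite !mxE ImS => h; transitivity (complex.Im ((x +i* y)%C * w 0 i)).
    rewrite -h; apply: eq_bigr => k _; rewrite !mxE.
    by case: (w 0 k) => u v /=; ring.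
  by case: (w 0 i) => u v /=; ring.
have ab0 : 0 < quad P a + quad P b.
  have Pn := (posdef_possemidef Pp).2.
  have [a0|a0] := eqVneq a 0; last by rewrite ltr_pwDl// Pp.2.
  rewrite ltr_wpDl ?Pn// Pp.2//; apply: contra_neq w0 => b0.
  apply/matrixP => i j; rewrite ord1 mxE.
  have := congr1 (fun M : 'cV[R]_n => M j 0) a0; have := congr1 (fun M : 'cV[R]_n => M j 0) b0.
  by rewrite !mxE; case: (w 0 j) => u v /= -> ->.
have h : quad P (X *m a) + quad P (X *m b) =
    (x ^+ 2 + y ^+ 2) * (quad P a + quad P b).
  rewrite Xa Xb !(quadD _ _ Pp.1) !quadZ !bilZl !bilZr; ring.
rewrite /= -ler_pow2 ?sqrtr_ge0// sqr_sqrtr ?addr_ge0 ?sqr_ge0//.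
rewrite -(ler_pM2r ab0) -h mulrDr lerD//.
Qed.

Lemma spectral_radius_lt1 n (P X : 'M[R]_n) : posdef P ->
  norm_wrt P X < 1 -> spectral_radius X < 1.
Proof.
move=> Pp X1; rewrite /spectral_radius; set S := [set _ | _ in _].
have [->|S0] := eqVneq S set0; first by rewrite sup0 ltr01.
apply: le_lt_trans X1; apply: ge_sup; first by apply/set0P.
move=> _ [z /= zX <-]; apply: (@quad_contraction_eigenvalue _ P X _ z Pp) zX.
  exact: norm_wrt_ge0.
by move=> y; exact: quad_norm_wrt.
Qed.

End stability.

(** * Riccati recursion *)

Section riccati_operator.
Context {R : realType} {n m : nat}.
Variables (A : 'M[R]_n) (B : 'M[R]_(n, m)) (Q : 'M[R]_n) (W : 'M[R]_m).
Hypotheses (Qpos : posdef Q) (Wpos : posdef W).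

(** Half the Hessian of the one-stage cost with respect to the control. *)
Definition hess (P : 'M[R]_n) : 'M[R]_m := W + B^T *m P *m B.

Definition riccati_step (P : 'M[R]_n) : 'M[R]_n :=
  policy_cost A B Q W P (gain A B W P).

Lemma hess_posdef P : possemidef P -> posdef (hess P).
Proof.
by move=> Pp; rewrite /hess addrC; apply: possemidef_posdefD Wpos; exact: possemidef_conj.
Qed.

Lemma quad_hess P y : quad (hess P) y = quad W y + quad P (B *m y).
Proof. by rewrite quadDM quad_conj. Qed.

Lemma quad_W_le_hess P y : possemidef P -> quad W y <= quad (hess P) y.
Proof. by move=> [_ Pp]; rewrite quad_hess lerDl. Qed.

Lemma hess_gain P : possemidef P -> hess P *m gain A B W P = B^T *m P *m A.
Proof.
move=> /hess_posdef/posdef_unitmx Hu.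
by rewrite /gain -/(hess P) -!mulmxA mulKVmx.
Qed.

(** The stationarity condition of the one-stage cost at the optimal gain; it cancels the cross terms
    when the square is completed. *)
Lemma W_gain P : possemidef P ->
  W *m gain A B W P = B^T *m P *m (A - B *m gain A B W P).
Proof.
move=> /hess_gain; rewrite /hess mulmxDl => h.
by apply/eqP; rewrite mulmxBr -h !mulmxA addrK.
Qed.

Lemma quad_policy_cost P K z : quad (policy_cost A B Q W P K) z =
  quad P ((A - B *m K) *m z) + quad W (K *m z) + quad Q z.
Proof. by rewrite /policy_cost !quadDM !quad_conj. Qed.

Lemma policy_cost_possemidef P K : possemidef P ->
  possemidef (policy_cost A B Q W P K).
Proof.
move=> Pp; apply: possemidefD; last exact: posdef_possemidef.
by apply: possemidefD; apply: possemidef_conj => //; exact: posdef_possemidef.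
Qed.

Lemma quad_Q_le_policy_cost P K z : possemidef P ->
  quad Q z <= quad (policy_cost A B Q W P K) z.
Proof.
move=> [_ Pp]; rewrite quad_policy_cost lerDr addr_ge0//.
by have [] := posdef_possemidef Wpos.
Qed.

(** Completion of the square around the optimal gain: the terms linear in [D] cancel by [W_gain],
    and the quadratic ones assemble into [hess P]. *)
Lemma quad_policy_cost_gain P K z : possemidef P ->
  quad (policy_cost A B Q W P K) z =
  quad (riccati_step P) z + quad (hess P) ((K - gain A B W P) *m z).
Proof.
move=> Pp; set G := gain A B W P; set D := K - G.
rewrite /riccati_step !quad_policy_cost -/G quad_hess.
have -> : (A - B *m K) *m z = (A - B *m G) *m z + (-1) *: (B *m (D *m z)).
  by rewrite scaleN1r /D !mulmxBl mulmxBr !mulmxA opprB addrA subrK.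
have -> : K *m z = G *m z + D *m z by rewrite /D mulmxBl addrC subrK.
rewrite (quadD _ _ Pp.1) (quadD _ _ Wpos.1) quadZ bilZr.
have -> : bil W (G *m z) (D *m z) = bil P ((A - B *m G) *m z) (B *m (D *m z)).
  rewrite -(bil_tr W) Wpos.1 bil_mulr W_gain//.
  by rewrite -[in RHS](bil_tr P) Pp.1 [RHS]bil_mull [RHS]bil_mulr.
ring.
Qed.

Lemma quad_riccati_step_le P K z : possemidef P ->
  quad (riccati_step P) z <= quad (policy_cost A B Q W P K) z.
Proof.
move=> Pp; rewrite quad_policy_cost_gain// lerDl.
by have [] := posdef_possemidef (hess_posdef Pp).
Qed.

Lemma riccati_step_possemidef P : possemidef P -> possemidef (riccati_step P).
Proof. exact: policy_cost_possemidef. Qed.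

(** Bound the optimal value for [P] by the cost of the gain that is optimal for [P']. The terms in
    [W] and [Q] are not scaled, but they are nonnegative, so multiplying them by [k >= 1] only
    enlarges the right side. *)
Lemma riccati_step_le_scale P P' k z : possemidef P -> possemidef P' -> 1 <= k ->
  (forall y, quad P y <= k * quad P' y) ->
  quad (riccati_step P) z <= k * quad (riccati_step P') z.
Proof.
move=> Pp Pp' k1 PP'.
apply: le_trans (quad_riccati_step_le (gain A B W P') z Pp) _.
rewrite /riccati_step !quad_policy_cost !mulrDr lerD ?lerD ?PP'// ler_peMl//.
  by have [] := posdef_possemidef Wpos.
by have [] := posdef_possemidef Qpos.
Qed.

Lemma riccati_step_mono P P' z : possemidef P -> possemidef P' ->
  (forall y, quad P y <= quad P' y) ->
  quad (riccati_step P) z <= quad (riccati_step P') z.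
Proof.
move=> Pp Pp' PP'; rewrite -[leRHS]mul1r; apply: riccati_step_le_scale => // y.
by rewrite mul1r.
Qed.

Lemma l2norm_hess P y : (0 < m)%N -> possemidef P ->
  lambda_min W * l2norm y <= l2norm (hess P *m y).
Proof.
move=> m0 Pp; have [l0 _ lP] := lambda_minE m0 Wpos.
have [->|y0] := eqVneq y 0; first by rewrite mulmx0 !l2norm0 mulr0.
have yp : 0 < l2norm y by rewrite l2norm_gt0.
have h : lambda_min W * sqn y <= l2norm y * l2norm (hess P *m y).
  rewrite (le_trans (lP y))// (le_trans (quad_W_le_hess y Pp))//.
  have -> : quad (hess P) y = bil 1%:M y (hess P *m y) by rewrite bil_mulr mul1mx.
  exact: cauchy_schwarz.
by rewrite -(ler_pM2l yp) mulrCA -expr2 l2norm_sqr.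
Qed.

(** Subtract the two normal equations [hess_gain]. The closed loop that appears belongs to [P] and
    the Hessian to [P'], so in applications [P] is the matrix whose closed loop is controlled. *)
Lemma hess_gainB P P' : possemidef P -> possemidef P' ->
  hess P' *m (gain A B W P' - gain A B W P) =
  B^T *m (P' - P) *m (A - B *m gain A B W P).
Proof.
move=> Pp Pp'; rewrite mulmxBr hess_gain//.
have -> : hess P' = hess P + B^T *m (P' - P) *m B.
  by rewrite /hess mulmxBr mulmxBl addrA addrAC addrK.
rewrite mulmxDl hess_gain// opprD addrA [RHS]mulmxBr; congr (_ - _); last by rewrite !mulmxA.
by rewrite mulmxBr mulmxBl.
Qed.

Lemma gain_lipschitz P P' : (0 < m)%N -> possemidef P -> possemidef P' ->
  spectral_norm (gain A B W P' - gain A B W P) <=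
  spectral_norm (A - B *m gain A B W P) * spectral_norm B / lambda_min W
    * spectral_norm (P' - P).
Proof.
move=> m0 Pp Pp'; have [l0 _ _] := lambda_minE m0 Wpos.
have sge0 := @spectral_norm_ge0 R.
apply: spectral_norm_le => [|z].
  by rewrite !mulr_ge0 ?invr_ge0 ?(ltW l0).
set D := _ - _; have := l2norm_hess (D *m z) m0 Pp'; rewrite mulmxA hess_gainB//.
set C := A - _; rewrite -ler_pdivlMl// => /le_trans; apply.
rewrite mulrC; set k := lambda_min W.
have -> : spectral_norm C * spectral_norm B / k * spectral_norm (P' - P) * l2norm z
  = (spectral_norm B * (spectral_norm (P' - P) * (spectral_norm C * l2norm z))) / k.
  by ring.
rewrite ler_wpM2r ?invr_ge0 ?(ltW l0)// -!mulmxA.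
apply: le_trans (l2norm_mulmx _ _) _; apply: ler_pM => //.
- exact: l2norm_ge0.
- exact: spectral_norm_tr.
apply: le_trans (l2norm_mulmx _ _) _; apply: ler_wpM2l => //.
exact: l2norm_mulmx.
Qed.

End riccati_operator.

(** * Convergence of the exact Riccati recursion *)

Section riccati_iteration.
Context {R : realType} {n m : nat}.
Variables (A : 'M[R]_n) (B : 'M[R]_(n, m)) (Q : 'M[R]_n) (W : 'M[R]_m).
Variables (QN Pst : 'M[R]_n).
Hypotheses (Qpos : posdef Q) (Wpos : posdef W) (Ppos : posdef Pst).
Hypotheses (Pare : solves_riccati A B Q W Pst) (QNge : possemidef (QN - Pst)).
Hypothesis n_gt0 : (0 < n)%N.

Local Notation F := (riccati_step A B Q W).
Local Notation Kst := (gain A B W Pst).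
Local Notation AK := (A - B *m Kst).
Local Notation ric k := (iter k F QN).
Local Notation rho := (norm_wrt Pst AK).

(** By [W_gain] the term [K^T W K] becomes [K^T B^T P (A - B K)] and merges with the first one into
    [A^T P (A - B K)], which is the form of the algebraic equation. *)
Lemma riccati_fixpoint : F Pst = Pst.
Proof.
have Pp := posdef_possemidef Ppos; have WG := W_gain A B Wpos Pp.
rewrite [RHS]Pare /riccati_step /policy_cost -(mulmxA _ W) WG {WG}.
have : Kst = Kst by []; rewrite {2}/gain; move: Kst => G GE.
rewrite !mulmxA -!mulmxDl.
have -> : (A - B *m G)^T + G^T *m B^T = A^T by rewrite linearB /= trmx_mul subrK.
by rewrite mulmxBr GE !mulmxA.
Qed.

(** The Lyapunov identity of the optimal closed loop, source of both [rho < 1] and the convergence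
    rate. *)
Lemma quad_closed_loop z :
  quad Pst z = quad Pst (AK *m z) + quad W (Kst *m z) + quad Q z.
Proof. by rewrite -{1}riccati_fixpoint quad_policy_cost. Qed.

Lemma QN_possemidef : possemidef QN.
Proof.
rewrite -(subrK Pst QN); apply: possemidefD => //; exact: posdef_possemidef.
Qed.

Lemma ric_possemidef k : possemidef (ric k).
Proof.
elim: k => [|k IH] /=; first exact: QN_possemidef.
exact: riccati_step_possemidef.
Qed.

Lemma Pst_le_ric k z : quad Pst z <= quad (ric k) z.
Proof.
elim: k z => [|k IH] z /=; first by rewrite -subr_ge0 -quadBM; case: QNge.
rewrite -{1}riccati_fixpoint; apply: riccati_step_mono => //.
  exact: posdef_possemidef.
exact: ric_possemidef.
Qed.

Lemma ricB_possemidef k : possemidef (ric k - Pst).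
Proof.
split; first by rewrite linearB /= (ric_possemidef k).1 Ppos.1.
by move=> z; rewrite quadBM subr_ge0 Pst_le_ric.
Qed.

(** In one step, replace the optimal gain of [ric k] by that of [Pst]: the terms in [W] and [Q]
    cancel against those of the Lyapunov identity, leaving the previous difference at [AK z]. *)
Lemma ricB_le k z :
  quad (ric k - Pst) z <= quad (QN - Pst) (iter k (mulmx AK) z).
Proof.
elim: k z => [//|k IH] z; rewrite [in leRHS]iterSr.
apply: le_trans _ (IH _); rewrite [leLHS]quadBM.
have := @quad_riccati_step_le _ _ _ A B Q W Wpos _ Kst z (ric_possemidef k).
rewrite quad_policy_cost (quad_closed_loop z) quadBM iterS /=; lra.
Qed.

Lemma quad_iter_closed_loop k z :
  quad Pst (iter k (mulmx AK) z) <= rho ^+ (2 * k) * quad Pst z.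
Proof.
elim: k => [|k IH]; first by rewrite muln0 expr0 mul1r.
rewrite iterS (le_trans (quad_norm_wrt _ _ Ppos))// mulnS exprD -mulrA.
by rewrite ler_wpM2l// sqr_ge0.
Qed.

(** The initial difference at the k-th closed-loop image is bounded by the Euclidean length of that
    image, which decays in the [Pst] norm; changing norms there and back costs the condition
    number. *)
Lemma ricB_norm k : spectral_norm (ric k - Pst) <=
  condition_number Pst * norm_wrt Pst (QN - Pst) * rho ^+ (2 * k).
Proof.
have [l0 sE lP] := lambda_minE n_gt0 Ppos.
have r0 : 0 <= rho by exact: norm_wrt_ge0.
have nN := norm_wrt_ge0 Pst (QN - Pst).
have k0 : 0 <= condition_number Pst.
  by rewrite (le_trans ler01)// condition_number_ge1.
apply: spectral_norm_possemidef; first exact: ricB_possemidef.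
  by apply: mulr_ge0; [exact: mulr_ge0|exact: exprn_ge0].
move=> z; rewrite (le_trans (ricB_le _ _))//.
rewrite (le_trans (quad_le_norm_wrt _ n_gt0 Ppos QNge.1))//.
have kE : condition_number Pst * lambda_min Pst = spectral_norm Pst.
  by rewrite /condition_number sE mulfVK// gt_eqF.
move: (condition_number Pst) k0 kE => c c0 cE.
have -> : c * norm_wrt Pst (QN - Pst) * rho ^+ (2 * k) * sqn z =
  norm_wrt Pst (QN - Pst) * (c * (rho ^+ (2 * k) * sqn z)) by ring.
rewrite ler_wpM2l// -(ler_pM2r l0) mulrC.
have -> : c * (rho ^+ (2 * k) * sqn z) * lambda_min Pst =
  rho ^+ (2 * k) * (spectral_norm Pst * sqn z) by rewrite -cE; ring.
rewrite (le_trans (lP _))// (le_trans (quad_iter_closed_loop _ _))//.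
by rewrite ler_wpM2l ?exprn_ge0// quad_le_spectral_norm.
Qed.

(** One closed-loop step loses at least [quad Q z] by the Lyapunov identity, and that is at least
    the fraction [q / p] of [quad Pst z]. *)
Lemma rho_lt1 : rho < 1.
Proof.
have [q0 _ qP] := lambda_minE n_gt0 Qpos.
set q := lambda_min Q in q0 qP; set p := spectral_norm Pst.
have Wp := (posdef_possemidef Wpos).2; have Pp := (posdef_possemidef Ppos).2.
have z0 := const_mx1_neq0 (R := R) n_gt0; set z := const_mx 1 in z0.
have zp : 0 < sqn z by rewrite sqn_gt0.
have qp : q <= p.
  rewrite -(ler_pM2r zp) (le_trans (qP z))// (le_trans _ (quad_le_spectral_norm _ _))//.
  by rewrite [leRHS]quad_closed_loop lerDr addr_ge0.
have p0 : 0 < p by exact: lt_le_trans q0 qp.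
have c0 : 0 <= 1 - q / p by rewrite subr_ge0 ler_pdivrMr// mul1r.
have : rho <= Num.sqrt (1 - q / p).
  apply: norm_wrt_le => // y; rewrite sqr_sqrtr// mulrBl mul1r [quad Pst (_ *m _)](_ : _ =
    quad Pst y - quad W (Kst *m y) - quad Q y); last first.
    by rewrite (quad_closed_loop y); ring.
  rewrite lerB// ?gerBl// (le_trans _ (qP y))// mulrAC ler_pdivrMr// -mulrA.
  by rewrite ler_wpM2l ?(ltW q0)// mulrC quad_le_spectral_norm.
move=> /le_lt_trans; apply; rewrite -[ltRHS]sqrtr1 ltr_sqrt//.
by rewrite ltrBlDr ltrDl divr_gt0.
Qed.

Definition Pmax : R :=
  spectral_norm Pst + condition_number Pst * norm_wrt Pst (QN - Pst).

Lemma ric_norm k : spectral_norm (ric k) <= Pmax.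
Proof.
rewrite -(subrK Pst (ric k)) (le_trans (spectral_normD _ _))// addrC lerD2l.
rewrite (le_trans (ricB_norm k))// ler_piMr//.
  by apply: mulr_ge0; rewrite ?norm_wrt_ge0// (le_trans ler01)// condition_number_ge1.
by rewrite exprn_ile1 ?norm_wrt_ge0 ?(ltW rho_lt1).
Qed.


Lemma Pmax_gt0 : 0 < Pmax.
Proof.
have [l0 sE lP] := lambda_minE n_gt0 Ppos.
apply: ltr_wpDr; last first.
  have z0 := const_mx1_neq0 (R := R) n_gt0.
  have zp : 0 < sqn (const_mx 1 : 'cV[R]_n) by rewrite sqn_gt0.
  rewrite -(pmulr_lgt0 _ zp) (lt_le_trans _ (quad_le_spectral_norm _ _))//.
  exact: Ppos.2.
apply: mulr_ge0; last exact: norm_wrt_ge0.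
by rewrite (le_trans ler01)// condition_number_ge1.
Qed.

(** * Accumulation of errors over inexact Riccati steps *)

Section perturbed.
Variables (Pt : nat -> 'M[R]_n) (K : nat -> 'M[R]_(m, n)) (N : nat) (e s2 a : R).
Hypotheses (Pt0 : Pt 0%N = QN)
  (PtS : forall k, Pt k.+1 = policy_cost A B Q W (Pt k) (K k)).
Hypotheses (a_gt0 : 0 < a) (aQ : forall z, 2 * a * sqn z <= quad Q z).
Hypotheses (e_ge0 : 0 <= e) (s2_ge0 : 0 <= s2)
  (s2e : (spectral_norm W + (Pmax + a) * spectral_norm B ^+ 2) * s2 <= e)
  (ea : N%:R * (e / (2 * a)) * Pmax <= a).

Lemma perturbed_possemidef k : possemidef (Pt k).
Proof.
elim: k => [|k IH]; first by rewrite Pt0; exact: QN_possemidef.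
by rewrite PtS; exact: policy_cost_possemidef.
Qed.

Lemma hess_norm P y : possemidef P -> spectral_norm P <= Pmax + a ->
  quad (hess B W P) y <=
  (spectral_norm W + (Pmax + a) * spectral_norm B ^+ 2) * sqn y.
Proof.
move=> Pp Pn; rewrite quad_hess mulrDl lerD ?quad_le_spectral_norm//.
rewrite (le_trans (quad_le_spectral_norm _ _))// -mulrA.
by rewrite ler_pM ?spectral_norm_ge0 ?sqn_ge0// sqn_mulmx.
Qed.

(** Here [e] is the excess cost of an inexact gain per unit |z|^2 and [2 a] a lower bound for [Q],
    so each stage adds [e / (2 a)] to the relative error. The induction carries the order bounds;
    [ea] turns them into |Pt k| <= Pmax + a, which bounds the Hessian in the next step. *)
Lemma perturbed_bounds k : (k <= N)%N ->
  (forall j, (j < k)%N -> frob2 (K j - gain A B W (Pt j)) <= s2) ->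
  [/\ forall z, quad (ric k) z <= quad (Pt k) z,
      forall z, quad (Pt k) z <= (1 + k%:R * (e / (2 * a))) * quad (ric k) z,
      spectral_norm (Pt k - ric k) <= N%:R * (e / (2 * a)) * Pmax &
      spectral_norm (Pt k) <= Pmax + a].
Proof.
move=> kN acc; have d0 : 0 <= e / (2 * a) by rewrite divr_ge0// mulr_ge0// ltW.
(* Granted the order bounds, [Pt k - ric k] and [Pt k] are semidefinite, so bounds on the forms are
   bounds on the norms. *)
suff [lo hi] : (forall z, quad (ric k) z <= quad (Pt k) z) /\
   (forall z, quad (Pt k) z <= (1 + k%:R * (e / (2 * a))) * quad (ric k) z).
  have Pn := ltW Pmax_gt0.
  have rn z : quad (ric k) z <= Pmax * sqn z.
    rewrite (le_trans (quad_le_spectral_norm _ _))// ler_wpM2r ?sqn_ge0//.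
    exact: ric_norm.
  have kN' : k%:R * (e / (2 * a)) <= N%:R * (e / (2 * a)).
    by rewrite ler_wpM2r// ler_nat.
  have kd0 : 0 <= k%:R * (e / (2 * a)) by rewrite mulr_ge0.
  have Nd0 : 0 <= N%:R * (e / (2 * a)) by rewrite mulr_ge0.
  have diff z : quad (Pt k - ric k) z <= N%:R * (e / (2 * a)) * Pmax * sqn z.
    rewrite quadBM; move: kN' kd0 (hi z) (rn z) ((ric_possemidef k).2 z).
    move: (k%:R * _) (N%:R * _) => x y xy x0 h1 h2 h3.
    rewrite -mulrA; apply: (@le_trans _ _ (x * quad (ric k) z)); first by lra.
    by apply: ler_pM.
  split=> //.
    apply: spectral_norm_possemidef => //; last by rewrite mulr_ge0.
    split; first by rewrite linearB /= (perturbed_possemidef k).1 (ric_possemidef k).1.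
    by move=> z; rewrite quadBM subr_ge0.
  apply: spectral_norm_possemidef; first exact: perturbed_possemidef.
    by rewrite addr_ge0// ltW.
  move=> z; have := le_trans (diff z) (ler_wpM2r (sqn_ge0 z) ea).
  have := rn z; rewrite quadBM; lra.
elim: k kN acc => [|k IH] kN acc.
  by split=> z; rewrite Pt0 ?mul0r ?addr0 ?mul1r.
have [lo hi] := IH (ltnW kN) (fun j jk => acc j (ltnW jk)).
have Ppk := perturbed_possemidef k; have Prk := ric_possemidef k.
split=> z; rewrite PtS /=.
  apply: le_trans _ (@quad_riccati_step_le _ _ _ A B Q W Wpos _ (K k) z Ppk).
  exact: riccati_step_mono.
have Pn : spectral_norm (Pt k) <= Pmax + a.
  apply: spectral_norm_possemidef => //; first by rewrite addr_ge0 ?(ltW Pmax_gt0) ?(ltW a_gt0).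
  move=> y; rewrite (le_trans (hi y))//.
  have h1 : quad (ric k) y <= Pmax * sqn y.
    by rewrite (le_trans (quad_le_spectral_norm _ _))// ler_wpM2r ?sqn_ge0// ric_norm.
  have h2 : k%:R * (e / (2 * a)) <= N%:R * (e / (2 * a)).
    by rewrite ler_wpM2r// ler_nat ltnW.
  have h3 : 0 <= k%:R * (e / (2 * a)) by rewrite mulr_ge0.
  rewrite (@le_trans _ _ ((1 + k%:R * (e / (2 * a))) * (Pmax * sqn y)))//.
    by rewrite ler_wpM2l// addr_ge0.
  rewrite mulrA ler_wpM2r ?sqn_ge0// mulrDl mul1r lerD2l (le_trans _ ea)//.
  by rewrite ler_wpM2r// (ltW Pmax_gt0).
rewrite quad_policy_cost_gain//.
have step : quad (riccati_step A B Q W (Pt k)) z <=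
    (1 + k%:R * (e / (2 * a))) * quad (F (ric k)) z.
  by apply: riccati_step_le_scale => //; rewrite lerDl mulr_ge0.
have err : quad (hess B W (Pt k)) ((K k - gain A B W (Pt k)) *m z) <= e * sqn z.
  rewrite (le_trans (hess_norm _ Ppk Pn))//.
  rewrite (@le_trans _ _ ((spectral_norm W + (Pmax + a) * spectral_norm B ^+ 2)
    * s2 * sqn z))//; last by rewrite ler_wpM2r ?sqn_ge0.
  rewrite -mulrA ler_wpM2l//.
    rewrite addr_ge0 ?spectral_norm_ge0// mulr_ge0 ?sqr_ge0//.
    by rewrite addr_ge0 ?(ltW Pmax_gt0) ?(ltW a_gt0).
  rewrite (le_trans (sqn_mulmx_frob2 _ _))// ler_wpM2r ?sqn_ge0//.
  exact: acc.
(* The absolute excess becomes a relative one: [2 a |z|^2] is below [Q], and [Q] is below every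
   value of the Riccati operator. *)
have eQ : e * sqn z <= e / (2 * a) * quad (F (ric k)) z.
  have -> : e * sqn z = e / (2 * a) * (2 * a * sqn z).
    by field; rewrite gt_eqF.
  rewrite ler_wpM2l// (le_trans (aQ z))//.
  exact: quad_Q_le_policy_cost.
have -> : (1 + k.+1%:R * (e / (2 * a))) * quad (F (ric k)) z =
    (1 + k%:R * (e / (2 * a))) * quad (F (ric k)) z
    + e / (2 * a) * quad (F (ric k)) z.
  by rewrite -natr1 [(k%:R + 1) * _]mulrDl mul1r addrA mulrDl.
by rewrite lerD// (le_trans err).
Qed.

End perturbed.

End riccati_iteration.

(** * From accurate stages to an accurate policy *)

Section accuracy.
Context {R : realType} {n m : nat}.
Variable p : rhpg_setting R n m.

Local Notation A := (sysA p).
Local Notation B := (sysB p).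
Local Notation Q := (costQ p).
Local Notation W := (costR p).
Local Notation QN := (terminalQ p).
Local Notation Pst := (optimalP p).
Local Notation eps := (accuracy p).
Local Notation N := (horizon p).
Local Notation Kst := (gain A B W Pst).
Local Notation AK := (A - B *m Kst).
Local Notation rho := (norm_wrt Pst AK).
Local Notation ric k := (iter k (riccati_step A B Q W) QN).
Local Notation Pm := (cst_Pmax p).
Local Notation a := (cst_a p).
Local Notation C1 := (cst_C1 p).
Local Notation C3 := (cst_C3 p).

Hypotheses (Qpos : posdef Q) (Wpos : posdef W) (Ppos : posdef Pst).
Hypotheses (Pare : solves_riccati A B Q W Pst) (QNge : possemidef (QN - Pst)).
Hypotheses (A_neq0 : A != 0) (B_neq0 : B != 0) (QN_neq : QN != Pst).
Hypotheses (eps_gt0 : 0 < eps) (N_gt0 : (0 < N)%N).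

Lemma dim_state_gt0 : (0 < n)%N.
Proof.
rewrite lt0n; apply: contraNneq A_neq0 => n0; apply/eqP/matrixP => -[i lt_in].
by exfalso; rewrite n0 in lt_in.
Qed.

Lemma dim_input_gt0 : (0 < m)%N.
Proof.
rewrite lt0n; apply: contraNneq B_neq0 => m0; apply/eqP/matrixP => i [j lt_jm].
by exfalso; rewrite m0 in lt_jm.
Qed.

Let n_gt0 := dim_state_gt0.
Let m_gt0 := dim_input_gt0.

(** A vanishing closed loop would give [W G = 0] by stationarity, hence [G = 0] and [A = 0]. This
    makes [cst_C1] positive and the logarithms in the horizon meaningful. *)
Lemma closed_loop_neq0 P : possemidef P -> A - B *m gain A B W P != 0.
Proof.
move=> Pp; apply/eqP => C0; move/eqP: A_neq0; apply.
have := W_gain A B Wpos Pp; rewrite C0 mulmx0 => WG.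
have G0 : gain A B W P = 0.
  by rewrite -(mulKmx (posdef_unitmx Wpos) (gain A B W P)) WG mulmx0.
by have := C0; rewrite G0 mulmx0 subr0.
Qed.

Lemma cst_a_gt0 : 0 < a.
Proof.
by have [q0 qE _] := lambda_minE n_gt0 Qpos; rewrite /cst_a qE divr_gt0.
Qed.

Lemma cst_aP z : 2 * a * sqn z <= quad Q z.
Proof.
have [_ qE qP] := lambda_minE n_gt0 Qpos.
by rewrite /cst_a qE [2 * (_ / _)]mulrC divfK ?pnatr_eq0.
Qed.

Lemma cst_Pmax_gt0 : 0 < Pm.
Proof. exact: Pmax_gt0. Qed.

Lemma spectral_norm_B_gt0 : 0 < spectral_norm B.
Proof. exact: spectral_norm_gt0. Qed.

(** After [N.-1] steps the recursion is at time 1, whose gain is the one of time 0 in the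
    maximum. *)
Lemma cst_phi_ge : spectral_norm (A - B *m gain A B W (ric N.-1)) <= cst_phi p.
Proof.
have -> : gain A B W (ric N.-1) = riccati_K p 0 by rewrite /riccati_K /riccati_P subn1.
by rewrite /cst_phi (bigD1 (Ordinal N_gt0))//= le_max lexx.
Qed.

Lemma cst_C1_gt0 : 0 < C1.
Proof.
have [w0 _ _] := lambda_minE m_gt0 Wpos.
rewrite /cst_C1 divr_gt0// mulr_gt0 ?spectral_norm_B_gt0//.
rewrite (lt_le_trans _ cst_phi_ge)// spectral_norm_gt0// closed_loop_neq0//.
exact: (ric_possemidef A B Qpos Wpos Ppos QNge).
Qed.

Lemma cst_C3_gt0 : 0 < C3.
Proof.
rewrite /cst_C3 mulr_gt0// ltr_wpDl ?spectral_norm_ge0// mulr_gt0//.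
  by rewrite addr_gt0 ?cst_Pmax_gt0 ?cst_a_gt0.
by rewrite exprn_gt0// spectral_norm_B_gt0.
Qed.

Let NR_gt0 : 0 < N%:R :> R. Proof. by rewrite ltr0n. Qed.

Let pos := (cst_a_gt0, cst_C3_gt0, cst_C1_gt0, cst_Pmax_gt0, expR_gt0, NR_gt0).

Lemma target_accuracy_gt0 h : 0 < target_accuracy p h.
Proof.
rewrite /target_accuracy; case: ifP => _; first by rewrite divr_gt0.
rewrite !lt_min !sqrtr_gt0; apply/and4P.
by split; do ?[rewrite pos | apply: divr_gt0 | apply: mulr_gt0].
Qed.

(** The first bound keeps the computed matrices within [a] of the exact ones; the second makes the
    resulting error of the gain a fraction of [eps]. *)
Lemma target_accuracy_sqr h : (0 < h)%N ->
  target_accuracy p h ^+ 2 <= a / C3 * (a / (2 * expR 1 * N%:R * Pm)) /\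
  target_accuracy p h ^+ 2 <= a / C3 * (eps / (8 * expR 1 * N%:R * C1 * Pm)).
Proof.
move=> h0; have t0 := target_accuracy_gt0 h.
have sq x : 0 < x -> target_accuracy p h <= Num.sqrt x -> target_accuracy p h ^+ 2 <= x.
  move=> x0 tx; rewrite -[leRHS]sqr_sqrtr ?(ltW x0)//.
  by rewrite ler_pow2 ?(ltW t0)// sqrtr_ge0.
have tE : target_accuracy p h <=
   Num.min (Num.sqrt (a / C3 * (1 / N%:R)))
 (Num.min (Num.sqrt (a / C3 * (a / (2 * expR 1 * N%:R * Pm))))
 (Num.min (Num.sqrt (a / C3 * (eps / (8 * expR 1 * N%:R * C1 * Pm))))
          (Num.sqrt (eps / (4 * C1 * C3))))).
  by rewrite /target_accuracy gtn_eqF// lexx.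
move: tE; rewrite !le_min => /and4P[_ t2 t3 _].
by split; apply: sq => //; do ?[rewrite pos | apply: divr_gt0 | apply: mulr_gt0].
Qed.

Lemma target_accuracyE h : (0 < h)%N -> target_accuracy p h = target_accuracy p 1.
Proof. by case: h. Qed.

Variables (Pt : nat -> 'M[R]_n) (K : nat -> 'M[R]_(m, n)).
Hypotheses (Pt0 : Pt 0%N = QN)
  (PtS : forall k, Pt k.+1 = policy_cost A B Q W (Pt k) (K k)).

Let s2 := target_accuracy p 1 ^+ 2.
(** [cst_C3] is twice the bound on the Hessian, so this is the excess cost caused by a gain of
    squared error [s2]. All stages [h >= 1] share the accuracy of stage 1. *)
Let e := C3 / 2 * s2.

Let e_ge0 : 0 <= e.
Proof. by rewrite mulr_ge0 ?sqr_ge0// divr_ge0// ltW ?cst_C3_gt0. Qed.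

Let e_fine : (spectral_norm W + (Pm + a) * spectral_norm B ^+ 2) * s2 <= e.
Proof. by rewrite /e /cst_C3 [2 * (_ + _)]mulrC mulfK ?pnatr_eq0. Qed.

Let expR1_ge1 : 1 <= expR 1 :> R.
Proof. by rewrite -[leLHS]expR0 ler_expR. Qed.

Let inv2a_ge0 : 0 <= (2 * a)^-1.
Proof. by rewrite invr_ge0 pmulr_rge0// ltW// cst_a_gt0. Qed.

Let e_a : N%:R * (e / (2 * a)) * Pm <= a / (8 * expR 1).
Proof.
have [h _] := target_accuracy_sqr (ltnSn 0).
have -> : a / (8 * expR 1) =
    N%:R * (C3 / 2 * (a / C3 * (a / (2 * expR 1 * N%:R * Pm))) / (2 * a)) * Pm.
  by field; rewrite !gt_eqF ?pos.
rewrite ler_wpM2r ?(ltW cst_Pmax_gt0)// ler_wpM2l ?(ltW NR_gt0)//.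
rewrite ler_wpM2r//.
by rewrite /e ler_wpM2l// divr_ge0// ltW ?cst_C3_gt0.
Qed.

Let e_eps : N%:R * (e / (2 * a)) * Pm <= eps / (32 * expR 1 * C1).
Proof.
have [_ h] := target_accuracy_sqr (ltnSn 0).
have -> : eps / (32 * expR 1 * C1) =
    N%:R * (C3 / 2 * (a / C3 * (eps / (8 * expR 1 * N%:R * C1 * Pm))) / (2 * a)) * Pm.
  by field; rewrite !gt_eqF ?pos.
rewrite ler_wpM2r ?(ltW cst_Pmax_gt0)// ler_wpM2l ?(ltW NR_gt0)//.
rewrite ler_wpM2r//.
by rewrite /e ler_wpM2l// divr_ge0// ltW ?cst_C3_gt0.
Qed.

Let ea : N%:R * (e / (2 * a)) * Pm <= a.
Proof.
rewrite (le_trans e_a)// ler_pdivrMr ?mulr_gt0 ?expR_gt0// ler_peMr ?(ltW cst_a_gt0)//.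
by have := expR1_ge1; lra.
Qed.

Lemma stage_P_possemidef k : possemidef (Pt k).
Proof. exact: (perturbed_possemidef Qpos Wpos Ppos QNge Pt0 PtS). Qed.

(** For [j < k < N] the stage index [N - j.+1] is positive, so the common accuracy applies; the
    accuracy [eps / 4] of stage 0 enters only at the output. *)
Let bounds k : (k < N)%N ->
  (forall j, (j < k)%N ->
    frob2 (K j - gain A B W (Pt j)) <= target_accuracy p (N - j.+1) ^+ 2) ->
  spectral_norm (Pt k - ric k) <= N%:R * (e / (2 * a)) * Pm /\
  spectral_norm (Pt k) <= Pm + a.
Proof.
move=> kN acc.
have [||_ _ h1 h2] := @perturbed_bounds _ _ _ A B Q W QN Pst Qpos Wpos Ppos Pare QNge
  n_gt0 Pt K N e s2 a Pt0 PtS cst_a_gt0 cst_aP e_ge0 e_fine ea k; rewrite ?(ltnW kN)//.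
move=> j jk; rewrite /s2 -(@target_accuracyE (N - j.+1)) ?acc//.
by rewrite subn_gt0 (leq_ltn_trans jk).
Qed.

Lemma stage_P_norm k : (k < N)%N ->
  (forall j, (j < k)%N ->
    frob2 (K j - gain A B W (Pt j)) <= target_accuracy p (N - j.+1) ^+ 2) ->
  spectral_norm (Pt k) <= Pm + a.
Proof. by move=> kN /(bounds kN)[]. Qed.

(** Three errors add up: the last optimisation, at most [eps / 4]; the inexact matrix it starts
    from, at most [eps / 4]; the finite horizon, at most [eps / 2]. The last two go through the
    Lipschitz bound on the gain. *)
Lemma accurate_stages_output :
  2 * norm_wrt Pst (QN - Pst) * condition_number Pst * spectral_norm AK
    * spectral_norm B * rho ^+ (2 * N.-1) <= eps * lambda_min W ->
  (forall j, (j < N)%N ->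
    frob2 (K j - gain A B W (Pt j)) <= target_accuracy p (N - j.+1) ^+ 2) ->
  spectral_norm (K N.-1 - Kst) <= eps.
Proof.
move=> rate acc; have N1 : (N.-1 < N)%N by rewrite prednK.
have [w0 _ _] := lambda_minE m_gt0 Wpos.
have [||h1 _] := @bounds N.-1 => // [j jN|].
  by apply: acc; rewrite (ltn_trans jN).
have ricp := ric_possemidef A B Qpos Wpos Ppos QNge N.-1.
have Ptp := stage_P_possemidef N.-1.
have -> : K N.-1 - Kst = (K N.-1 - gain A B W (Pt N.-1)) +
  ((gain A B W (Pt N.-1) - gain A B W (ric N.-1)) + (gain A B W (ric N.-1) - Kst)).
  by rewrite !addrA !subrK.
have T1 : spectral_norm (K N.-1 - gain A B W (Pt N.-1)) <= eps / 4.
  have := acc _ N1; rewrite prednK// subnn /target_accuracy eqxx => h.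
  rewrite (le_trans (spectral_norm_frob2 _))// -[leRHS]ger0_norm ?divr_ge0 ?(ltW eps_gt0)//.
  by rewrite -sqrtr_sqr ler_wsqrtr.
have T2 : spectral_norm (gain A B W (Pt N.-1) - gain A B W (ric N.-1)) <= eps / 4.
  rewrite (le_trans (gain_lipschitz A B Wpos m_gt0 ricp Ptp))//.
  rewrite (@le_trans _ _ (C1 * (eps / (32 * expR 1 * C1))))//.
    rewrite ler_pM ?spectral_norm_ge0 ?mulr_ge0 ?invr_ge0 ?spectral_norm_ge0 ?(ltW w0)//.
      by rewrite /cst_C1 !ler_wpM2r ?invr_ge0 ?spectral_norm_ge0 ?(ltW w0) ?cst_phi_ge.
    exact: le_trans h1 e_eps.
  have -> : C1 * (eps / (32 * expR 1 * C1)) = eps / (32 * expR 1).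
    by field; rewrite !gt_eqF ?pos.
  rewrite ler_wpM2l ?(ltW eps_gt0)// lef_pV2 ?posrE ?mulr_gt0 ?expR_gt0//.
  by have := expR1_ge1; lra.
(* The Lipschitz bound is taken at [Pst], so its factor is the norm of [AK] that the horizon formula
   contains. *)
have T3 : spectral_norm (gain A B W (ric N.-1) - Kst) <= eps / 2.
  rewrite (le_trans (gain_lipschitz A B Wpos m_gt0 (posdef_possemidef Ppos) ricp))//.
  rewrite ler_pdivlMr// -(ler_pM2r w0).
  have h2 := ricB_norm Qpos Wpos Ppos Pare QNge n_gt0 N.-1.
  apply: le_trans _ rate; move: (rho ^+ _) h2 => r.
  set x := spectral_norm AK; set y := spectral_norm B; set w := lambda_min W.
  move: (condition_number Pst) (norm_wrt _ _) => c u h2.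
  have -> : x * y / w * spectral_norm (ric N.-1 - Pst) * 2 * w =
    2 * (x * y) * spectral_norm (ric N.-1 - Pst) by field; rewrite gt_eqF.
  have -> : 2 * u * c * x * y * r = 2 * (x * y) * (c * u * r) by ring.
  by rewrite ler_wpM2l// !mulr_ge0 ?spectral_norm_ge0.
have -> : eps = eps / 4 + (eps / 4 + eps / 2) by field.
move: (K _ - _) (gain _ _ _ (Pt _) - _) (gain _ _ _ _ - Kst) T1 T2 T3 => X Y Z T1 T2 T3.
rewrite (le_trans (spectral_normD _ _))// lerD// (le_trans (spectral_normD _ _))//.
exact: lerD.
Qed.

End accuracy.

(** * Independence *)

Lemma le_integrable_real d (T : measurableType d) (R : realType)
    (mu : {measure set T -> \bar R}) (D : set T) (f g : T -> R) :
  measurable D -> measurable_fun D f -> (forall x, D x -> `|f x| <= g x) ->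
  mu.-integrable D (EFin \o g) -> mu.-integrable D (EFin \o f).
Proof.
move=> mD mf fg ig; apply: (le_integrable mD _ _ ig).
  exact/measurable_EFinP.
by move=> x Dx /=; rewrite !lee_fin (le_trans (fg x Dx))// ler_norm.
Qed.

Section independence.
Local Open Scope ereal_scope.
Context d (T : measurableType d) (R : realType) (P : probability T R).

Definition independent_systems (G H : set_system T) : Prop :=
  forall A B, G A -> H B -> P (A `&` B) = P A * P B.

Lemma independent_systemsC G H :
  independent_systems G H -> independent_systems H G.
Proof. by move=> GH A B HA GB; rewrite setIC muleC GH. Qed.

Lemma independent_systems_sub G G' H H' : G `<=` G' -> H `<=` H' ->
  independent_systems G' H' -> independent_systems G H.
Proof. by move=> GG' HH' h A B /GG' GA /HH' HB; exact: h. Qed.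

(** Dynkin's argument: for fixed [A], the restriction of [P] to [A] and [P A] times [P] are finite
    measures that agree on the pi-system [H], hence on the sigma-algebra it generates. *)
Lemma independent_systems_sigma G H : G `<=` measurable -> H `<=` measurable ->
  setI_closed H -> H setT -> independent_systems G H ->
  independent_systems G <<s H >>.
Proof.
move=> Gm Hm HI HT GH A B GA.
have mA := Gm _ GA.
pose m1 := mrestr P mA.
have PA0 : (0 <= fine (P A))%R by rewrite fine_ge0.
pose m2 := mscale (NngNum PA0) P.
have m2E C : m2 C = P A * P C.
  by rewrite -[in RHS](@fineK _ (P A)) ?fin_num_measure.
move=> HB; rewrite setIC; transitivity (m1 B) => //; transitivity (m2 B).
  apply: (@g_sigma_algebra_measure_unique _ _ _ H Hm (fun=> setT)) => //.
  - by rewrite bigcup_const.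
  - by move=> C HC; rewrite /= [RHS]m2E /m1 /mrestr setIC GH.
  - move=> _; change (P (setT `&` A) < +oo).
    by rewrite setTI (le_lt_trans (probability_le1 P mA)) ?ltry.
exact: m2E.
Qed.

Variables (I : eqType) (F : I -> set_system T).
Hypotheses (Fm : forall k, F k `<=` measurable) (FT : forall k, F k setT)
  (FI : forall k, setI_closed (F k)) (indF : mutually_independent P F).

(** A pi-system that generates the joint sigma-algebra and to which mutual independence applies
    directly. *)
Definition finite_intersections (J : set I) : set_system T :=
  [set E | exists s : seq I, exists E_ : I -> set T,
    [/\ uniq s, [set` s] `<=` J, forall i, F i (E_ i)
      & E = \bigcap_(i in [set` s]) E_ i]].

Lemma finite_intersections_setT J : finite_intersections J setT.
Proof.
exists [::], (fun=> setT); split=> //.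
by apply/esym/seteqP; split=> // w _ i.
Qed.

Lemma finite_intersections_measurable J : finite_intersections J `<=` measurable.
Proof.
move=> _ [s [E [_ _ FE ->]]]; apply: fin_bigcap_measurable => // i _.
exact: (Fm (FE i)).
Qed.

Lemma finite_intersections_setI J : setI_closed (finite_intersections J).
Proof.
move=> _ _ [s [E [us sJ FE ->]]] [s' [E' [us' sJ' FE' ->]]].
exists (undup (s ++ s')), (fun i => (if i \in s then E i else setT) `&`
  (if i \in s' then E' i else setT)); split.
- exact: undup_uniq.
- by move=> i /=; rewrite mem_undup mem_cat => /orP[/sJ|/sJ'].
- by move=> i; apply: FI; case: ifP.
apply/seteqP; split=> [w [h h'] i /= _|w h].
  by split; case: ifP => // is_; [exact: h|exact: h'].
split=> i /= is_; have := h i; rewrite /= mem_undup mem_cat is_ ?orbT.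
  by move=> /(_ isT)[].
by move=> /(_ isT)[].
Qed.

Lemma finite_intersections_independent J1 J2 : [disjoint J1 & J2]%classic ->
  independent_systems (finite_intersections J1) (finite_intersections J2).
Proof.
move=> /disj_setPS J12 _ _ [s [E [us sJ FE ->]]] [s' [E' [us' sJ' FE' ->]]].
(* The index sets are disjoint, so the two families glue into a single one. *)
pose E2 i := if i \in s then E i else E' i.
have ss' i : i \in s -> i \notin s'.
  by move=> /= is_; apply/negP => is'; apply: (J12 i); split; [exact: sJ|exact: sJ'].
have -> : (\bigcap_(i in [set` s]) E i) `&` (\bigcap_(i in [set` s']) E' i) =
   \bigcap_(i in [set` s ++ s']) E2 i.
  apply/seteqP; split=> [w [h h'] i /=|w h].
    by rewrite mem_cat /E2; case: ifPn => [is_ _|_ /= is_]; [exact: h|exact: h'].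
  split=> i /= is_; have := h i; rewrite /= mem_cat is_ ?orbT /E2.
    by rewrite is_; apply.
  by rewrite ifN; [apply|apply/negP => /ss'; rewrite is_].
rewrite indF; first last.
- by move=> i _; rewrite /E2; case: ifP.
- rewrite cat_uniq us us' andbT/=; apply/hasPn => i is'.
  by apply/negP => /ss'; rewrite is'.
rewrite big_cat/= indF// indF//; congr (_ * _); rewrite !big_seq.
  by apply: eq_bigr => i; rewrite /E2 => ->.
by apply: eq_bigr => i is'; rewrite /E2 ifN//; apply/negP => /ss'; rewrite is'.
Qed.

Definition joint_sigma (J : set I) : set_system T := <<s \bigcup_(k in J) F k >>.

Lemma joint_sigma_sub J :
  joint_sigma J `<=` <<s finite_intersections J >>.
Proof.
apply: smallest_sub; first exact: smallest_sigma_algebra.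
move=> A [k Jk FA]; apply: sub_sigma_algebra.
exists [:: k], (fun i => if i == k then A else setT); split=> //.
- by move=> i /=; rewrite inE => /eqP ->.
- by move=> i; case: eqP => [->|_].
apply/seteqP; split=> [w Aw i /=|w h].
  by rewrite inE => /eqP ->; rewrite eqxx.
by have := h k; rewrite /= inE eqxx; apply.
Qed.

(** Pass from the pi-system to the sigma-algebra on one side, swap, and repeat on the other side. *)
Lemma joint_sigma_independent J1 J2 : [disjoint J1 & J2]%classic ->
  independent_systems (joint_sigma J1) (joint_sigma J2).
Proof.
move=> J12.
have sm J : <<s finite_intersections J >> `<=` measurable.
  apply: smallest_sub; first exact: sigma_algebra_measurable.
  exact: finite_intersections_measurable.
apply: (independent_systems_sub (@joint_sigma_sub J1) (@joint_sigma_sub J2)).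
apply: independent_systems_sigma => //.
- exact: finite_intersections_measurable.
- exact: finite_intersections_setI.
- exact: finite_intersections_setT.
apply: independent_systemsC; apply: independent_systems_sigma => //.
- exact: finite_intersections_measurable.
- exact: finite_intersections_measurable.
- exact: finite_intersections_setI.
- exact: finite_intersections_setT.
by apply: independent_systemsC; exact: finite_intersections_independent.
Qed.

End independence.

(** * Tonelli and Fubini for independent variables *)

Section independent_pair.
Local Open Scope ereal_scope.
Context d d1 d2 (T : measurableType d) (T1 : measurableType d1)
  (T2 : measurableType d2) (R : realType) (P : probability T R).
Variables (X : T -> T1) (Y : T -> T2).
Hypotheses (mX : measurable_fun setT X) (mY : measurable_fun setT Y).
Hypothesis XY : independent_systems P (generated_by X) (generated_by Y).

Let X' := HB.pack_for {mfun T >-> T1} X (isMeasurableFun.Build _ _ T T1 X mX).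
Let Y' := HB.pack_for {mfun T >-> T2} Y (isMeasurableFun.Build _ _ T T2 Y mY).
Let mZ : measurable_fun setT (fun w => (X w, Y w)).
Proof. exact: measurable_fun_pair. Qed.
Let Z := HB.pack_for {mfun T >-> (T1 * T2)%type} (fun w => (X w, Y w))
  (isMeasurableFun.Build _ _ T (T1 * T2)%type (fun w => (X w, Y w)) mZ).

Lemma distribution_pair (C : set (T1 * T2)) : measurable C ->
  distribution P Z C = (distribution P X' \x distribution P Y') C.
Proof.
move=> mC; apply/esym; apply: product_measure_unique => // A B mA mB.
rewrite /distribution /pushforward -XY.
- by congr (P _); apply/seteqP; split=> w.
- by exists A => //; rewrite setTI.
- by exists B => //; rewrite setTI.
Qed.

(** Stands in for conditioning on [X]: the inner integral runs over an independent copy of [Y] while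
    [X w] is frozen. It holds because the joint law is the product law. *)
Lemma ge0_integral_independent (f : T1 * T2 -> \bar R) :
  measurable_fun setT f -> (forall z, 0 <= f z) ->
  \int[P]_w f (X w, Y w) = \int[P]_w \int[P]_w' f (X w, Y w').
Proof.
move=> mf f0.
have -> : \int[P]_w f (X w, Y w) = \int[distribution P Z]_z f z.
  by rewrite (ge0_integral_distribution Z).
rewrite (eq_measure_integral (distribution P X' \x distribution P Y')%E); last first.
  by move=> C mC _; exact: distribution_pair.
rewrite fubini_tonelli1// (ge0_integral_distribution X').
- apply: eq_integral => w _ /=; rewrite /fubini_F.
  rewrite (ge0_integral_distribution Y')//.
  exact: measurableT_comp mf (measurable_fun_pair (measurable_cst _) (@measurable_id _ _ _)).
- exact: (measurable_fun_fubini_tonelli_F f).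
- by move=> x; exact: integral_ge0.
Qed.

End independent_pair.

Section independent_product.
Context d (T : measurableType d) (R : realType) (P : probability T R).
Variables X Y : T -> R.
Hypotheses (iX : P.-integrable setT (EFin \o X))
  (iY : P.-integrable setT (EFin \o Y)).
Hypothesis XY : independent_systems P (generated_by X) (generated_by Y).

Let mX : measurable_fun setT X.
Proof. exact/measurable_EFinP/(measurable_int P). Qed.

Let mY : measurable_fun setT Y.
Proof. exact/measurable_EFinP/(measurable_int P). Qed.

Lemma integrable_independentM : P.-integrable setT (EFin \o (X \* Y)).
Proof.
apply/integrableP; split.
  by apply/measurable_EFinP; exact: measurable_funM.
pose f (z : R * R) := (`|z.1 * z.2|%:E)%E.
rewrite (_ : (\int[P]_x _)%E = (\int[P]_w f (X w, Y w))%E); last first.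
  by apply: eq_integral => w _.
rewrite (ge0_integral_independent mX mY XY); last 2 first.
- apply/measurable_EFinP; apply: measurableT_comp => //.
  by apply: measurable_funM; [exact: measurable_fst|exact: measurable_snd].
- by move=> z; rewrite lee_fin.
under eq_integral => w _.
  rewrite /f/=; under eq_integral => w' _ do rewrite normrM EFinM.
  rewrite integralZl//; last by exact: (integrable_abse iY).
  over.
rewrite /= -(@fineK _ (\int[P]_w `|Y w|%:E)%E); last first.
  exact: (integrable_fin_num measurableT (integrable_abse iY)).
rewrite integralZr//; last exact: (integrable_abse iX).
rewrite ltey_eq fin_numM//.
exact: (integrable_fin_num measurableT (integrable_abse iX)).
Qed.

Lemma Rintegral_independentM :
  \int[P]_w (X w * Y w) = \int[P]_w X w * \int[P]_w Y w.
Proof.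
pose X' := HB.pack_for {mfun T >-> R} X (isMeasurableFun.Build _ _ T R X mX).
pose Y' := HB.pack_for {mfun T >-> R} Y (isMeasurableFun.Build _ _ T R Y mY).
have mZ : measurable_fun setT (fun w => (X w, Y w)) by exact: measurable_fun_pair.
pose Z := HB.pack_for {mfun T >-> (R * R)%type} (fun w => (X w, Y w))
  (isMeasurableFun.Build _ _ T (R * R)%type (fun w => (X w, Y w)) mZ).
pose f (z : R * R) := ((z.1 * z.2)%:E)%E.
have mf : measurable_fun setT f.
  apply/measurable_EFinP; apply: measurable_funM; [exact: measurable_fst|exact: measurable_snd].
have ifZ : P.-integrable setT (f \o Z) by exact: integrable_independentM.
have dZ C : measurable C -> distribution P Z C = ((distribution P X' \x distribution P Y') C)%E.
  exact: distribution_pair.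
have ifD : ((distribution P X' \x distribution P Y')%E).-integrable setT f.
  apply/integrableP; split=> //.
  rewrite (eq_measure_integral (distribution P Z)); last first.
    by move=> C mC _; exact/esym/dZ.
  rewrite (ge0_integral_distribution Z) => [||z]; last exact: abse_ge0.
    by have /integrableP[] := ifZ.
  exact: measurableT_comp.
have iY' : (distribution P Y').-integrable setT EFin.
  by apply: (integrable_pushforward mY (mu := P)) => //; exact: EFin_measurable.
have iX' : (distribution P X').-integrable setT EFin.
  by apply: (integrable_pushforward mX (mu := P)) => //; exact: EFin_measurable.
rewrite /Rintegral -fineM; last 2 first.
- exact: integrable_fin_num.
- exact: integrable_fin_num.
congr fine.
transitivity (\int[distribution P Z]_z f z)%E.
  by rewrite (integral_distribution mf ifZ).
rewrite (eq_measure_integral (distribution P X' \x distribution P Y')%E); last first.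
  by move=> C mC _; exact: dZ.
rewrite -integral12_prod_meas1//.
transitivity (\int[distribution P X']_x (x%:E * \int[P]_w (Y w)%:E))%E.
  apply: eq_integral => x _; rewrite /fubini_F /f /=.
  have -> : (\int[P]_w (Y w)%:E = \int[distribution P Y']_y y%:E)%E.
    by rewrite (integral_distribution (X := Y') (f := EFin)).
  under eq_integral do rewrite EFinM.
  by rewrite integralZl.
rewrite -(@fineK _ (\int[P]_w (Y w)%:E)%E); last exact: integrable_fin_num.
rewrite integralZr//.
by rewrite (integral_distribution (X := X') (f := EFin)).
Qed.

End independent_product.

(** * Gaussian moments *)

Section normal_moments.
Context {R : realType}.
Local Notation phi := (@normal_pdf R 0 1).
Local Notation nu := (@normal_prob R 0 1).
Local Notation mu := (@lebesgue_measure R).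

Lemma normal_pdf01E : phi = (fun x => normal_peak 1 * expR (- (x ^+ 2 / 2))).
Proof.
apply/funext => x; rewrite normal_pdfE ?oner_eq0// /normal_fun subr0 expr1n.
by rewrite mulNr.
Qed.

(** The identity phi' = - x phi drives the moment recursions. *)
Lemma is_derive_normal_pdf01 (x : R) : is_derive x 1 phi (- x * phi x).
Proof.
rewrite normal_pdf01E.
have h : is_derive x 1 (fun x : R => - (x ^+ 2 / 2)) (- x).
  have -> : (fun x : R => - (x ^+ 2 / 2)) = (- 2^-1) \*: (fun x : R => x ^+ 2).
    by apply/funext => y; rewrite /= /GRing.scale /=; ring.
  apply: is_derive_eq; rewrite /GRing.scale /= !mulr1.
  by field.
have h2 := @is_derive1_comp _ (@expR R) (fun x : R => - (x ^+ 2 / 2)) x _ _ _ h.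
have -> : (fun x => normal_peak 1 * expR (- (x ^+ 2 / 2))) =
  normal_peak 1 \*: (expR \o (fun x : R => - (x ^+ 2 / 2))) by [].
apply: is_derive_eq; rewrite /= /GRing.scale /=; ring.
Qed.

Lemma FTC_segment (f F : R -> R) (a b : R) : a < b -> continuous f ->
  (forall x : R, is_derive x 1 F (f x)) ->
  \int[mu]_(x in `[a, b]) f x = F b - F a.
Proof.
move=> ab cf dF.
have cF : continuous F.
  move=> x; apply/differentiable_continuous/derivable1_diffP; exact: ex_derive.
rewrite /Rintegral (@continuous_FTC2 _ f F)//.
- exact: continuous_subspaceT.
- split; [by move=> x _; exact: ex_derive| |].
  + by apply: cvg_at_right_filter; exact: cF.
  + by apply: cvg_at_left_filter; exact: cF.
- by move=> x _; rewrite derive1E derive_val.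
Qed.


(** The density agrees almost everywhere with the Radon-Nikodym derivative of the law with respect
    to Lebesgue measure. *)
Lemma integral_normal_prob (U : set R) (f : R -> \bar R) : measurable U ->
  nu.-integrable U f ->
  (\int[nu]_(x in U) f x = \int[mu]_(x in U) (f x * (phi x)%:E))%E.
Proof.
move=> mU iff; have mf := measurable_int _ iff.
have dom : nu `<< mu by exact: normal_prob_dominates.
have mphi := measurable_normal_pdf (0 : R) 1.
rewrite -(Radon_Nikodym_change_of_variables dom)//=.
apply: ae_eq_integral => //.
- apply: emeasurable_funM => //; apply: (measurable_int mu).
  apply: (integrableS _ _ (@subsetT _ _)) => //=.
  exact: Radon_Nikodym_integrable.
- by apply: emeasurable_funM => //=; apply/measurable_EFinP; exact: measurable_funTS.
- apply: ae_eqe_mul2l => /=.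
  rewrite Radon_NikodymE//=; case: cid => /= h [h1 h2 h3].
  apply: integral_ae_eq => //=.
  + exact: integrableS h2.
  + by apply/measurable_EFinP; exact: measurable_funTS.
  + by move=> E EU mE; rewrite -h3.
Qed.

Let seg (r : R) : set R := `[- r, r]%classic.

Lemma integrable_pow_segment k (r : R) :
  nu.-integrable (seg r) (EFin \o (fun x : R => x ^+ k)).
Proof.
apply: (@le_integrable_real _ _ _ nu _ _ (cst (r ^+ k))).
- exact: measurable_itv.
- exact: measurable_funTS.
- move=> x; rewrite /seg /= in_itv /= => /andP[h1 h2].
  by rewrite normrX lerXn2r// ?nnegrE//; [lra|rewrite ler_norml h1 h2].
- apply: finite_measure_integrable_cst; exact: measurable_itv.
Qed.

Let J k r : R := \int[nu]_(x in seg r) x ^+ k.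

Let JE k r : J k r = \int[mu]_(x in seg r) (x ^+ k * phi x).
Proof.
rewrite /J /Rintegral integral_normal_prob//; first exact: measurable_itv.
exact: integrable_pow_segment.
Qed.

Let cphi : continuous phi.
Proof. exact: continuous_normal_pdf. Qed.

Let cpow k : continuous (fun x : R => x ^+ k * phi x).
Proof. by move=> x; apply: cvgM; [exact: exprn_continuous|exact: cphi]. Qed.

Let iphi k r : mu.-integrable (seg r) (EFin \o (fun x => x ^+ k * phi x)).
Proof.
apply: continuous_compact_integrable; first exact: segment_compact.
exact: continuous_subspaceT.
Qed.

Let czpow (c : R) k : continuous (fun x : R => c * (x ^+ k * phi x)).
Proof. by move=> x; apply: cvgM; [exact: cvg_cst|exact: cpow]. Qed.

Let izphi c k r : mu.-integrable (seg r) (EFin \o (fun x => c * (x ^+ k * phi x))).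
Proof.
apply: continuous_compact_integrable; first exact: segment_compact.
by apply: continuous_subspaceT; exact: czpow.
Qed.

Let phi_even r : phi (- r) = phi r.
Proof. by rewrite normal_pdf01E sqrrN. Qed.

Lemma normal_moment1_segment (r : R) : 0 < r -> J 1 r = 0.
Proof.
move=> r0; rewrite JE.
have dF (x : R) : is_derive x 1 (fun x => - phi x) (x ^+ 1 * phi x).
  by have h := is_derive_normal_pdf01 x; apply: is_derive_eq; rewrite expr1 mulNr opprK.
have := @FTC_segment (fun x => x ^+ 1 * phi x) (fun x => - phi x) (- r) r.
by rewrite gtrN// => -> //; rewrite phi_even subrr.
Qed.

(** Integration by parts with antiderivative [- x^(k+1) phi]. The boundary term is kept explicit
    because its sign, rather than its limit, is used for the even moments. *)
Lemma normal_momentS_segment (r : R) k : 0 < r ->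
  J k.+2 r = k.+1%:R * J k r - (r ^+ k.+1 - (- r) ^+ k.+1) * phi r.
Proof.
move=> r0; rewrite !JE.
have dF (x : R) : is_derive x 1 (fun x => - (x ^+ k.+1 * phi x))
    (x ^+ k.+2 * phi x - k.+1%:R * (x ^+ k * phi x)).
  have h := is_derive_normal_pdf01 x.
  have hX : is_derive x 1 (fun x : R => x ^+ k.+1) (k.+1%:R * x ^+ k).
    have -> : (fun x : R => x ^+ k.+1) = (id : R -> R) ^+ k.+1 by rewrite fctE.
    apply: (is_derive_eq (@is_deriveX _ _ id k.+1 x 1 1 (is_derive_id _ _))).
    by rewrite /GRing.scale /= mulr1.
  have hM := is_deriveM hX h.
  apply: (is_derive_eq (is_deriveN hM)).
  rewrite /GRing.scale /= !exprS; ring.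
have := @FTC_segment (fun x => x ^+ k.+2 * phi x - k.+1%:R * (x ^+ k * phi x))
  (fun x => - (x ^+ k.+1 * phi x)) (- r) r.
rewrite gtrN// => /(_ isT) H; have {H} := H _ dF.
rewrite RintegralB//; [|exact: iphi|]; last first.
  exact: izphi.
rewrite RintegralZl//; last exact: iphi.
move=> H; have : forall a b c : R, a - b = c -> a = b + c by move=> a b c <-; ring.
apply; rewrite H; first by rewrite phi_even; ring.
move=> x; apply: cvgB; first exact: cpow.
exact: czpow.
Qed.


(** For an even moment the boundary term of the recursion is nonpositive, so the inequality holds on
    every segment and passes to the monotone limit before any integrability is known. *)
Lemma normal_even_momentS k :
  (\int[nu]_x (x ^+ (2 * k.+1))%:E <= (2 * k).+1%:R%:E * \int[nu]_x (x ^+ (2 * k))%:E)%E.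
Proof.
have even0 (j : nat) (x : R) : 0 <= x ^+ (2 * j) by rewrite exprM exprn_ge0// sqr_ge0.
have mpow (j : nat) D : measurable_fun D (fun x : R => (x ^+ j)%:E).
  by apply/measurable_EFinP; exact: measurable_funTS.
pose F (n : nat) := seg n.+1%:R.
have ndF : nondecreasing_seq F.
  move=> a b ab; apply/subsetPset => x; rewrite /F /seg /= !in_itv /= => /andP[h1 h2].
  have : a.+1%:R <= b.+1%:R :> R by rewrite ler_nat.
  by move=> h; apply/andP; split; lra.
have cupF : \bigcup_n F n = setT.
  apply/seteqP; split=> // x _; exists (Num.truncn `|x|) => //.
  by rewrite /F /seg /= in_itv /= -ler_norml ltW// truncnS_gt.
have mF n : measurable (F n) by exact: measurable_itv.
have : (\int[nu]_(x in F i) (x ^+ (2 * k.+1))%:E @[i --> \oo] -->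
   \int[nu]_(x in \bigcup_n F n) (x ^+ (2 * k.+1))%:E)%E.
  by apply: ge0_nondecreasing_set_cvg_integral; [exact: ndF|exact: mF|move=> n; exact: mpow|move=> n x _; rewrite lee_fin].
rewrite cupF.
move=> cv; rewrite -(cvg_lim _ cv)//; apply: lime_le; first by apply/cvg_ex; eexists; exact: cv.
apply: nearW => n.
have n0 : 0 < n.+1%:R :> R by rewrite ltr0n.
have fJ j : (\int[nu]_(x in F n) (x ^+ j)%:E)%E = (J j n.+1%:R)%:E.
  rewrite /J /Rintegral fineK//.
  apply: integrable_fin_num; first exact: measurable_itv.
  exact: integrable_pow_segment.
rewrite fJ mulnS normal_momentS_segment//.
apply: (@le_trans _ _ ((2 * k).+1%:R * J (2 * k) n.+1%:R)%:E).
  have oddN : (- n.+1%:R) ^+ (2 * k).+1 = - n.+1%:R ^+ (2 * k).+1 :> R.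
    by rewrite exprS exprM sqrrN -exprM mulNr -exprS.
  by rewrite lee_fin gerBl mulr_ge0 ?normal_pdf_ge0// oddN opprK addr_ge0// exprn_ge0.
rewrite EFinM -fJ; apply: lee_wpmul2l; first by rewrite lee_fin.
apply: ge0_subset_integral; [exact: measurable_itv|exact: measurableT|exact: mpow| |by []].
by move=> x _; rewrite lee_fin.
Qed.


Local Notation E k := (\int[nu]_x (x ^+ k)%:E)%E.

Let E0 : E 0 = 1%E.
Proof.
rewrite (eq_integral (cst 1%E)); last by move=> x _; rewrite expr0.
by rewrite integral_cst// mul1e; exact: probability_setT.
Qed.

Lemma normal_moment2_le : (E 2 <= 1)%E.
Proof. by have := normal_even_momentS 0; rewrite !muln0 muln1 E0 mule1. Qed.

Lemma normal_moment4_le : (E 4 <= 3%:R%:E)%E.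
Proof.
apply: le_trans (normal_even_momentS 1) _.
rewrite -[leRHS]mule1; apply: lee_wpmul2l; first by rewrite lee_fin.
exact: normal_moment2_le.
Qed.

Lemma normal_moment6_le : (E 6 <= 15%:R%:E)%E.
Proof.
apply: le_trans (normal_even_momentS 2) _.
have -> : 15%:R%:E = (5%:R%:E * 3%:R%:E)%E :> \bar R by rewrite -EFinM -natrM.
apply: lee_wpmul2l; first by rewrite lee_fin.
exact: normal_moment4_le.
Qed.

Lemma normal_integrable_sqr : nu.-integrable setT (EFin \o (fun x : R => x ^+ 2)).
Proof.
apply/integrableP; split; first by apply/measurable_EFinP.
under eq_integral do rewrite /= ger0_norm ?sqr_ge0//.
exact: le_lt_trans normal_moment2_le (ltry _).
Qed.

Lemma normal_integrable_id : nu.-integrable setT (EFin \o (fun x : R => x)).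
Proof.
apply: (@le_integrable_real _ _ _ nu _ _ (fun x : R => 1 + x ^+ 2)) => //.
  move=> x _; have := sqr_ge0 (`|x| - 1); rewrite -(real_normK (num_real x)).
  by have := normr_ge0 x; nra.
have : nu.-integrable setT ((EFin \o cst 1) \+ (EFin \o (fun x : R => x ^+ 2))).
  apply: integrableD => //; last exact: normal_integrable_sqr.
  exact: finite_measure_integrable_cst.
by apply: eq_integrable => // x _.
Qed.

Let m2_le : \int[nu]_x (x ^+ 2) <= 1 :> R.
Proof.
rewrite -lee_fin /Rintegral fineK; first exact: normal_moment2_le.
exact: (integrable_fin_num measurableT normal_integrable_sqr).
Qed.

Let mseg r : measurable (seg r). Proof. exact: measurable_itv. Qed.

Let splitJ (f : R -> R) r : nu.-integrable setT (EFin \o f) ->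
  \int[nu]_x f x = \int[nu]_(x in seg r) f x + \int[nu]_(x in ~` seg r) f x.
Proof.
move=> fi; rewrite -(setUv (seg r)); apply: Rintegral_setU.
- exact: mseg.
- by apply: measurableC; exact: mseg.
- by rewrite setUv.
- exact/disj_set2P/setICr.
Qed.

(** The second moment is at most 1, so whatever is dominated by [c x^2] outside the segment
    integrates to at most [c] there. *)
Let tail (f : R -> R) r c : 0 <= c -> nu.-integrable setT (EFin \o f) ->
  (forall x, ~ seg r x -> `|f x| <= c * x ^+ 2) ->
  `|\int[nu]_(x in ~` seg r) f x| <= c.
Proof.
move=> c0 fi fc; have mC : measurable (~` seg r) by exact: measurableC.
have fi' : nu.-integrable (~` seg r) (EFin \o f) by exact: integrableS fi.
have i2 := normal_integrable_sqr.
have i2' : nu.-integrable (~` seg r) (EFin \o (fun x : R => x ^+ 2)).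
  exact: integrableS i2.
apply: le_trans (le_normr_Rintegral _ fi') _; first by apply: measurableC; exact: mseg.
apply: (@le_trans _ _ (\int[nu]_(x in ~` seg r) (c * x ^+ 2))).
  apply: le_Rintegral.
  - by apply: measurableC; exact: mseg.
  - exact: integrable_norm.
  - have := @integrableZl _ _ _ _ _ _ c _ i2'.
    by move=> h; apply: h; apply: measurableC; exact: mseg.
  - by move=> x /fc.
rewrite RintegralZl// -[leRHS]mulr1 ler_wpM2l// (le_trans _ m2_le)//.
rewrite (splitJ r i2) lerDr; apply: Rintegral_ge0 => // x _; exact: sqr_ge0.
Qed.

Let seg_out (r x : R) : 0 < r -> ~ seg r x -> r <= `|x|.
Proof.
move=> r0 h; rewrite leNgt; apply/negP => xr; apply: h.
by rewrite /seg /= in_itv /= -ler_norml ltW.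
Qed.

(** The truncated mean vanishes by symmetry, and outside the segment |x| <= x^2 / r bounds the rest
    by 1 / r, for every [r]. *)
Lemma normal_moment1 : \int[nu]_x x = 0 :> R.
Proof.
have bnd (r : R) : 0 < r -> `|\int[nu]_x x| <= r^-1 :> R.
  move=> r0; rewrite (splitJ r normal_integrable_id).
  have -> : \int[nu]_(x in seg r) x = J 1 r by apply: eq_Rintegral => x _; rewrite expr1.
  rewrite normal_moment1_segment// add0r; apply: tail => //.
  - by rewrite invr_ge0 ltW.
  - exact: normal_integrable_id.
  - move=> x /(seg_out r0) rx; rewrite mulrC ler_pdivlMr//.
    by rewrite -(real_normK (num_real x)) expr2 ler_wpM2l.
apply/eqP; apply: contraT => m0.
set m := \int[nu]_x x in m0 bnd.
have mp : 0 < `|m| by rewrite normr_gt0.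
(* This [r] would give |m| <= |m| / 2. *)
have /bnd : 0 < 2 / `|m| by rewrite divr_gt0.
rewrite invf_div => h; have := lt_le_trans _ h.
by move=> /(_ (`|m| / 2)); rewrite ltxx => ->//; lra.
Qed.

(** Here an exact value is required: the identity covariance of the perturbation makes the gradient
    estimate unbiased. The lower bound comes from showing 1 - m <= constant / r for every
    [r >= 1]. *)
Lemma normal_moment2 : \int[nu]_x x ^+ 2 = 1 :> R.
Proof.
apply/eqP; rewrite eq_le m2_le /=.
set m := \int[nu]_x x ^+ 2; set c := normal_peak (1 : R).
have c0 : 0 <= c by exact: normal_peak_ge0.
have bnd (r : R) : 1 <= r -> 1 - m <= (1 + 4 * c) / r.
  move=> r1; have r0 : 0 < r by exact: lt_le_trans ltr01 r1.
  have h1 : J 2 r <= m.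
    rewrite /m (splitJ r normal_integrable_sqr) lerDl.
    by apply: Rintegral_ge0 => // x _; exact: sqr_ge0.
  have h2 : 1 - J 0 r <= r^-1.
    have i1 : nu.-integrable setT (EFin \o (fun x : R => x ^+ 0)).
      by apply: eq_integrable (finite_measure_integrable_cst nu 1 measurableT) => // x _.
    have : \int[nu]_x x ^+ 0 = 1 :> R by rewrite /Rintegral E0.
    rewrite (splitJ r i1) -/(J 0 r) => <-; rewrite addrAC subrr add0r.
    apply: le_trans (ler_norm _) _; apply: tail => //; first by rewrite invr_ge0 ltW.
    move=> x /(seg_out r0) rx; rewrite expr0 normr1 mulrC ler_pdivlMr// mul1r.
    rewrite -(real_normK (num_real x)) (le_trans rx)// expr2 ler_peMl//.
    exact: le_trans r1 rx.
  have h3 : J 2 r = J 0 r - 2 * (r * phi r).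
    by rewrite normal_momentS_segment// expr1 expr1; ring.
  (* From exp y >= 1 + y at y = r^2 / 2. *)
  have h4 : r * phi r <= 2 * c / r.
    rewrite ler_pdivlMr// normal_pdf01E -/c expRN.
    have := expR_ge1Dx (r ^+ 2 / 2); have := expR_gt0 (r ^+ 2 / 2).
    set e := expR _ => e0 h; rewrite [leLHS](_ : _ = c * r ^+ 2 / e); last by field; rewrite gt_eqF.
    rewrite ler_pdivrMr// [2 * c]mulrC -mulrA ler_wpM2l//; nra.
  have -> : (1 + 4 * c) / r = r^-1 + 2 * (2 * c / r) by field; rewrite gt_eqF.
  lra.
rewrite leNgt; apply/negP => m1.
have q0 : 0 < 1 - m by rewrite subr_gt0.
have p0 : 0 < 1 + 4 * c by lra.
(* With q = 1 - m, this choice turns the bound into q <= q / (q + 2), impossible for q > 0. Both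
   factors are at least 1, so [1 <= r]. *)
pose r := (1 + 4 * c) * (1 + 2 / (1 - m)).
have r1 : 1 <= r.
  rewrite /r; have := divr_gt0 (ltr0Sn R 1) q0; set u := _ / _ => u0.
  nra.
have := bnd r r1; rewrite /r invfM mulrA divff ?gt_eqF// mul1r.
have -> : (1 + 2 / (1 - m))^-1 = (1 - m) / (1 - m + 2).
  by field; apply/andP; split; apply: lt0r_neq0; lra.
rewrite ler_pdivlMr; last lra.
by nra.
Qed.

End normal_moments.

(** * Measurability with respect to selected draws *)

Section sub_sigma_algebra.
Context d (T : measurableType d) (R : realType) (P : probability T R).

Lemma generated_by_sub d' (T' : measurableType d') (G : set_system T) (f : T -> T') :
  measurable_fun [set: g_sigma_algebraType G] f -> generated_by f `<=` <<s G >>.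
Proof. by move=> mf _ [B mB <-]; exact: mf. Qed.

Lemma generated_by_measurable d' (T' : measurableType d') (f : T -> T') :
  measurable_fun setT f -> generated_by f `<=` measurable.
Proof. by move=> mf _ [B mB <-]; exact: mf. Qed.

Lemma generated_by_setT d' (T' : measurableType d') (f : T -> T') :
  generated_by f setT.
Proof. by exists setT => //; rewrite setTI preimage_setT. Qed.

Lemma generated_by_setI d' (T' : measurableType d') (f : T -> T') :
  setI_closed (generated_by f).
Proof.
move=> _ _ [A mA <-] [B mB <-]; exists (A `&` B); first exact: measurableI.
by rewrite !setTI preimage_setI.
Qed.

Lemma sub_sigma_measurable_fun d' (T' : measurableType d') (G : set_system T) (f : T -> T') :
  G `<=` measurable -> measurable_fun [set: g_sigma_algebraType G] f ->
  measurable_fun setT f.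
Proof.
move=> Gm mf _ B mB; have := mf measurableT B mB.
apply: smallest_sub; first exact: sigma_algebra_measurable.
exact: Gm.
Qed.

(** [g_sigma_algebraType] equips the same set with the smaller sigma-algebra of the draws in [J];
    measurability for it expresses dependence on these draws alone. *)
Lemma joint_measurable_fun (I : eqType) (F : I -> set_system T) (J : set I) k
    d' (T' : measurableType d') (f : T -> T') :
  J k -> generated_by f `<=` F k ->
  measurable_fun [set: g_sigma_algebraType (\bigcup_(i in J) F i)] f.
Proof.
move=> Jk fF _ B mB; apply: sub_sigma_algebra; exists k => //; apply: fF.
by exists B.
Qed.

End sub_sigma_algebra.

Section normal_variable.
Context d (T : measurableType d) (R : realType) (P : probability T R).
Variable X : T -> R.
Hypotheses (mX : measurable_fun setT X)
  (X01 : forall U, measurable U -> P (X @^-1` U) = normal_prob 0 1 U).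

Let X' := HB.pack_for {mfun T >-> measurableTypeR R} (X : T -> measurableTypeR R)
  (isMeasurableFun.Build _ _ T (measurableTypeR R) X mX).

Lemma ge0_integral_normal (f : R -> R) : measurable_fun setT f ->
  (forall x, 0 <= f x) ->
  (\int[P]_w (f (X w))%:E = \int[normal_prob 0 1]_x (f x)%:E)%E.
Proof.
move=> mf f0; transitivity (\int[distribution P X']_x (f x)%:E)%E.
  by rewrite (ge0_integral_distribution X')//; exact/measurable_EFinP.
apply: eq_measure_integral => A mA _; exact: X01.
Qed.

Let integrable_normal (f : R -> R) : measurable_fun setT f ->
  (normal_prob 0 1).-integrable setT (EFin \o f) ->
  P.-integrable setT (EFin \o (f \o X)).
Proof.
move=> mf /integrableP[_ fi]; apply/integrableP; split.
  by apply/measurable_EFinP; exact: measurableT_comp.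
apply: le_lt_trans fi; rewrite le_eqVlt; apply/orP; left; apply/eqP.
by apply: (ge0_integral_normal (f := fun x => `|f x|)) => //; exact: measurableT_comp.
Qed.

Let ge0_int (f : R -> R) (c : R) : measurable_fun setT f -> (forall x, 0 <= f x) ->
  (\int[normal_prob 0 1]_x (f x)%:E <= c%:E)%E ->
  P.-integrable setT (EFin \o (f \o X)) /\ \int[P]_w f (X w) <= c.
Proof.
move=> mf f0 fc; have h : (\int[P]_w (f (X w))%:E <= c%:E)%E.
  by rewrite ge0_integral_normal.
have i : P.-integrable setT (EFin \o (f \o X)).
  apply/integrableP; split; first by apply/measurable_EFinP; exact: measurableT_comp.
  by under eq_integral do rewrite /= ger0_norm//; exact: le_lt_trans h (ltry _).
by split=> //; rewrite -lee_fin /Rintegral fineK// (integrable_fin_num measurableT i).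
Qed.

Let even_ge0 k (x : R) : ~~ odd k -> 0 <= x ^+ k.
Proof. by move=> k0; rewrite exprn_even_ge0. Qed.

Lemma normal_variable_sqr :
  P.-integrable setT (EFin \o (fun w => X w ^+ 2)) /\ \int[P]_w X w ^+ 2 = 1.
Proof.
have mf : measurable_fun setT (fun x : R => x ^+ 2) by exact: measurable_funX.
have [i _] := ge0_int mf (fun x => sqr_ge0 x) (@normal_moment2_le R).
split=> //; rewrite /Rintegral (ge0_integral_normal (f := fun x => x ^+ 2)).
- exact: normal_moment2.
- exact: measurable_funX.
- by move=> x; exact: sqr_ge0.
Qed.

Lemma normal_variable_pow4 :
  P.-integrable setT (EFin \o (fun w => X w ^+ 4)) /\ \int[P]_w X w ^+ 4 <= 3%:R.
Proof.
apply: (ge0_int (f := fun x => x ^+ 4)); last exact: normal_moment4_le.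
  exact: measurable_funX.
by move=> x; exact: even_ge0.
Qed.

Lemma normal_variable_pow6 :
  P.-integrable setT (EFin \o (fun w => X w ^+ 6)) /\ \int[P]_w X w ^+ 6 <= 15%:R.
Proof.
apply: (ge0_int (f := fun x => x ^+ 6)); last exact: normal_moment6_le.
  exact: measurable_funX.
by move=> x; exact: even_ge0.
Qed.

Lemma normal_variable_id :
  P.-integrable setT (EFin \o X) /\ \int[P]_w X w = 0.
Proof.
have iX : P.-integrable setT (EFin \o X).
  apply: (integrable_normal (f := fun x : R => x)); first exact: measurable_id.
  exact: normal_integrable_id.
split=> //; rewrite -[RHS](@normal_moment1 R) /Rintegral; congr fine.
transitivity (\int[distribution P X']_x x%:E)%E.
  by rewrite (integral_distribution (X := X') (f := EFin : measurableTypeR R -> \bar R))//; exact: EFin_measurable.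
by apply: eq_measure_integral => A mA _; exact: X01.
Qed.

End normal_variable.

(** * Moments of a standard Gaussian vector *)

Section gaussian_vector.
Context d (T : measurableType d) (R : realType) (P : probability T R).
Variables (m : nat) (eta : {mfun T >-> m.-tuple R}).
Hypothesis eta_law : standard_gaussian (distribution P eta).

Definition coord_rv (j : 'I_m) (w : T) : R := tnth (eta w) j.
Local Notation e := coord_rv.

Lemma measurable_coord j : measurable_fun setT (e j).
Proof. by apply: (measurableT_comp (measurable_tnth j)). Qed.

Lemma gaussian_rectangle (U : 'I_m -> set R) : (forall j, measurable (U j)) ->
  P [set w | forall j, U j (e j w)] = (\prod_(j < m) normal_prob 0%R 1%R (U j))%E.
Proof. by move=> mU; rewrite -eta_law. Qed.

Lemma gaussian_coord j U : measurable U -> P (e j @^-1` U) = normal_prob 0 1 U.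
Proof.
move=> mU; pose V i := if i == j then U else setT.
have := @gaussian_rectangle V.
rewrite (bigD1 j)//= /V eqxx big1 ?mule1.
  move=> <-; last by move=> i; case: eqP.
  congr (P _); apply/seteqP; split=> w /= h; last by have := h j; rewrite eqxx.
  by move=> i; case: eqP => // ->.
move=> i ij; rewrite (negbTE ij); exact: probability_setT.
Qed.

(** [standard_gaussian] gives the measure of full rectangles; [setT] in the coordinates outside [s]
    yields the finite products. *)
Lemma gaussian_coord_independent :
  mutually_independent P (fun j => generated_by (e j)).
Proof.
move=> s E us sE.
have /choice[U hU] : forall j, exists U : set R, measurable U /\
    (j \in s -> e j @^-1` U = E j).
  move=> j; case: (boolP (j \in s)) => [js|_]; last by exists setT.
  by have [U mU UE] := sE _ js; exists U; split=> // _; rewrite -UE setTI.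
pose V i := if i \in s then U i else setT.
have VE : \bigcap_(i in [set` s]) E i = [set w | forall j, V j (e j w)].
  apply/seteqP; split=> w h.
    move=> j; rewrite /V; case: ifPn => // js.
    by have := h j js; rewrite -(hU j).2.
  move=> i /= is_; have := h i; rewrite /V is_ => h'.
  by rewrite -(hU i).2.
rewrite VE gaussian_rectangle; last by move=> j; rewrite /V; case: ifP => // _; exact: (hU j).1.
rewrite [RHS]big_uniq//= [RHS]big_mkcond/=; apply: eq_bigr => j _; rewrite /V; case: ifPn => js.
  by rewrite -(hU j).2// gaussian_coord//; exact: (hU j).1.
exact: (@probability_setT _ _ _ (normal_prob 0 1)).
Qed.

Let law j : forall U, measurable U -> P (e j @^-1` U) = normal_prob 0 1 U.
Proof. by move=> U; exact: gaussian_coord. Qed.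

Lemma gaussian_coord_id j :
  P.-integrable setT (EFin \o e j) /\ \int[P]_w e j w = 0.
Proof. exact: normal_variable_id (measurable_coord j) (law j). Qed.

Lemma gaussian_coordM j l :
  P.-integrable setT (EFin \o (e j \* e l)) /\
  \int[P]_w (e j w * e l w) = (j == l)%:R.
Proof.
have [->|jl] := eqVneq j l.
  have [h1 h2] := normal_variable_sqr (measurable_coord l) (law l).
  split; first by apply: eq_integrable h1 => // x _ /=; rewrite expr2.
  by rewrite -h2; apply: eq_Rintegral => x _; rewrite expr2.
have ind : independent_systems P (generated_by (e j)) (generated_by (e l)).
  move=> A B gA gB; pose F i := if i == j then A else B.
  have := gaussian_coord_independent (s := [:: j; l]) (E := F).
  rewrite /= inE jl => /(_ isT) H.
  have {H} : P (\bigcap_(i in [set` [:: j; l]]) F i) = (\prod_(i <- [:: j; l]) P (F i))%E.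
    apply: H => i; rewrite !inE /F => /orP[]/eqP -> ; first by rewrite eqxx.
    by rewrite eq_sym (negbTE jl).
  rewrite !big_cons big_nil mule1 /F eqxx eq_sym (negbTE jl) => <-; congr (P _).
  apply/seteqP; split=> w.
    by move=> [Aw Bw] i /=; rewrite !inE => /orP[]/eqP ->; rewrite ?eqxx // eq_sym (negbTE jl).
  move=> h; split; first by have := h j; rewrite eqxx; apply; rewrite /= !inE eqxx.
  by have := h l; rewrite eq_sym (negbTE jl); apply; rewrite /= !inE eqxx orbT.
have [i1 e1] := gaussian_coord_id j; have [i2 e2] := gaussian_coord_id l.
split; first exact: integrable_independentM.
by rewrite Rintegral_independentM// e1 mul0r.
Qed.

(** A chi-square variable with [k] degrees of freedom, built one coordinate at a time to allow
    induction on [k]. *)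
Definition partial_sqn (k : nat) (w : T) : R := \sum_(j < m | (j < k)%N) e j w ^+ 2.

Lemma partial_sqn_ge0 k w : 0 <= partial_sqn k w.
Proof. by apply: sumr_ge0 => j _; exact: sqr_ge0. Qed.

Lemma partial_sqnS k (km : (k < m)%N) w :
  partial_sqn k.+1 w = partial_sqn k w + e (Ordinal km) w ^+ 2.
Proof.
rewrite /partial_sqn (bigD1 (Ordinal km))//= addrC; congr (_ + _).
apply: eq_bigl => j; rewrite ltnS -val_eqE /= [RHS]ltn_neqAle andbC//.
Qed.

Lemma partial_sqn_m w : partial_sqn m w = sqn (vec (eta w)).
Proof.
rewrite /partial_sqn /sqn; apply: eq_big => [j|j _]; first by rewrite ltn_ord.
by rewrite mxE.
Qed.

Let Fj (j : 'I_m) := generated_by (e j).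

Let Jk (k : nat) : set 'I_m := [set i : 'I_m | (i < k)%N].

Let partial_sqn_measurable k :
  measurable_fun [set: g_sigma_algebraType (\bigcup_(i in Jk k) Fj i)] (partial_sqn k).
Proof.
have -> : partial_sqn k =
    (fun w => \sum_(j <- index_enum 'I_m) (if (j < k)%N then e j w ^+ 2 else 0)).
  by apply/funext => w; rewrite /partial_sqn big_mkcond.
apply: measurable_sum => j; case: (boolP (j < k)%N) => jk; last exact: measurable_cst.
apply: measurable_funX; apply: (joint_measurable_fun (k := j)) => //.
Qed.

Let partial_sqn_independent k (km : (k < m)%N) a b :
  independent_systems P (generated_by (fun w => partial_sqn k w ^+ a))
    (generated_by (fun w => (e (Ordinal km) w ^+ 2) ^+ b)).
Proof.
have h : [disjoint Jk k & [set Ordinal km]]%classic.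
  apply/disj_set2P/seteqP; split=> // j [jk jE].
  by move: jk; rewrite /Jk /= jE /= ltnn.
have Fm i : Fj i `<=` measurable.
  exact: generated_by_measurable (measurable_coord i).
have := joint_sigma_independent Fm (fun i => generated_by_setT (e i))
  (fun i => @generated_by_setI _ _ _ _ (e i)) gaussian_coord_independent h.
apply: independent_systems_sub.
  apply: generated_by_sub; apply: measurable_funX; exact: partial_sqn_measurable.
apply: generated_by_sub; do 2 apply: measurable_funX.
exact: (joint_measurable_fun (k := Ordinal km)).
Qed.

(** These are the moments that appear in [xi3]. Expand the powers of [S + Z], where [Z] is the new
    squared coordinate, independent of [S], with moments 1, at most 3 and at most 15. For instance
    k(k+2) + 2k + 3 = (k+1)(k+3). *)
Lemma partial_sqn_moments k : (k <= m)%N ->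
  [/\ P.-integrable setT (EFin \o (fun w => partial_sqn k w ^+ 1)) /\
        \int[P]_w partial_sqn k w ^+ 1 = k%:R,
      P.-integrable setT (EFin \o (fun w => partial_sqn k w ^+ 2)) /\
        \int[P]_w partial_sqn k w ^+ 2 <= k%:R * (k%:R + 2) &
      P.-integrable setT (EFin \o (fun w => partial_sqn k w ^+ 3)) /\
        \int[P]_w partial_sqn k w ^+ 3 <= k%:R * (k%:R + 2) * (k%:R + 4)].
Proof.
elim: k => [_|k IH km].
  have S0 i : (fun w => partial_sqn 0 w ^+ i.+1) = cst 0.
    apply/funext => w; rewrite /partial_sqn big_pred0 ?expr0n//.
  have i0 : P.-integrable setT (EFin \o cst 0) by exact: finite_measure_integrable_cst.
  by rewrite !S0 !mul0r Rintegral_cst// mul0r.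
have [[i1 e1] [i2 e2] [i3 e3]] := IH (ltnW km).
set Z := fun w => e (Ordinal km) w ^+ 2.
have [z1 f1] := normal_variable_sqr (measurable_coord (Ordinal km)) (law (Ordinal km)).
have [z2 f2] := normal_variable_pow4 (measurable_coord (Ordinal km)) (law (Ordinal km)).
have [z3 f3] := normal_variable_pow6 (measurable_coord (Ordinal km)) (law (Ordinal km)).
have Z1 : (fun w => e (Ordinal km) w ^+ 2) = (fun w => Z w ^+ 1).
  by apply/funext => w; rewrite expr1.
have Z2 : (fun w => e (Ordinal km) w ^+ 4) = (fun w => Z w ^+ 2).
  by apply/funext => w; rewrite -exprM.
have Z3 : (fun w => e (Ordinal km) w ^+ 6) = (fun w => Z w ^+ 3).
  by apply/funext => w; rewrite -exprM.
rewrite Z1 in z1 f1; rewrite Z2 in z2 f2; rewrite Z3 in z3 f3.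
set S := partial_sqn k in i1 e1 i2 e2 i3 e3 *.
have prod a b : P.-integrable setT (EFin \o (fun w => S w ^+ a)) ->
    P.-integrable setT (EFin \o (fun w => Z w ^+ b)) ->
    P.-integrable setT (EFin \o (fun w => S w ^+ a * Z w ^+ b)) /\
    \int[P]_w (S w ^+ a * Z w ^+ b) = \int[P]_w (S w ^+ a) * \int[P]_w (Z w ^+ b).
  move=> ia ib; split.
    have := (@integrable_independentM _ _ _ P (fun w => S w ^+ a) (fun w => Z w ^+ b) ia ib (@partial_sqn_independent k km a b)).
    by apply: eq_integrable.
  exact: (@Rintegral_independentM _ _ _ P (fun w => S w ^+ a) (fun w => Z w ^+ b) ia ib (@partial_sqn_independent k km a b)).
have [p11 q11] := prod 1%N 1%N i1 z1.
have [p21 q21] := prod 2%N 1%N i2 z1.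
have [p12 q12] := prod 1%N 2%N i1 z2.
have addI f g : P.-integrable setT (EFin \o f) -> P.-integrable setT (EFin \o g) ->
    P.-integrable setT (EFin \o (fun w => f w + g w)) /\
    \int[P]_w (f w + g w) = \int[P]_w f w + \int[P]_w g w.
  move=> fi gi; split; last by rewrite RintegralD.
  by have := integrableD measurableT fi gi; apply: eq_integrable.
have sclI c f : P.-integrable setT (EFin \o f) ->
    P.-integrable setT (EFin \o (fun w => c * f w)) /\
    \int[P]_w (c * f w) = c * \int[P]_w f w.
  move=> fi; split; last by rewrite RintegralZl.
  by have := integrableZl measurableT c fi; apply: eq_integrable.
have k0 : 0 <= k%:R :> R by [].
rewrite -natr1; split.
- have -> : (fun w => partial_sqn k.+1 w ^+ 1) = (fun w => S w ^+ 1 + Z w ^+ 1).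
    by apply/funext => w; rewrite partial_sqnS !expr1.
  by have [h1 h2] := addI _ _ i1 z1; split=> //; rewrite h2 e1 f1.
- have -> : (fun w => partial_sqn k.+1 w ^+ 2) =
     (fun w => S w ^+ 2 + (2 * (S w ^+ 1 * Z w ^+ 1) + Z w ^+ 2)).
    by apply/funext => w; rewrite partial_sqnS -/(Z w) -/(S w); ring.
  have [h1 h1'] := sclI 2 _ p11.
  have [h2 h2'] := addI _ _ h1 z2; have [h3 h3'] := addI _ _ i2 h2.
  by split=> //; rewrite h3' h2' h1' q11 e1 f1; nra.
have -> : (fun w => partial_sqn k.+1 w ^+ 3) =
   (fun w => S w ^+ 3 + (3 * (S w ^+ 2 * Z w ^+ 1) + (3 * (S w ^+ 1 * Z w ^+ 2) + Z w ^+ 3))).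
  by apply/funext => w; rewrite partial_sqnS -/(Z w) -/(S w); ring.
have [h1 h1'] := sclI 3 _ p21; have [g1 g1'] := sclI 3 _ p12.
have [h2 h2'] := addI _ _ g1 z3; have [h3 h3'] := addI _ _ h1 h2.
have [h4 h4'] := addI _ _ i3 h3.
split=> //; rewrite h4' h3' h2' h1' g1' q21 q12 e1 f1.
move: (\int[P]_w Z w ^+ 2) (\int[P]_w Z w ^+ 3) f2 f3 => y z f2 f3.
have : k%:R * y <= k%:R * 3%:R by rewrite ler_wpM2l.
move: (\int[P]_w S w ^+ 2) (\int[P]_w S w ^+ 3) e2 e3 => s2 s3 e2 e3 h.
lra.
Qed.

Lemma gaussian_sqn_moments :
  [/\ P.-integrable setT (EFin \o (fun w => sqn (vec (eta w)))) /\
        \int[P]_w sqn (vec (eta w)) = m%:R,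
      P.-integrable setT (EFin \o (fun w => sqn (vec (eta w)) ^+ 2)) /\
        \int[P]_w sqn (vec (eta w)) ^+ 2 <= m%:R * (m%:R + 2) &
      P.-integrable setT (EFin \o (fun w => sqn (vec (eta w)) ^+ 3)) /\
        \int[P]_w sqn (vec (eta w)) ^+ 3 <= m%:R * (m%:R + 2) * (m%:R + 4)].
Proof.
have := partial_sqn_moments (leqnn m).
have -> : partial_sqn m = (fun w => sqn (vec (eta w))).
  by apply/funext => w; exact: partial_sqn_m.
have -> : (fun w => sqn (vec (eta w)) ^+ 1) = (fun w => sqn (vec (eta w))).
  by apply/funext => w; rewrite expr1.
by [].
Qed.

End gaussian_vector.

(** * Measurability of matrix functions *)

(** [0^-1] is 0, so the inverse is total but not continuous at 0; the line is split there. *)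
Lemma measurable_inv (R : realType) : measurable_fun setT (fun x : R => x^-1).
Proof.
have -> : setT = [set 0] `|` ~` [set 0] :> set R by rewrite setUv.
have m0 : measurable ([set 0] : set R) by exact: measurable_set1.
apply/measurable_funU => //; first exact: measurableC.
split.
  have h : measurable_fun ([set 0] : set R) (cst 0 : R -> R) by exact: measurable_cst.
  move: h; apply: eq_measurable_fun.
  by move=> x; rewrite inE => /= ->; rewrite invr0.
apply: open_continuous_measurable_fun.
  apply: closed_openC; apply: accessible_closed_set1.
  by apply: hausdorff_accessible; exact: Rhausdorff.
move=> x; rewrite inE => /eqP x0; exact: inv_continuous.
Qed.

Lemma measurable_fun_inv d (T : measurableType d) (R : realType) (f : T -> R) :
  measurable_fun setT f -> measurable_fun setT (fun t => (f t)^-1).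
Proof. by move=> mf; exact: (measurableT_comp (@measurable_inv R) mf). Qed.

Lemma measurable_superlevel d (T : measurableType d) (R : realType) (f : T -> R) c :
  measurable_fun setT f -> measurable [set t | c < f t].
Proof.
move=> mf; rewrite (_ : [set _ | _] = f @^-1` `]c, +oo[).
  by rewrite -[X in measurable X]setTI; exact: mf.
by apply/seteqP; split=> t /=; rewrite in_itv/= andbT.
Qed.

Lemma measurable_sublevel d (T : measurableType d) (R : realType) (f : T -> R) c :
  measurable_fun setT f -> measurable [set t | f t <= c].
Proof.
move=> mf; rewrite (_ : [set _ | _] = f @^-1` `]-oo, c]).
  by rewrite -[X in measurable X]setTI; exact: mf.
by apply/seteqP; split=> t /=; rewrite in_itv/=.
Qed.

Section measurable_matrix.
Context d (T : measurableType d) (R : realType).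

Definition mx_measurable p q (f : T -> 'M[R]_(p, q)) : Prop :=
  forall i j, measurable_fun setT (fun t => f t i j).

Lemma mx_measurable_cst p q (M : 'M[R]_(p, q)) : mx_measurable (fun=> M).
Proof. by move=> i j; exact: measurable_cst. Qed.

Lemma mx_measurableD p q (f g : T -> 'M[R]_(p, q)) :
  mx_measurable f -> mx_measurable g -> mx_measurable (fun t => f t + g t).
Proof.
move=> mf mg i j; under eq_fun do rewrite mxE; exact: measurable_funD.
Qed.

Lemma mx_measurableN p q (f : T -> 'M[R]_(p, q)) :
  mx_measurable f -> mx_measurable (fun t => - f t).
Proof.
move=> mf i j; under eq_fun do rewrite mxE.
exact: measurable_funN.
Qed.

Lemma mx_measurableZ p q (c : T -> R) (f : T -> 'M[R]_(p, q)) :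
  measurable_fun setT c -> mx_measurable f -> mx_measurable (fun t => c t *: f t).
Proof.
move=> mc mf i j; under eq_fun do rewrite mxE; exact: measurable_funM.
Qed.

Lemma mx_measurable_tr p q (f : T -> 'M[R]_(p, q)) :
  mx_measurable f -> mx_measurable (fun t => (f t)^T).
Proof. by move=> mf i j; under eq_fun do rewrite mxE; exact: mf. Qed.

Lemma mx_measurableM p q r (f : T -> 'M[R]_(p, q)) (g : T -> 'M[R]_(q, r)) :
  mx_measurable f -> mx_measurable g -> mx_measurable (fun t => f t *m g t).
Proof.
move=> mf mg i j; under eq_fun do rewrite mxE.
by apply: measurable_sum => k; exact: measurable_funM.
Qed.

Lemma measurable_prod_fun (I : Type) (s : seq I) (h : I -> T -> R) :
  (forall i, measurable_fun setT (h i)) ->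
  measurable_fun setT (fun t => \prod_(i <- s) h i t).
Proof.
move=> mh; elim: s => [|i s IH].
  by under eq_fun do rewrite big_nil; exact: measurable_cst.
by under eq_fun do rewrite big_cons; exact: measurable_funM.
Qed.

Lemma mx_measurable_det p (f : T -> 'M[R]_p) :
  mx_measurable f -> measurable_fun setT (fun t => \det (f t)).
Proof.
move=> mf; rewrite /determinant; apply: measurable_sum => s.
apply: measurable_funM; first exact: measurable_cst.
by apply: measurable_prod_fun => i; exact: mf.
Qed.

Lemma mx_measurable_adj p (f : T -> 'M[R]_p) :
  mx_measurable f -> mx_measurable (fun t => \adj (f t)).
Proof.
move=> mf i j; under eq_fun do rewrite mxE /cofactor.
apply: measurable_funM; first exact: measurable_cst.
apply: mx_measurable_det => k l; under eq_fun do rewrite !mxE; exact: mf.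
Qed.

(** By Cramer's rule the entries are polynomials in those of [f], divided by the determinant. *)
Lemma mx_measurable_inv p (f : T -> 'M[R]_p) :
  (forall t, f t \in unitmx) ->
  mx_measurable f -> mx_measurable (fun t => invmx (f t)).
Proof.
move=> fu mf i j.
have -> : (fun t => invmx (f t) i j) = (fun t => (\det (f t))^-1 * (\adj (f t)) i j).
  by apply/funext => t; rewrite /invmx fu mxE.
apply: measurable_funM; last exact: mx_measurable_adj.
by apply: measurable_fun_inv; exact: mx_measurable_det.
Qed.

Lemma mx_measurable_bil p q (M : T -> 'M[R]_(p, q)) x y :
  mx_measurable M -> mx_measurable x -> mx_measurable y ->
  measurable_fun setT (fun t => bil (M t) (x t) (y t)).
Proof.
move=> mM mx my; apply: (mx_measurableM (mx_measurableM _ _) _ _ _) => //.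
exact: mx_measurable_tr.
Qed.

Lemma mx_measurable_quad p (M : T -> 'M[R]_p) z :
  mx_measurable M -> mx_measurable z ->
  measurable_fun setT (fun t => quad (M t) (z t)).
Proof. by move=> mM mz; exact: mx_measurable_bil. Qed.

Lemma mx_measurable_frob2 p q (f : T -> 'M[R]_(p, q)) :
  mx_measurable f -> measurable_fun setT (fun t => frob2 (f t)).
Proof.
by move=> mf; do 2 (apply: measurable_sum => ?); apply: measurable_funX; exact: mf.
Qed.

Lemma mx_measurable_sqn p (f : T -> 'cV[R]_p) :
  mx_measurable f -> measurable_fun setT (fun t => sqn (f t)).
Proof.
by move=> mf; apply: measurable_sum => ?; apply: measurable_funX; exact: mf.
Qed.

Lemma mx_measurable_mxtrace p (f : T -> 'M[R]_p) :
  mx_measurable f -> measurable_fun setT (fun t => \tr (f t)).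
Proof. by move=> mf; apply: measurable_sum => i; exact: mf. Qed.

Lemma mx_measurable_vec p (f : T -> p.-tuple R) :
  measurable_fun setT f -> mx_measurable (fun t => vec (f t)).
Proof.
move=> mf i j; under eq_fun do rewrite mxE.
exact: (measurableT_comp (measurable_tnth i) mf).
Qed.

End measurable_matrix.

(** * One gradient step *)

Section policy_gradient_algebra.
Context {R : realType} {n m : nat}.
Variables (A : 'M[R]_n) (B : 'M[R]_(n, m)) (Q : 'M[R]_n) (W : 'M[R]_m).
Variable P : 'M[R]_n.
Hypotheses (Qpos : posdef Q) (Wpos : posdef W) (Pp : possemidef P).

Local Notation H := (hess B W P).
Local Notation G := (gain A B W P).
Local Notation cost x u := (quad Q x + quad W u + quad P (A *m x + B *m u)).

(** Expansion in the perturbation: the linear term carries [H (K - G)], which becomes the policy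
    gradient, up to a factor, once multiplied by [y x^T] and averaged. *)
Lemma noisy_cost_expansion (K : 'M[R]_(m, n)) x y s :
  cost x (- (K *m x) + s *: y) = quad (policy_cost A B Q W P K) x
    - 2 * s * bil (H *m (K - G)) y x + s ^+ 2 * quad H y.
Proof.
have -> : A *m x + B *m (- (K *m x) + s *: y) = (A - B *m K) *m x + s *: (B *m y).
  by rewrite mulmxDr mulmxN mulmxBl -scalemxAr mulmxA addrA.
have -> : - (K *m x) + s *: y = (- K) *m x + s *: y by rewrite mulNmx.
rewrite !(quadD _ _ Wpos.1) !(quadD _ _ Pp.1) !quadZ !bilZr quad_policy_cost quad_hess.
have -> : bil (H *m (K - G)) y x = bil W y (K *m x) - bil P (B *m y) ((A - B *m K) *m x).
  rewrite mulmxBr hess_gain//.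
  have -> : H *m K - B^T *m P *m A = W *m K - B^T *m P *m (A - B *m K).
    by rewrite /hess mulmxDl mulmxBr opprB !mulmxA -addrA; congr (_ + _).
  rewrite bilDM bilNM bil_mulr; congr (_ - _).
  by rewrite [RHS]bil_mull [RHS]bil_mulr.
have -> : quad W (- K *m x) = quad W (K *m x).
  by rewrite mulNmx -scaleN1r quadZ sqrrN expr1n mul1r.
have -> : bil W (- K *m x) y = - bil W y (K *m x).
  by rewrite -(bil_tr W) Wpos.1 mulNmx -scaleN1r bilZr mulN1r.
rewrite -(bil_tr P ((A - B *m K) *m x)) Pp.1; ring.
Qed.

Lemma cost_ge0 x u : 0 <= cost x u.
Proof.
rewrite !addr_ge0//; first by have [] := posdef_possemidef Qpos.
  by have [] := posdef_possemidef Wpos.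
by have [] := Pp.
Qed.

Lemma sqnD_le k (x y : 'cV[R]_k) : sqn (x + y) <= 2 * sqn x + 2 * sqn y.
Proof.
have := sqn_ge0 (x - y); rewrite -!quad1 !quadD ?tr_scalar_mx//.
have -> : bil 1%:M x (- y) = - bil 1%:M x y by rewrite -scaleN1r bilZr mulN1r.
have -> : quad 1%:M (- y) = quad 1%:M y.
  by rewrite -scaleN1r quadZ sqrrN expr1n mul1r.
lra.
Qed.

(** The two coefficients are those of [xi1] and [xi2] without the powers of [Cm]; factors 2 come
    from |x + y|^2 <= 2 |x|^2 + 2 |y|^2. *)
Lemma noisy_cost_bound (K : 'M[R]_(m, n)) x y s p k : spectral_norm P <= p ->
  spectral_norm K ^+ 2 <= k ->
  cost x (- (K *m x) + s *: y) <=
  (spectral_norm Q + 2 * spectral_norm W * k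
   + 2 * p * (spectral_norm A ^+ 2 + 2 * spectral_norm B ^+ 2 * k)) * sqn x
  + 2 * (spectral_norm W + 2 * p * spectral_norm B ^+ 2) * (s ^+ 2 * sqn y).
Proof.
move=> Ppn Kk; have p0 : 0 <= p by rewrite (le_trans _ Ppn) ?spectral_norm_ge0.
have k0 : 0 <= k by rewrite (le_trans _ Kk) ?sqr_ge0.
set u := - _ + _.
have un : sqn u <= 2 * (k * sqn x) + 2 * (s ^+ 2 * sqn y).
  rewrite (le_trans (sqnD_le _ _))// -scaleN1r !sqnZ sqrrN expr1n mul1r lerD2r.
  rewrite ler_wpM2l// (le_trans (sqn_mulmx _ _))// ler_wpM2r// sqn_ge0//.
have h1 := quad_le_spectral_norm Q x.
have h2 : quad W u <= spectral_norm W * (2 * (k * sqn x) + 2 * (s ^+ 2 * sqn y)).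
  by rewrite (le_trans (quad_le_spectral_norm _ _))// ler_wpM2l ?spectral_norm_ge0.
have h3 : quad P (A *m x + B *m u) <= p * (2 * (spectral_norm A ^+ 2 * sqn x)
   + 2 * (spectral_norm B ^+ 2 * (2 * (k * sqn x) + 2 * (s ^+ 2 * sqn y)))).
  rewrite (le_trans (quad_le_spectral_norm _ _))// ler_pM ?spectral_norm_ge0 ?sqn_ge0//.
  rewrite (le_trans (sqnD_le _ _))// lerD// ler_wpM2l// (le_trans (sqn_mulmx _ _))//.
  by rewrite ler_wpM2l// sqr_ge0.
rewrite (le_trans (lerD (lerD h1 h2) h3))// le_eqVlt; apply/orP; left; apply/eqP; ring.
Qed.

Variable Sigma : 'M[R]_n.
Hypothesis Ss : Sigma^T = Sigma.

Definition gap (D : 'M[R]_(m, n)) : R := \tr (D^T *m H *m D *m Sigma).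

(** A stochastic gradient step is a rank-one update and [gap] is quadratic; the two mixed terms
    coincide because [H] and [Sigma] are symmetric. *)
Lemma gap_rank1 (D : 'M[R]_(m, n)) (y : 'cV[R]_m) (x : 'cV[R]_n) t :
  gap (D + t *: (y *m x^T)) = gap D + 2 * t * bil (H *m D *m Sigma) y x
    + t ^+ 2 * (quad H y * quad Sigma x).
Proof.
have Hs := (hess_posdef B Wpos Pp).1.
have tr1 (M : 'M[R]_1) : \tr M = M 0 0 by rewrite /mxtrace big_ord1.
have e1 : \tr (D^T *m H *m (y *m x^T) *m Sigma) = bil (H *m D *m Sigma) y x.
  rewrite !mulmxA -mulmxA mxtrace_mulC !mulmxA tr1 -/(bil _ _ _).
  rewrite -(mulmxA x^T) -(mulmxA x^T) -/(bil (Sigma *m D^T *m H) x y).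
  by rewrite -(bil_tr (Sigma *m D^T *m H)) !trmx_mul trmxK Hs Ss mulmxA.
have e2 : \tr ((y *m x^T)^T *m H *m D *m Sigma) = bil (H *m D *m Sigma) y x.
  by rewrite trmx_mul trmxK -!mulmxA mxtrace_mulC tr1 /bil !mulmxA.
have e3 : \tr ((y *m x^T)^T *m H *m (y *m x^T) *m Sigma) = quad H y * quad Sigma x.
  rewrite trmx_mul trmxK.
  have -> : x *m y^T *m H *m (y *m x^T) *m Sigma = x *m (y^T *m H *m y) *m (x^T *m Sigma).
    by rewrite !mulmxA.
  rewrite -mulmxA mxtrace_mulC tr1 [y^T *m H *m y]mx11_scalar -/(quad H y).
  by rewrite mul_scalar_mx -scalemxAl mxE.
pose F (M : 'M[R]_m) (X Y : 'M[R]_(m, n)) := \tr (X^T *m M *m Y *m Sigma).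
have FDl M X X' Y : F M (X + X') Y = F M X Y + F M X' Y.
  by rewrite /F linearD /= !mulmxDl linearD.
have FDr M X Y Y' : F M X (Y + Y') = F M X Y + F M X Y'.
  by rewrite /F mulmxDr mulmxDl linearD.
have FZl M a X Y : F M (a *: X) Y = a * F M X Y.
  by rewrite /F linearZ /= -!scalemxAl linearZ.
have FZr M a X Y : F M X (a *: Y) = a * F M X Y.
  by rewrite /F -scalemxAr -scalemxAl linearZ.
rewrite /gap -[\tr _]/(F H (D + t *: (y *m x^T)) (D + t *: (y *m x^T))).
rewrite FDl !FDr !FZl !FZr /F e1 e2 e3; ring.
Qed.

(** Reduces trace inequalities to inequalities between quadratic forms at the rows of [N]. *)
Lemma tr_gram k (N : 'M[R]_(k, n)) (S : 'M[R]_n) :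
  \tr (N^T *m N *m S) = \sum_i quad S (row i N)^T.
Proof.
rewrite -mulmxA mxtrace_mulC /mxtrace; apply: eq_bigr => i _.
rewrite /quad trmxK -row_mul mxE [RHS]mxE; apply: eq_bigr => j _.
by rewrite !mxE.
Qed.

End policy_gradient_algebra.

Section mean.
Context d (T : measurableType d) (R : realType) (P : probability T R).

(** Integrability is bundled with the value so that sums and multiples of means need no separate
    integrability proof. *)
Definition has_mean (f : T -> R) (c : R) : Prop :=
  P.-integrable setT (EFin \o f) /\ \int[P]_w f w = c.

Lemma has_mean_ext f g c : f =1 g -> has_mean f c -> has_mean g c.
Proof. by move=> /funext ->. Qed.

Lemma has_mean_unique f c c' : has_mean f c -> has_mean f c' -> c = c'.
Proof. by move=> [_ <-] [_ <-]. Qed.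

Lemma has_mean_cst c : has_mean (cst c) c.
Proof.
split; first exact: finite_measure_integrable_cst.
by rewrite Rintegral_cst// [X in fine X](_ : _ = 1%E) ?mulr1//; exact: probability_setT.
Qed.

Lemma has_meanD f g a b : has_mean f a -> has_mean g b ->
  has_mean (fun w => f w + g w) (a + b).
Proof.
move=> [fi <-] [gi <-]; split; last by rewrite RintegralD.
by have := integrableD measurableT fi gi; apply: eq_integrable.
Qed.

Lemma has_meanZ c f a : has_mean f a -> has_mean (fun w => c * f w) (c * a).
Proof.
move=> [fi <-]; split; last by rewrite RintegralZl.
by have := integrableZl measurableT c fi; apply: eq_integrable.
Qed.

Lemma has_mean_sum (I : Type) (s : seq I) (F : I -> T -> R) (c : I -> R) :
  (forall i, has_mean (F i) (c i)) ->
  has_mean (fun w => \sum_(i <- s) F i w) (\sum_(i <- s) c i).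
Proof.
move=> Fc; elim: s => [|i s IH].
  rewrite big_nil; apply: has_mean_ext (has_mean_cst 0) => w.
  by rewrite big_nil.
rewrite big_cons; apply: has_mean_ext (has_meanD (Fc i) IH) => w.
by rewrite big_cons.
Qed.

Lemma ae_le_integrable (f g : T -> R) : measurable_fun setT f ->
  (forall w, 0 <= g w) -> {ae P, forall w, `|f w| <= g w} ->
  P.-integrable setT (EFin \o g) -> P.-integrable setT (EFin \o f).
Proof.
move=> mf g0 fg /integrableP[mg gi]; apply/integrableP.
split; first exact/measurable_EFinP.
apply: le_lt_trans gi; apply: ae_ge0_le_integral => //.
- by apply: measurableT_comp => //; exact/measurable_EFinP.
- exact: measurableT_comp.
by apply: filterS fg => w h _ /=; rewrite lee_fin (le_trans h)// ler_norm.
Qed.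

Lemma ae_le_mean (f g : T -> R) b : measurable_fun setT f -> (forall w, 0 <= f w) ->
  (forall w, 0 <= g w) -> {ae P, forall w, f w <= g w} -> has_mean g b ->
  exists2 a, has_mean f a & a <= b.
Proof.
move=> mf f0 g0 fg [gi <-].
have fi : P.-integrable setT (EFin \o f).
  apply: ae_le_integrable g0 _ gi => //.
  by apply: filterS fg => w h; rewrite ger0_norm.
exists (\int[P]_w f w) => //.
rewrite -lee_fin /Rintegral !fineK ?(integrable_fin_num measurableT)//.
apply: ae_ge0_le_integral => //.
- by move=> w _; rewrite lee_fin.
- exact/measurable_EFinP.
- by move=> w _; rewrite lee_fin.
- exact: (measurable_int P).
by apply: filterS fg => w h _; rewrite lee_fin.
Qed.

End mean.

(** * Mean and second moment of the one-point gradient estimate *)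

Section gradient_mean.
Context d (T : measurableType d) (R : realType) (Pr : probability T R) (n m : nat).
Variables (x : {mfun T >-> n.-tuple R}) (eta : {mfun T >-> m.-tuple R}).
Local Notation xv w := (vec (x w)).
Local Notation yv w := (vec (eta w)).
Variables (Sigma : 'M[R]_n) (Cm : R).
Hypotheses (eta_law : standard_gaussian (distribution Pr eta)) (Cm_gt0 : 0 < Cm)
  (x_bound : {ae Pr, forall w, sqn (xv w) <= Cm})
  (x_mean : forall k, \int[Pr]_w xv w k 0 = 0)
  (x_cov : forall i j, \int[Pr]_w (xv w i 0 * xv w j 0) = Sigma i j)
  (ind : independent_systems Pr (generated_by x) (generated_by eta)).

Local Notation has_mean := (has_mean Pr).

Lemma mx_measurable_x : mx_measurable (fun w => xv w).
Proof. exact: mx_measurable_vec. Qed.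

Lemma mx_measurable_eta : mx_measurable (fun w => yv w).
Proof. exact: mx_measurable_vec. Qed.

Let mtup k : mx_measurable (fun t : k.-tuple R => vec t).
Proof. exact: mx_measurable_vec. Qed.

Lemma coord_sqr_le k (z : 'cV[R]_k) i : z i 0 ^+ 2 <= sqn z.
Proof. by rewrite /sqn (bigD1 i)//= lerDl; apply: sumr_ge0 => j _; exact: sqr_ge0. Qed.

Lemma coord_norm_le k (z : 'cV[R]_k) i : `|z i 0| <= 1 + sqn z.
Proof.
have := coord_sqr_le z i; have := sqr_ge0 (`|z i 0| - 1).
by rewrite -(real_normK (num_real (z i 0))); have := normr_ge0 (z i 0); nra.
Qed.

Lemma coordM_norm_le k (z : 'cV[R]_k) i j : `|z i 0 * z j 0| <= sqn z.
Proof.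
have := coord_sqr_le z i; have := coord_sqr_le z j.
rewrite normrM -(real_normK (num_real (z i 0))) -(real_normK (num_real (z j 0))).
have := sqr_ge0 (`|z i 0| - `|z j 0|); nra.
Qed.

Let integrable_x (f : n.-tuple R -> R) c : measurable_fun setT f -> 0 <= c ->
  (forall t, sqn (vec t) <= Cm -> `|f t| <= c) ->
  Pr.-integrable setT (EFin \o (fun w => f (x w))).
Proof.
move=> mf c0 fc; apply: (@ae_le_integrable _ _ _ _ _ (cst c)) => //.
- exact: (measurableT_comp mf).
- by apply: filterS x_bound => w /fc.
- exact: finite_measure_integrable_cst.
Qed.

Let mean_x (f : n.-tuple R -> R) c : measurable_fun setT f -> 0 <= c ->
  (forall t, sqn (vec t) <= Cm -> `|f t| <= c) ->
  has_mean (fun w => f (x w)) (\int[Pr]_w f (x w)).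
Proof. by move=> mf c0 fc; split=> //; exact: integrable_x c0 fc. Qed.

Lemma mean_coord k : has_mean (fun w => xv w k 0) 0.
Proof.
rewrite -(x_mean k); apply: (mean_x (f := fun t => vec t k 0) (c := 1 + Cm)).
- exact: mtup.
- by rewrite addr_ge0// ltW.
- by move=> t h; rewrite (le_trans (coord_norm_le _ _))// lerD2l.
Qed.

Lemma mean_coordM i j : has_mean (fun w => xv w i 0 * xv w j 0) (Sigma i j).
Proof.
rewrite -(x_cov i j); apply: (mean_x (f := fun t => vec t i 0 * vec t j 0) (c := Cm)).
- by apply: measurable_funM; exact: mtup.
- exact: ltW.
- by move=> t h; rewrite (le_trans (coordM_norm_le _ _ _)).
Qed.

Lemma mean_bil_x (M : 'M[R]_n) : has_mean (fun w => quad M (xv w)) (\tr (M *m Sigma)).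
Proof.
have h : has_mean (fun w => \sum_i \sum_j M i j * (xv w i 0 * xv w j 0))
    (\sum_i \sum_j M i j * Sigma i j).
  by do 2 apply: has_mean_sum => ?; apply: has_meanZ; exact: mean_coordM.
have Ss i j : Sigma j i = Sigma i j.
  by rewrite -!x_cov; apply: eq_Rintegral => w _; rewrite mulrC.
have -> : \tr (M *m Sigma) = \sum_i \sum_j M i j * Sigma i j.
  apply: eq_bigr => i _; rewrite mxE; apply: eq_bigr => j _.
  by rewrite Ss.
apply: has_mean_ext h => w; rewrite quadE bilE.
by do 2 apply: eq_bigr => ? _; ring.
Qed.

(** Existence of this mean is enough: it will be multiplied by the zero mean of the perturbation. *)
Let mean_quad_coord (M : 'M[R]_n) k : possemidef M ->
  exists c, has_mean (fun w => quad M (xv w) * xv w k 0) c.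
Proof.
move=> Mp; eexists.
apply: (mean_x (f := fun t => quad M (vec t) * vec t k 0) (c := spectral_norm M * Cm * (1 + Cm))).
- apply: measurable_funM; last exact: mtup.
  by apply: mx_measurable_quad; [exact: mx_measurable_cst|exact: mtup].
- by rewrite !mulr_ge0 ?spectral_norm_ge0 ?addr_ge0 ?(ltW Cm_gt0).
move=> t h; rewrite normrM ler_pM//; last first.
  by rewrite (le_trans (coord_norm_le _ _))// lerD2l.
rewrite ger0_norm; last by have [] := Mp.
by rewrite (le_trans (quad_le_spectral_norm _ _))// ler_wpM2l// spectral_norm_ge0.
Qed.

Let mean_eta_coord j : has_mean (fun w => yv w j 0) 0.
Proof.
by apply: has_mean_ext (gaussian_coord_id eta_law j) => w; rewrite mxE.
Qed.

Let mean_eta_coordM j l : has_mean (fun w => yv w j 0 * yv w l 0) (j == l)%:R.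
Proof.
by apply: has_mean_ext (gaussian_coordM eta_law j l) => w; rewrite !mxE.
Qed.

Let mean_eta_quad_coord (H : 'M[R]_m) j : possemidef H ->
  exists c, has_mean (fun w => quad H (yv w) * yv w j 0) c.
Proof.
move=> Hp; eexists; split; last by [].
have [[i1 _] [i2 _] _] := gaussian_sqn_moments eta_law.
apply: (@le_integrable_real _ _ _ Pr setT _
  (fun w => spectral_norm H * (sqn (yv w) + sqn (yv w) ^+ 2))) => //.
- apply: measurable_funM; last exact: mx_measurable_eta.
  by apply: mx_measurable_quad; [exact: mx_measurable_cst|exact: mx_measurable_eta].
- move=> w _; rewrite normrM (ger0_norm (Hp.2 _)).
  rewrite (@le_trans _ _ (spectral_norm H * sqn (yv w) * (1 + sqn (yv w))))//.
    by rewrite ler_pM ?coord_norm_le ?quad_le_spectral_norm//; case: Hp.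
  by rewrite mulrDr mulr1 -mulrA -expr2 mulrDr.
have h := has_meanZ (spectral_norm H) (has_meanD (conj i1 erefl) (conj i2 erefl)).
by case: h.
Qed.

Lemma mean_independent (f : n.-tuple R -> R) (g : m.-tuple R -> R) a b :
  measurable_fun setT f -> measurable_fun setT g ->
  has_mean (fun w => f (x w)) a -> has_mean (fun w => g (eta w)) b ->
  has_mean (fun w => f (x w) * g (eta w)) (a * b).
Proof.
move=> mf mg [fi <-] [gi <-].
have ind' : independent_systems Pr (generated_by (fun w => f (x w)))
    (generated_by (fun w => g (eta w))).
  apply: independent_systems_sub ind.
    move=> _ [C mC <-]; exists (f @^-1` C); last by rewrite !setTI.
    by rewrite -[X in measurable X]setTI; exact: mf.
  move=> _ [C mC <-]; exists (g @^-1` C); last by rewrite !setTI.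
  by rewrite -[X in measurable X]setTI; exact: mg.
split; last exact: Rintegral_independentM.
by have := integrable_independentM fi gi ind'; apply: eq_integrable.
Qed.


(** The trace against [Sigma] is the expectation of the form at the random state, so the order
    passes to traces without diagonalising [Sigma]. *)
Lemma tr_mono (M M' : 'M[R]_n) : (forall z, quad M z <= quad M' z) ->
  \tr (M *m Sigma) <= \tr (M' *m Sigma).
Proof.
move=> MM'; have [i1 <-] := mean_bil_x M; have [i2 <-] := mean_bil_x M'.
by apply: le_Rintegral => // w _.
Qed.

Lemma tr_ge0 (M : 'M[R]_n) : (forall z, 0 <= quad M z) -> 0 <= \tr (M *m Sigma).
Proof.
move=> M0; have <- : \tr (0 *m Sigma) = 0 by rewrite mul0mx mxtrace0.
by apply: tr_mono => z; rewrite [quad 0 z]/quad mulmx0 mul0mx mxE.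
Qed.

Variables (A : 'M[R]_n) (B : 'M[R]_(n, m)) (Q : 'M[R]_n) (W : 'M[R]_m).
Variable P : 'M[R]_n.
Hypotheses (Qpos : posdef Q) (Wpos : posdef W) (Pp : possemidef P)
  (Spos : posdef Sigma) (n_gt0 : (0 < n)%N) (m_gt0 : (0 < m)%N).

Local Notation H := (hess B W P).
Local Notation G := (gain A B W P).
Local Notation gap := (gap B W P Sigma).
Local Notation lW := (lambda_min W).
Local Notation lS := (lambda_min Sigma).

Let Wp : possemidef W := posdef_possemidef Wpos.
Let Qp : possemidef Q := posdef_possemidef Qpos.
Let Hp : possemidef H := posdef_possemidef (hess_posdef B Wpos Pp).

Lemma surrogate_gap K : \tr (policy_cost A B Q W P K *m Sigma) =
  \tr (riccati_step A B Q W P *m Sigma) + gap (K - G).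
Proof.
apply: (has_mean_unique (mean_bil_x _)).
apply: has_mean_ext (has_meanD (mean_bil_x _) (mean_bil_x _)) => w.
rewrite [RHS]quad_policy_cost_gain//; congr (_ + _).
by rewrite -quad_conj.
Qed.

Lemma gap_ge0 D : 0 <= gap D.
Proof. by apply: tr_ge0 => z; rewrite quad_conj; case: Hp. Qed.

Lemma tr_gram_ge k (N : 'M[R]_(k, n)) : lS * frob2 N <= \tr (N^T *m N *m Sigma).
Proof.
have [_ _ SP] := lambda_minE n_gt0 Spos.
rewrite tr_gram /frob2 mulr_sumr; apply: ler_sum => i _.
apply: le_trans (SP _); rewrite le_eqVlt; apply/orP; left; apply/eqP; congr (_ * _).
by apply: eq_bigr => j _; rewrite !mxE.
Qed.

Lemma gap_ge D : lW * lS * frob2 D <= gap D.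
Proof.
have [l0 _ lP] := lambda_minE m_gt0 Wpos.
apply: (@le_trans _ _ (\tr (lW *: (D^T *m D) *m Sigma))).
  by rewrite -scalemxAl linearZ /= -mulrA ler_wpM2l ?(ltW l0)// tr_gram_ge.
apply: tr_mono => z; rewrite quadZM quad_conj (le_trans _ (quad_W_le_hess B W _ Pp))//.
by rewrite -[D^T]mulmx1 quad_conj quad1 lP.
Qed.

(** A bounded cost bounds the policy; this is how the cost level 10 J0 / zeta turns into
    [Ctilde]. *)
Lemma surrogate_ge K :
  lW * lS * frob2 K <= \tr (policy_cost A B Q W P K *m Sigma).
Proof.
have [l0 _ lP] := lambda_minE m_gt0 Wpos.
apply: (@le_trans _ _ (\tr (lW *: (K^T *m K) *m Sigma))).
  by rewrite -scalemxAl linearZ /= -mulrA ler_wpM2l ?(ltW l0)// tr_gram_ge.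
apply: tr_mono => z; rewrite quadZM quad_policy_cost -[K^T]mulmx1 quad_conj quad1.
have [_ Q0] := Qp; have [_ P0] := Pp.
by have := lP (K *m z); have := Q0 z; have := P0 ((A - B *m K) *m z); lra.
Qed.

(** The companion of [M^2 <= c M] from below, again by Cauchy-Schwarz and one cancellation. *)
Lemma sqn_coercive k (M : 'M[R]_k) l z : 0 <= l -> (forall y, l * sqn y <= quad M y) ->
  l * quad M z <= sqn (M *m z).
Proof.
move=> l0 lM.
have M0 y : 0 <= quad M y by rewrite (le_trans _ (lM y))// mulr_ge0// sqn_ge0.
have h : quad M z ^+ 2 <= sqn z * sqn (M *m z).
  have -> : quad M z = bil 1%:M z (M *m z) by rewrite bil_mulr mul1mx.
  by have := bil_cauchy_schwarz z (M *m z) (possemidef1 k); rewrite !quad1.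
have [q0|q0] := ltP 0 (quad M z); last first.
  by rewrite (le_trans _ (sqn_ge0 _))// mulr_ge0_le0.
rewrite -(ler_pM2r q0) -mulrA -expr2 (le_trans (ler_wpM2l l0 h))//.
by rewrite mulrA mulrC ler_wpM2l ?sqn_ge0.
Qed.

(** Gradient domination: the gradient is [2 H D Sigma], so its squared norm is at least [4 lW lS],
    that is [cst_mu], times the gap. The factors come from [H^2 >= lW H] and
    [Sigma^2 >= lS Sigma]. *)
Lemma gradient_ge D : lW * lS * gap D <= frob2 (H *m D *m Sigma).
Proof.
have [w0 _ wP] := lambda_minE m_gt0 Wpos; have [s0 _ sP] := lambda_minE n_gt0 Spos.
have frobE (N : 'M[R]_(m, n)) : frob2 N = \sum_i sqn (row i N)^T.
  by apply: eq_bigr => i _; apply: eq_bigr => j _; rewrite !mxE.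
apply: (@le_trans _ _ (lS * \tr ((H *m D)^T *m (H *m D) *m Sigma))); last first.
  rewrite tr_gram frobE mulr_sumr; apply: ler_sum => i _.
  have -> : (row i (H *m D *m Sigma))^T = Sigma *m (row i (H *m D))^T.
    by rewrite (row_mul i (H *m D)) trmx_mul Spos.1.
  by apply: sqn_coercive => //; exact: ltW.
rewrite mulrAC mulrC ler_wpM2l ?(ltW s0)//.
apply: (@le_trans _ _ (\tr (lW *: (D^T *m H *m D) *m Sigma))).
  by rewrite -scalemxAl linearZ.
apply: tr_mono => z; rewrite quadZM quad_conj.
rewrite -[(H *m D)^T]mulmx1 quad_conj quad1 -mulmxA.
apply: sqn_coercive; first exact: ltW.
by move=> y; rewrite (le_trans (wP y))// quad_W_le_hess.
Qed.


Variables (K : 'M[R]_(m, n)) (a s p k : R).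
Hypotheses (s_gt0 : 0 < s) (a_ge0 : 0 <= a) (P_le : spectral_norm P <= p)
  (K_le : spectral_norm K ^+ 2 <= k).

Local Notation D := (K - G).
Local Notation V := (H *m D *m Sigma).
Local Notation u w := (- (K *m xv w) + s *: yv w).

Definition sampled_cost (w : T) : R :=
  quad Q (xv w) + quad W (u w) + quad P (A *m xv w + B *m u w).
Local Notation q := sampled_cost.

Definition cost_coef_x : R := spectral_norm Q + 2 * spectral_norm W * k
   + 2 * p * (spectral_norm A ^+ 2 + 2 * spectral_norm B ^+ 2 * k).
Definition cost_coef_eta : R := 2 * (spectral_norm W + 2 * p * spectral_norm B ^+ 2).
Definition hess_bound : R := spectral_norm W + p * spectral_norm B ^+ 2.
Local Notation c1 := cost_coef_x.
Local Notation c2 := cost_coef_eta.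
Local Notation hb := hess_bound.

Let p_ge0 : 0 <= p. Proof. by rewrite (le_trans _ P_le) ?spectral_norm_ge0. Qed.
Let k_ge0 : 0 <= k. Proof. by rewrite (le_trans _ K_le) ?sqr_ge0. Qed.

Let c1_ge0 : 0 <= c1.
Proof.
by rewrite /c1 !(addr_ge0, mulr_ge0) ?spectral_norm_ge0 ?sqr_ge0 ?addr_ge0
  ?mulr_ge0 ?sqr_ge0 ?spectral_norm_ge0.
Qed.

Let c2_ge0 : 0 <= c2.
Proof.
by rewrite /c2 !mulr_ge0 ?addr_ge0 ?mulr_ge0 ?sqr_ge0 ?spectral_norm_ge0.
Qed.

Let hb_ge0 : 0 <= hb.
Proof. by rewrite /hb addr_ge0 ?mulr_ge0 ?sqr_ge0 ?spectral_norm_ge0. Qed.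

Lemma mx_measurable_u : mx_measurable (fun w => u w).
Proof.
apply: mx_measurableD; last first.
  by apply: mx_measurableZ; [exact: measurable_cst|exact: mx_measurable_eta].
apply: mx_measurableN; apply: mx_measurableM; last exact: mx_measurable_x.
exact: mx_measurable_cst.
Qed.

Lemma measurable_sampled_cost : measurable_fun setT q.
Proof.
have mx := mx_measurable_x; have mu := mx_measurable_u.
have cst p' q' (M : 'M[R]_(p', q')) := @mx_measurable_cst _ T R p' q' M.
apply: measurable_funD; first apply: measurable_funD; apply: mx_measurable_quad => //.
by apply: mx_measurableD; apply: mx_measurableM.
Qed.

(** Of the three terms of the expanded cost, the one free of [eta] is killed by the zero mean of
    [eta], the quadratic one by the zero mean of [x], and the linear one picks out an entry of [V]
    because [eta] has identity covariance. *)
Let mean_cost_coord j i : has_mean (fun w => q w * (yv w j 0 * xv w i 0)) (- 2 * s * V j i).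
Proof.
have PK := policy_cost_possemidef A B Qpos Wpos K Pp.
have [c0 m0] := mean_quad_coord i PK; have [c3 m3] := mean_eta_quad_coord j Hp.
have t1 : has_mean (fun w => (quad (policy_cost A B Q W P K) (xv w) * xv w i 0) * yv w j 0) (c0 * 0).
  apply: (mean_independent (f := fun t => quad (policy_cost A B Q W P K) (vec t) * vec t i 0)
    (g := fun t => vec t j 0)) => //; last exact: mtup.
  apply: measurable_funM; last exact: mtup.
  by apply: mx_measurable_quad; [exact: mx_measurable_cst|exact: mtup].
have t3 : has_mean (fun w => xv w i 0 * (quad H (yv w) * yv w j 0)) (0 * c3).
  apply: (mean_independent (f := fun t => vec t i 0)
    (g := fun t => quad H (vec t) * vec t j 0)) => //; first exact: mtup.
    apply: measurable_funM; last exact: mtup.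
    by apply: mx_measurable_quad; [exact: mx_measurable_cst|exact: mtup].
  exact: mean_coord.
have t2 : has_mean (fun w => \sum_l \sum_r (H *m D) l r *
    ((xv w r 0 * xv w i 0) * (yv w l 0 * yv w j 0)))
    (\sum_l \sum_r (H *m D) l r * (Sigma r i * (l == j)%:R)).
  apply: has_mean_sum => l; apply: has_mean_sum => r; apply: has_meanZ.
  apply: (mean_independent (f := fun t => vec t r 0 * vec t i 0)
    (g := fun t => vec t l 0 * vec t j 0)) => //.
  - by apply: measurable_funM; exact: mtup.
  - by apply: measurable_funM; exact: mtup.
  - exact: mean_coordM.
have VE : \sum_l \sum_r (H *m D) l r * (Sigma r i * (l == j)%:R) = V j i.
  rewrite (bigD1 j)//= [X in _ + X]big1 ?addr0.
    by rewrite [RHS]mxE; apply: eq_bigr => r _; rewrite eqxx mulr1.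
  by move=> l lj; rewrite big1// => r _; rewrite (negbTE lj) !mulr0.
rewrite VE in t2.
have := has_meanD (has_meanD t1 (has_meanZ (- 2 * s) t2)) (has_meanZ (s ^+ 2) t3).
rewrite !mulr0 mul0r mulr0 add0r addr0; apply: has_mean_ext => w.
rewrite /q noisy_cost_expansion//.
have -> : \sum_l \sum_r (H *m D) l r * (xv w r 0 * xv w i 0 * (yv w l 0 * yv w j 0)) =
    bil (H *m D) (yv w) (xv w) * (yv w j 0 * xv w i 0).
  rewrite bilE mulr_suml; apply: eq_bigr => l _; rewrite mulr_suml.
  by apply: eq_bigr => r _; ring.
ring.
Qed.

Let mean_cost_bil : has_mean (fun w => q w * bil V (yv w) (xv w)) (- 2 * s * frob2 V).
Proof.
have h : has_mean (fun w => \sum_j \sum_i V j i * (q w * (yv w j 0 * xv w i 0)))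
    (\sum_j \sum_i V j i * (- 2 * s * V j i)).
  by do 2 apply: has_mean_sum => ?; apply: has_meanZ.
have -> : - 2 * s * frob2 V = \sum_j \sum_i V j i * (- 2 * s * V j i).
  rewrite /frob2 mulr_sumr; apply: eq_bigr => j _; rewrite mulr_sumr.
  by apply: eq_bigr => i _; ring.
apply: has_mean_ext h => w; rewrite bilE mulr_sumr; apply: eq_bigr => j _.
by rewrite mulr_sumr; apply: eq_bigr => i _; ring.
Qed.

Lemma quad_hess_le y : quad H y <= hb * sqn y.
Proof.
rewrite quad_hess /hb mulrDl lerD ?quad_le_spectral_norm//.
rewrite (le_trans (quad_le_spectral_norm _ _))// -mulrA.
by rewrite ler_pM ?spectral_norm_ge0 ?sqn_ge0// sqn_mulmx.
Qed.

(** An upper bound for the mean of (c1 Cm + c2 s^2 |y|^2)^2 |y|^2 Cm / s^2, obtained by inserting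
    the chi-square moments. *)
Definition second_moment_bound : R := 1 / s ^+ 2 * (c1 ^+ 2 * Cm ^+ 3) * m%:R
  + 2 * (c1 * c2 * Cm ^+ 2) * m%:R * (m%:R + 2)
  + s ^+ 2 * (c2 ^+ 2 * Cm) * m%:R * (m%:R + 2) * (m%:R + 4).

Let mean_second : exists2 e,
  has_mean (fun w => (a / s * q w) ^+ 2 * (quad H (yv w) * quad Sigma (xv w))) e &
  e <= a ^+ 2 * (hb * spectral_norm Sigma) * second_moment_bound.
Proof.
pose K0 := (a / s) ^+ 2 * (hb * spectral_norm Sigma) * Cm.
have K0_ge0 : 0 <= K0.
  apply: mulr_ge0 (ltW Cm_gt0); apply: mulr_ge0; first exact: sqr_ge0.
  by apply: mulr_ge0 hb_ge0 _; exact: spectral_norm_ge0.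
have [[i1 e1] [i2 e2] [i3 e3]] := gaussian_sqn_moments eta_law.
(* The dominating function, expanded in powers of |eta|^2 up to the third; this is where sixth
   Gaussian moments enter. *)
pose g w := K0 * (c1 ^+ 2 * Cm ^+ 2 * sqn (yv w) +
  (2 * c1 * c2 * Cm * s ^+ 2 * sqn (yv w) ^+ 2 + c2 ^+ 2 * s ^+ 4 * sqn (yv w) ^+ 3)).
have gE w : g w = K0 * ((c1 * Cm + c2 * (s ^+ 2 * sqn (yv w))) ^+ 2 * sqn (yv w)).
  by rewrite /g; ring.
have mg : has_mean g _ := has_meanZ K0 (has_meanD
  (has_meanZ (c1 ^+ 2 * Cm ^+ 2) (conj i1 e1)) (has_meanD
  (has_meanZ (2 * c1 * c2 * Cm * s ^+ 2) (conj i2 erefl))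
  (has_meanZ (c2 ^+ 2 * s ^+ 4) (conj i3 erefl)))).
have qS0 w : 0 <= quad H (yv w) * quad Sigma (xv w).
  by rewrite mulr_ge0//; [case: Hp|case: (posdef_possemidef Spos)].
have [e me le_e] : exists2 e, has_mean (fun w => (a / s * q w) ^+ 2 *
    (quad H (yv w) * quad Sigma (xv w))) e & e <= K0 * (c1 ^+ 2 * Cm ^+ 2 * m%:R +
   (2 * c1 * c2 * Cm * s ^+ 2 * \int[Pr]_w sqn (yv w) ^+ 2 +
    c2 ^+ 2 * s ^+ 4 * \int[Pr]_w sqn (yv w) ^+ 3)).
  apply: ae_le_mean mg.
  - apply: measurable_funM.
      by apply: measurable_funX; apply: measurable_funM; [exact: measurable_cst|
        exact: measurable_sampled_cost].
    apply: measurable_funM; apply: mx_measurable_quad; try exact: mx_measurable_cst.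
      exact: mx_measurable_eta.
    exact: mx_measurable_x.
  - by move=> w; rewrite mulr_ge0// sqr_ge0.
  - by move=> w; rewrite gE; apply: mulr_ge0 K0_ge0 (mulr_ge0 (sqr_ge0 _) (sqn_ge0 _)).
  apply: filterS x_bound => w xC.
  have q0 : 0 <= q w by exact: cost_ge0.
  have qb : q w <= c1 * Cm + c2 * (s ^+ 2 * sqn (yv w)).
    apply: (@le_trans _ _ (c1 * sqn (xv w) + c2 * (s ^+ 2 * sqn (yv w)))).
      exact: noisy_cost_bound.
    by rewrite lerD2r; exact: ler_wpM2l.
  rewrite gE exprMn -mulrA.
  have -> : K0 * ((c1 * Cm + c2 * (s ^+ 2 * sqn (yv w))) ^+ 2 * sqn (yv w)) =
    (a / s) ^+ 2 * ((c1 * Cm + c2 * (s ^+ 2 * sqn (yv w))) ^+ 2 *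
     ((hb * sqn (yv w)) * (spectral_norm Sigma * Cm))) by rewrite /K0; ring.
  rewrite ler_wpM2l ?sqr_ge0// ler_pM ?sqr_ge0//.
    by rewrite ler_pow2// (le_trans q0).
  rewrite ler_pM ?quad_hess_le//; [by case: Hp|by case: (posdef_possemidef Spos)|].
  by rewrite (le_trans (quad_le_spectral_norm _ _))// ler_wpM2l ?spectral_norm_ge0.
exists e => //; apply: (le_trans le_e).
set M2 := \int[Pr]_w _ in e2 *; set M3 := \int[Pr]_w _ in e3 *.
have h2 : 2 * c1 * c2 * Cm * s ^+ 2 * M2 <= 2 * c1 * c2 * Cm * s ^+ 2 * (m%:R * (m%:R + 2)).
  have c0 : 0 <= 2 * c1 * c2 * Cm * s ^+ 2.
    apply: mulr_ge0 (sqr_ge0 _); apply: mulr_ge0 (ltW Cm_gt0).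
    by apply: mulr_ge0 c2_ge0; apply: mulr_ge0 c1_ge0.
  exact: ler_wpM2l c0 _ _ e2.
have h3 : c2 ^+ 2 * s ^+ 4 * M3 <= c2 ^+ 2 * s ^+ 4 * (m%:R * (m%:R + 2) * (m%:R + 4)).
  have c20 := mulr_ge0 (sqr_ge0 c2) (exprn_ge0 4 (ltW s_gt0)).
  exact: ler_wpM2l c20 _ _ e3.
have h := lerD h2 h3; rewrite -(lerD2l (c1 ^+ 2 * Cm ^+ 2 * m%:R)) in h.
apply: (le_trans (ler_wpM2l K0_ge0 h)).
rewrite le_eqVlt /second_moment_bound /K0; apply/orP; left; apply/eqP.
by field; rewrite gt_eqF.
Qed.

(* The cross term is a times the inner product of the exact gradient 2 H D Sigma
   with itself: the one-point estimate is unbiased because x and eta are centred. *)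
Lemma gap_step : exists2 e,
  has_mean (fun w => gap (K + (a / s * q w) *: (yv w *m (xv w)^T) - G)) e &
  e <= (1 - 4 * a * (lW * lS)) * gap D + a ^+ 2 * (hb * spectral_norm Sigma) * second_moment_bound.
Proof.
have [e me le_e] := mean_second.
have mb := has_meanZ (2 * (a / s)) mean_cost_bil.
exists (gap D + 2 * (a / s) * (- 2 * s * frob2 V) + e).
  apply: has_mean_ext (has_meanD (has_meanD (has_mean_cst Pr (gap D)) mb) me) => w.
  have -> : K + (a / s * q w) *: (yv w *m (xv w)^T) - G =
    D + (a / s * q w) *: (yv w *m (xv w)^T) by rewrite addrAC.
  by rewrite gap_rank1 ?Spos.1//=; ring.
rewrite lerD// mulrBl mul1r lerD2l.
have -> : 2 * (a / s) * (- 2 * s * frob2 V) = - (4 * a * frob2 V).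
  by field; rewrite gt_eqF.
rewrite lerN2 -[leLHS]mulrA.
by apply: ler_wpM2l (gradient_ge _); apply: mulr_ge0 a_ge0.
Qed.

End gradient_mean.

(** * One stage *)

Section potential.
Context {R : realType}.
Variables (J0 Jst mu s2 zeta th : R) (N : nat).
Hypotheses (J0_gt0 : 0 < J0) (Jst_ge0 : 0 <= Jst) (mu_gt0 : 0 < mu) (s2_gt0 : 0 < s2)
  (zeta_gt0 : 0 < zeta) (th_ge2 : 2 <= th).
Hypothesis N_ge : 40 / (7 * mu * s2 * zeta) * th * J0 <= N%:R.

(* The first summand exceeds 1 as soon as the surrogate cost exceeds 10 J0 / zeta,
   the second one exceeds 1 at time N if the gap exceeds (mu / 4) s2. *)
Definition potential (i : nat) (D : R) : R :=
  zeta / (10 * J0) * (D + Jst + J0 * th / (i%:R + th - 1)) +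
  4 / (mu * s2) * (((i%:R + th - 1) * (i%:R + th - 2) * D + (N%:R - i%:R) * th * J0)
    / ((N%:R + th - 1) * (N%:R + th - 2))).

Let a0 : 0 < zeta / (10 * J0). Proof. by rewrite divr_gt0// mulr_gt0. Qed.
Let b0 : 0 < 4 / (mu * s2). Proof. by rewrite divr_gt0// mulr_gt0. Qed.

Let N_gt0 : 0 < N%:R :> R.
Proof.
apply: lt_le_trans N_ge; rewrite mulr_gt0// mulr_gt0// ?divr_gt0 ?mulr_gt0//.
by have := th_ge2; lra.
Qed.

Let c0 : 0 < (N%:R + th - 1) * (N%:R + th - 2).
Proof. by rewrite mulr_gt0//; have := N_gt0; have := th_ge2; lra. Qed.

Lemma potential_affine i D : potential i D = potential i 0 +
  (zeta / (10 * J0) + 4 / (mu * s2) * (((i%:R + th - 1) * (i%:R + th - 2))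
    / ((N%:R + th - 1) * (N%:R + th - 2)))) * D.
Proof. by rewrite /potential; ring. Qed.

Lemma potential_mono i D D' : D <= D' -> potential i D <= potential i D'.
Proof.
move=> DD'; rewrite potential_affine [leRHS]potential_affine lerD2l.
apply: ler_wpM2l DD'; apply: addr_ge0 (ltW a0) _.
apply: mulr_ge0 (ltW b0) _; rewrite divr_ge0 ?(ltW c0)//.
have i0 : 0 <= i%:R :> R by [].
by rewrite mulr_ge0//; have := th_ge2; lra.
Qed.

Let parts_ge0 i D : 0 <= D -> (i <= N)%N -> 0 <= J0 * th / (i%:R + th - 1) /\
  0 <= 4 / (mu * s2) * (((i%:R + th - 1) * (i%:R + th - 2) * D + (N%:R - i%:R) * th * J0)
    / ((N%:R + th - 1) * (N%:R + th - 2))).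
Proof.
move=> D0 iN; have i0 : 0 <= i%:R :> R by [].
have iNR : i%:R <= N%:R :> R by rewrite ler_nat.
have t2 := th_ge2; split; first by rewrite divr_ge0 ?mulr_ge0 ?(ltW J0_gt0)//; lra.
apply: mulr_ge0 (ltW b0) _; rewrite divr_ge0 ?(ltW c0)// addr_ge0//.
  by rewrite mulr_ge0// mulr_ge0//; lra.
by rewrite mulr_ge0 ?(ltW J0_gt0)// mulr_ge0//; lra.
Qed.

Lemma potential_ge0 i D : 0 <= D -> (i <= N)%N -> 0 <= potential i D.
Proof.
move=> D0 iN; have [h1 h2] := parts_ge0 D0 iN.
apply: addr_ge0 h2; apply: mulr_ge0 (ltW a0) _.
by have := Jst_ge0; lra.
Qed.

Lemma potential_exit i D : 0 <= D -> (i <= N)%N ->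
  10 * zeta^-1 * J0 <= D + Jst -> 1 <= potential i D.
Proof.
move=> D0 iN h; have [h1 h2] := parts_ge0 D0 iN.
rewrite -[1]addr0 /potential; apply: lerD h2.
rewrite (@le_trans _ _ (zeta / (10 * J0) * (10 * zeta^-1 * J0)))//.
  by rewrite le_eqVlt; apply/orP; left; apply/eqP; field; rewrite !gt_eqF.
by rewrite ler_wpM2l ?(ltW a0)//; lra.
Qed.

(** At time [N] the weights cancel and the second summand is 4 D / (mu s2). *)
Lemma potential_final D f : 0 <= D -> mu / 4 * f <= D -> s2 < f -> 1 <= potential N D.
Proof.
move=> D0 fD sf; rewrite -[1]add0r /potential; apply: lerD.
  apply: mulr_ge0 (ltW a0) _; have [h1 _] := parts_ge0 D0 (leqnn N).
  by have := Jst_ge0; lra.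
rewrite subrr !mul0r addr0 (mulrAC _ D) mulfV ?mul1r; last by rewrite gt_eqF.
rewrite (@le_trans _ _ (4 / (mu * s2) * (mu / 4 * s2)))//.
  by rewrite le_eqVlt; apply/orP; left; apply/eqP; field; rewrite !gt_eqF.
rewrite ler_wpM2l ?(ltW b0)// (le_trans _ fD)// ler_wpM2l ?divr_ge0 ?(ltW mu_gt0)//.
exact: ltW.
Qed.

(** Let s = i + th. In the first summand, 1/s^2 <= 1/(s-1) - 1/s shows that the correction
    [J0 th / (s - 1)] pays for the noise. In the second, s (s-1) (1 - 2/s) = (s-1) (s-2) reproduces
    the weight of step [i], and the weighted noise, at most [th J0], is taken from
    [(N - i) th J0]. *)
Lemma potential_step i D : 0 <= D -> (i < N)%N ->
  potential i.+1 ((1 - 2 / (i%:R + th)) * D + th * J0 / (i%:R + th) ^+ 2)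
  <= potential i D.
Proof.
move=> D0 iN; have i0 : 0 <= i%:R :> R by [].
have t2 := th_ge2; rewrite /potential -[i.+1%:R]natr1.
set s := i%:R + th; have s2' : 2 <= s by rewrite /s; lra.
have -> : i%:R + 1 + th - 1 = s by rewrite /s; ring.
have -> : i%:R + 1 + th - 2 = s - 1 by rewrite /s; ring.
have s0 : 0 < s by lra. have s1 : 0 < s - 1 by lra.
have si : 0 <= s^-1 ^+ 2 by rewrite sqr_ge0.
have tJ : 0 <= th * J0 by rewrite mulr_ge0 ?(ltW J0_gt0)//; lra.
apply: lerD.
  apply: ler_wpM2l; first exact: ltW.
  have h : s^-1 ^+ 2 + s^-1 <= (s - 1)^-1.
    rewrite -subr_ge0 (_ : _ - _ = (s ^+ 2 * (s - 1))^-1); last first.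
      by field; rewrite !gt_eqF.
    by rewrite invr_ge0 mulr_ge0 ?sqr_ge0 ?ltW.
  have h2 : 0 <= 2 / s * D by apply: mulr_ge0 D0; apply: divr_ge0 => //; exact: ltW.
  have := ler_wpM2l tJ h; rewrite -exprVn; move: h2.
  by move: s^-1 (s - 1)^-1 => u v; lra.
apply: ler_wpM2l; first exact: ltW.
rewrite ler_wpM2r ?invr_ge0 ?(ltW c0)//.
have -> : s * (s - 1) * ((1 - 2 / s) * D + th * J0 / s ^+ 2) =
  (s - 1) * (s - 2) * D + th * J0 * (1 - s^-1) by field; rewrite gt_eqF.
have : th * J0 * (1 - s^-1) <= th * J0.
  by rewrite ler_piMr// gerBl invr_ge0 ltW.
by move: s^-1 => u; lra.
Qed.

(** Since [th >= 2], the first summand is at most 3/10 [zeta]; the lower bound on [N] makes the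
    second at most 7/10 [zeta], as 40/7 is 4 divided by 7/10. *)
Lemma potential_start D : 0 <= D -> D + Jst = J0 -> potential 0 D <= zeta.
Proof.
move=> D0 DJ; have t2 := th_ge2; have n0 := N_gt0.
rewrite (_ : zeta = 3 / 10 * zeta + 7 / 10 * zeta); last by field.
rewrite /potential !add0r subr0 DJ; apply: lerD.
  have h : th / (th - 1) <= 2 by rewrite ler_pdivrMr; lra.
  have -> : zeta / (10 * J0) * (J0 + J0 * th / (th - 1)) = zeta / 10 * (1 + th / (th - 1)).
    by field; rewrite !gt_eqF//; lra.
  have z0 := zeta_gt0; have := ler_wpM2l (ltW z0) h; set x := th / _; lra.
have thN : 0 <= th / N%:R by rewrite divr_ge0//; lra.
have h : ((th - 1) * (th - 2) * D + N%:R * th * J0) /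
    ((N%:R + th - 1) * (N%:R + th - 2)) <= th / N%:R * J0.
  rewrite ler_pdivrMr// -(ler_pM2r n0).
  rewrite (@le_trans _ _ (((th - 1) * (th - 2) + N%:R * th) * J0 * N%:R))//.
    have tt0 : 0 <= (th - 1) * (th - 2) by rewrite mulr_ge0//; lra.
    have DJ0 : D <= J0 by have := Jst_ge0; lra.
    by rewrite ler_pM2r//; have := ler_wpM2l tt0 DJ0; lra.
  have -> : th / N%:R * J0 * ((N%:R + th - 1) * (N%:R + th - 2)) * N%:R =
    th * ((N%:R + th - 1) * (N%:R + th - 2)) * J0 by field; rewrite gt_eqF.
  rewrite mulrAC ler_pM2r//.
  (* The two sides differ by N (th^2 - 2) + th (th - 1) (th - 2). *)
  have tt : 2 <= th ^+ 2 by nra.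
  have h1 : 0 <= N%:R * (th ^+ 2 - 2) by rewrite mulr_ge0 ?(ltW n0)//; lra.
  have h2 : 0 <= th * ((th - 1) * (th - 2)) by rewrite !mulr_ge0//; lra.
  lra.
apply: (le_trans (ler_wpM2l (ltW b0) h)).
have k0 : 0 < 7 * zeta / (10 * N%:R) by rewrite divr_gt0// mulr_gt0.
have := ler_wpM2l (ltW k0) N_ge.
have -> : 7 * zeta / (10 * N%:R) * (40 / (7 * mu * s2 * zeta) * th * J0) =
  4 / (mu * s2) * (th / N%:R * J0) by field; rewrite !gt_eqF.
by have -> : 7 * zeta / (10 * N%:R) * N%:R = 7 / 10 * zeta by field; rewrite gt_eqF.
Qed.

End potential.

Lemma measurable_absz_ceil d (T : measurableType d) (R : realType) (f : T -> R) k :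
  measurable_fun setT f -> measurable [set t | `|Num.ceil (f t)|%N = k].
Proof.
move=> mf.
have mz (z : int) : measurable [set t | Num.ceil (f t) = z].
  rewrite (_ : [set _ | _] = f @^-1` `](z - 1)%:~R, z%:~R]).
    by rewrite -[X in measurable X]setTI; exact: mf.
  apply/seteqP; split=> t /=; rewrite in_itv/= -ceil_eq; first by move=> ->.
  by move/eqP.
rewrite (_ : [set _ | _] = [set t | Num.ceil (f t) = k%:Z] `|` [set t | Num.ceil (f t) = - k%:Z]).
  exact: measurableU.
apply/seteqP; split=> t /=.
  move=> kE; have [h|h] := leP 0 (Num.ceil (f t)).
    by left; rewrite -kE gez0_abs.
  by right; rewrite -kE ltz0_abs// opprK.
by move=> [->|->]; rewrite ?abszN.
Qed.

(** * Measurability of a stage in its random value matrix *)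

Section measurable_stage.
Context {R : realType} {n m : nat} (p : rhpg_setting R n m).
Context d (T : measurableType d).

Local Notation A := (sysA p).
Local Notation B := (sysB p).
Local Notation Q := (costQ p).
Local Notation W := (costR p).

Hypotheses (Wpos : posdef W)
  (surrogateE : forall P K, surrogate_cost p P K =
     \tr (policy_cost A B Q W P K *m init_cov p)).
Variable P : T -> 'M[R]_n.
Hypotheses (mP : mx_measurable P) (Pp : forall t, possemidef (P t)).

Lemma mx_measurable_gain : mx_measurable (fun t => gain A B W (P t)).
Proof.
have cst p' q' (M : 'M[R]_(p', q')) := @mx_measurable_cst _ T R p' q' M.
do 3 apply: mx_measurableM => //; apply: mx_measurable_inv.
  by move=> t; exact: posdef_unitmx (hess_posdef B Wpos (Pp t)).
by apply: mx_measurableD => //; do 2 apply: mx_measurableM => //.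
Qed.

Lemma mx_measurable_policy_cost (K : T -> 'M[R]_(m, n)) : mx_measurable K ->
  mx_measurable (fun t => policy_cost A B Q W (P t) (K t)).
Proof.
move=> mK; have cst p' q' (M : 'M[R]_(p', q')) := @mx_measurable_cst _ T R p' q' M.
have mL : mx_measurable (fun t => A - B *m K t).
  by apply: mx_measurableD => //; apply: mx_measurableN; exact: mx_measurableM.
apply: mx_measurableD => //; apply: mx_measurableD.
  by do 2 apply: mx_measurableM => //; exact: mx_measurable_tr.
by do 2 apply: mx_measurableM => //; exact: mx_measurable_tr.
Qed.

Lemma measurable_surrogate_cost (K : T -> 'M[R]_(m, n)) : mx_measurable K ->
  measurable_fun setT (fun t => surrogate_cost p (P t) (K t)).
Proof.
move=> mK; under eq_fun do rewrite surrogateE.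
apply: mx_measurable_mxtrace; apply: mx_measurableM; last exact: mx_measurable_cst.
exact: mx_measurable_policy_cost.
Qed.

Lemma measurable_theta h : measurable_fun setT (fun t => theta p (P t) h).
Proof.
have c (x : R) : measurable_fun (setT : set T) (cst x) by exact: measurable_cst.
have mJ := measurable_surrogate_cost (mx_measurable_cst (init_policy p h)).
have mC : measurable_fun setT (fun t => Ctilde p (P t) h).
  apply: measurable_funM => //; apply: measurable_funD; first exact: measurable_funM.
  exact: measurable_surrogate_cost mx_measurable_gain.
have m1 : measurable_fun setT (fun t => xi1 p (P t) h).
  apply: measurable_funM => //; apply: measurable_funD.
    by apply: measurable_funD => //; exact: measurable_funM.
  by apply: measurable_funM => //; apply: measurable_funD => //; exact: measurable_funM.
have m3 : measurable_fun setT (fun t => xi3 p (P t) h).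
  apply: measurable_funD => //; apply: measurable_funD.
    by apply: measurable_funM => //; apply: measurable_funM => //; exact: measurable_funX.
  do 2 apply: measurable_funM => //; apply: measurable_funM => //.
  exact: measurable_funM.
apply: measurable_maxr => //; apply: measurable_funM; first exact: measurable_funM.
by apply: measurable_fun_inv; exact: measurable_funM.
Qed.

Lemma measurable_num_iterations h k :
  measurable [set t | num_iterations p (P t) h = k].
Proof.
apply: measurable_absz_ceil; apply: measurable_funM.
  by apply: measurable_funM; [exact: measurable_cst|exact: measurable_theta].
exact: measurable_surrogate_cost (mx_measurable_cst _).
Qed.

Variables (x : T -> nat -> 'cV[R]_n) (eta : T -> nat -> 'cV[R]_m).

Lemma mx_measurable_policy_iterate h i :
  (forall j, (j < i)%N -> mx_measurable (fun t => x t j)) ->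
  (forall j, (j < i)%N -> mx_measurable (fun t => eta t j)) ->
  mx_measurable (fun t => policy_iterate p (P t) h (x t) (eta t) i).
Proof.
have c (z : R) : measurable_fun (setT : set T) (cst z) by exact: measurable_cst.
have cst p' q' (M : 'M[R]_(p', q')) := @mx_measurable_cst _ T R p' q' M.
elim: i => [mx me|i IH mx me]; first exact: cst.
have mK : mx_measurable (fun t => policy_iterate p (P t) h (x t) (eta t) i).
  by apply: IH => j ji; [apply: mx|apply: me]; exact: leqW.
have mxi := mx i (ltnSn i); have mei := me i (ltnSn i).
have mu : mx_measurable (fun t => - (policy_iterate p (P t) h (x t) (eta t) i *m x t i)
    + smoothing p *: eta t i).
  apply: mx_measurableD; last exact: mx_measurableZ.
  by apply: mx_measurableN; exact: mx_measurableM.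
apply: mx_measurableD => //; apply: mx_measurableZ; last first.
  by apply: mx_measurableM => //; exact: mx_measurable_tr.
apply: measurable_funM; last first.
  apply: measurable_funD; first by apply: measurable_funD; exact: mx_measurable_quad.
  apply: mx_measurable_quad => //.
  by apply: mx_measurableD; exact: mx_measurableM.
apply: measurable_funM => //; apply: measurable_funM => //; apply: measurable_funM => //.
apply: measurable_fun_inv; apply: measurable_funD => //; exact: measurable_theta.
Qed.

(** The number of iterations is itself a function of [P t]; the event is cut along its countably
    many values, on each of which the policy is a fixed iterate. *)
Lemma mx_measurable_stage_policy h :
  (forall j, mx_measurable (fun t => x t j)) ->
  (forall j, mx_measurable (fun t => eta t j)) ->
  mx_measurable (fun t => stage_policy p (P t) h (x t) (eta t)).
Proof.
move=> mx me i j _ Y mY; rewrite setTI.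
rewrite (_ : _ @^-1` _ = \bigcup_k ([set t | num_iterations p (P t) h = k] `&`
   (fun t => policy_iterate p (P t) h (x t) (eta t) k i j) @^-1` Y)).
  apply: bigcup_measurable => k _; apply: measurableI.
    exact: measurable_num_iterations.
  rewrite -[X in measurable X]setTI.
  by apply: mx_measurable_policy_iterate.
apply/seteqP; split=> [t Yt|t [k _ [/= kE]]].
  by exists (num_iterations p (P t) h).
by rewrite -kE.
Qed.

End measurable_stage.

(** * Transfer from the initial law to the draws *)

Section initial_law.
Context {R : realType} {n : nat} (D : probability (n.-tuple R) R).
Variables (Sigma0 : 'M[R]_n) (Cm : R).
Hypotheses (mean0 : forall i, ('E_D[fun x => vec x i 0%R] = 0)%E)
  (cov0 : forall i j, ('E_D[fun x => (vec x i 0 * vec x j 0)%R] = (Sigma0 i j)%:E)%E)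
  (Cm_gt0 : 0 < Cm) (x0bound : {ae D, forall x, l2norm (vec x) ^+ 2 <= Cm}).

(** Viewing the identity as a random variable lets the lemmas on sampled states apply to the law [D]
    itself. *)
Let idm : {mfun (n.-tuple R) >-> n.-tuple R} :=
  HB.pack_for {mfun (n.-tuple R) >-> n.-tuple R} (@idfun (n.-tuple R))
    (isMeasurableFun.Build _ _ _ _ (@idfun (n.-tuple R)) (@measurable_id _ _ _)).

Let bound : {ae D, forall x, sqn (vec x) <= Cm}.
Proof. by apply: filterS x0bound => x; rewrite l2norm_sqr. Qed.

Lemma law_covE i j : \int[D]_x (vec (idm x) i 0 * vec (idm x) j 0) = Sigma0 i j.
Proof. by have := cov0 i j; rewrite unlock /Rintegral => ->. Qed.

Lemma law_mean_quad M : has_mean D (fun x => quad M (vec x)) (\tr (M *m Sigma0)).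
Proof. exact: (mean_bil_x (x := idm) Cm_gt0 bound law_covE). Qed.

Lemma surrogate_cost_trE m (p : rhpg_setting R n m) P K :
  init_law p = D -> init_cov p = Sigma0 -> surrogate_cost p P K =
  \tr (policy_cost (sysA p) (sysB p) (costQ p) (costR p) P K *m init_cov p).
Proof.
move=> pD ->; rewrite /surrogate_cost pD unlock.
by have [_ <-] := law_mean_quad (policy_cost (sysA p) (sysB p) (costQ p) (costR p) P K).
Qed.

Context d (T : measurableType d) (Pr : probability T R).
Variable X : {mfun T >-> n.-tuple R}.
Hypothesis X_law : forall U, measurable U -> distribution Pr X U = D U.

Lemma law_has_mean (f : n.-tuple R -> R) c : has_mean D f c ->
  has_mean Pr (fun w => f (X w)) c.
Proof.
move=> [fi fc].
have mf : measurable_fun setT (EFin \o f) := measurable_int D fi.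
have fiX : Pr.-integrable setT ((EFin \o f) \o X).
  apply/integrableP; split; first exact: measurableT_comp mf _.
  have mg : measurable_fun setT (fun t => `|(EFin \o f) t|)%E by exact: measurableT_comp mf.
  have g0 t : (0 <= `|(EFin \o f) t|)%E by exact: abse_ge0.
  rewrite -(ge0_integral_distribution X mg g0).
  rewrite (eq_measure_integral D) => [|U mU _]; last exact: X_law.
  by have /integrableP[] := fi.
split=> //; rewrite -fc /Rintegral; congr fine.
rewrite -[LHS](integral_distribution mf fiX).
by apply: eq_measure_integral => U mU _; exact: X_law.
Qed.

Lemma law_x_bound : {ae Pr, forall w, sqn (vec (X w)) <= Cm}.
Proof.
have mB : measurable [set t : n.-tuple R | ~ sqn (vec t) <= Cm].
  have ms : measurable_fun setT (fun t : n.-tuple R => sqn (vec t)).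
    by apply: mx_measurable_sqn; apply: mx_measurable_vec; exact: measurable_id.
  exact: measurableC (measurable_sublevel _ ms).
apply/negligibleP.
  have mX : measurable_fun setT X by exact: measurable_funPT.
  have := mX measurableT _ mB; rewrite setTI; exact.
transitivity (D [set t | ~ sqn (vec t) <= Cm]); first by rewrite -X_law.
exact/negligibleP.
Qed.

Lemma law_x_mean k : \int[Pr]_w vec (X w) k 0 = 0.
Proof.
have mk : measurable_fun setT (fun t : n.-tuple R => vec t k 0).
  by apply: mx_measurable_vec; exact: measurable_id.
have : has_mean D (fun t => vec t k 0) 0.
  split; last by have := mean0 k; rewrite unlock /Rintegral => ->.
  apply: (@ae_le_integrable _ _ _ _ _ (cst (1 + Cm))) => //.
  - by move=> w; rewrite addr_ge0 ?(ltW Cm_gt0).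
  - apply: filterS bound => t h; rewrite (le_trans (coord_norm_le _ _))//=.
    by rewrite lerD2l.
  - exact: finite_measure_integrable_cst.
by move/law_has_mean => [].
Qed.

Lemma law_x_cov i j : \int[Pr]_w (vec (X w) i 0 * vec (X w) j 0) = Sigma0 i j.
Proof.
have mk l : measurable_fun setT (fun t : n.-tuple R => vec t l 0).
  by apply: mx_measurable_vec; exact: measurable_id.
have : has_mean D (fun t => vec t i 0 * vec t j 0) (Sigma0 i j).
  split; last exact: law_covE.
  apply: (@ae_le_integrable _ _ _ _ _ (cst Cm)) => //.
  - exact: measurable_funM.
  - by move=> w; exact: ltW.
  - by apply: filterS bound => t h; rewrite (le_trans (coordM_norm_le _ _ _)).
  - exact: finite_measure_integrable_cst.
by move/law_has_mean => [].
Qed.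

End initial_law.

Lemma measurable_independent_integral d d1 d2 (T : measurableType d)
    (T1 : measurableType d1) (T2 : measurableType d2) (R : realType)
    (P : probability T R) (X : T -> T1) (Y : T -> T2) (f : T1 * T2 -> \bar R) :
  measurable_fun setT X -> measurable_fun setT Y ->
  measurable_fun setT f -> (forall z, 0 <= f z)%E ->
  measurable_fun setT (fun w => \int[P]_w' f (X w, Y w'))%E.
Proof.
move=> mX mY mf f0.
pose Y' := HB.pack_for {mfun T >-> T2} Y (isMeasurableFun.Build _ _ T T2 Y mY).
have -> : (fun w => \int[P]_w' f (X w, Y w'))%E =
    fubini_F (distribution P Y') f \o X.
  apply/funext => w; rewrite /= /fubini_F (ge0_integral_distribution Y')//.
  exact: measurableT_comp mf (measurable_fun_pair (measurable_cst _) (@measurable_id _ _ _)).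
apply: (measurableT_comp _ mX); exact: (measurable_fun_fubini_tonelli_F f).
Qed.

(** * Failure probability of one stage for a fixed value matrix *)

Section stage.
Context {R : realType} {n m : nat} (p : rhpg_setting R n m).
Context d (T : measurableType d) (Pr : probability T R).
Variables (x : nat -> {mfun T >-> n.-tuple R}) (eta : nat -> {mfun T >-> m.-tuple R}).
Variables (h : nat) (P : 'M[R]_n).

Local Notation A := (sysA p).
Local Notation B := (sysB p).
Local Notation Q := (costQ p).
Local Notation W := (costR p).
Local Notation Sigma := (init_cov p).
Local Notation Cm := (init_bound p).
Local Notation zeta := (failure p).
Local Notation sigma := (smoothing p).
Local Notation lW := (lambda_min W).
Local Notation lS := (lambda_min Sigma).
Local Notation mu := (cst_mu p).
Local Notation Pb := (cst_Pmax p + cst_a p).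
Local Notation G := (gain A B W P).
Local Notation J K := (surrogate_cost p P K).
Local Notation J0 := (J (init_policy p h)).
Local Notation Jst := (J G).
Local Notation th := (theta p P h).
Local Notation s2 := (target_accuracy p h ^+ 2).
Local Notation N := (num_iterations p P h).
Local Notation gap := (gap B W P Sigma).

Definition stage_draws (k : nat + nat) : set_system T :=
  match k with inl i => generated_by (x i) | inr i => generated_by (eta i) end.

Definition past_draws (i : nat) : set (nat + nat) :=
  [set k | (match k with inl j => j | inr j => j end < i)%N].

Hypotheses (n_gt0 : (0 < n)%N) (m_gt0 : (0 < m)%N).
Hypotheses (Qpos : posdef Q) (Wpos : posdef W) (Spos : posdef Sigma).
Hypotheses (Cm_gt0 : 0 < Cm) (zeta_gt0 : 0 < zeta) (sigma_gt0 : 0 < sigma).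
Hypothesis surrogateE : forall P K, surrogate_cost p P K =
     \tr (policy_cost A B Q W P K *m Sigma).
Hypotheses (eta_law : forall i, standard_gaussian (distribution Pr (eta i)))
  (x_bound : forall i, {ae Pr, forall w, sqn (vec (x i w)) <= Cm})
  (x_mean : forall i k, \int[Pr]_w vec (x i w) k 0 = 0)
  (x_cov : forall i k l, \int[Pr]_w (vec (x i w) k 0 * vec (x i w) l 0) = Sigma k l)
  (ind : mutually_independent Pr stage_draws).
Hypotheses (Pp : possemidef P) (P_le : spectral_norm P <= Pb)
  (acc_gt0 : 0 < target_accuracy p h).

Let stage_draws_measurable k : stage_draws k `<=` measurable.
Proof. by case: k => i; apply: generated_by_measurable. Qed.

Let draws_independent (J1 J2 : set (nat + nat)) : [disjoint J1 & J2]%classic ->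
  independent_systems Pr (joint_sigma stage_draws J1) (joint_sigma stage_draws J2).
Proof.
move=> J12; apply: (joint_sigma_independent stage_draws_measurable _ _ ind J12).
  by case=> i; exact: generated_by_setT.
by case=> i; exact: generated_by_setI.
Qed.

Let lW_gt0 : 0 < lW. Proof. by case: (lambda_minE m_gt0 Wpos). Qed.
Let lS_gt0 : 0 < lS. Proof. by case: (lambda_minE n_gt0 Spos). Qed.

Let muE : mu = 4 * (lW * lS).
Proof.
rewrite /cst_mu; have [_ -> _] := lambda_minE m_gt0 Wpos.
by have [_ -> _] := lambda_minE n_gt0 Spos; ring.
Qed.

Let mu_gt0 : 0 < mu. Proof. by rewrite muE !mulr_gt0. Qed.

Let JE K : J K = J G + gap (K - G).
Proof.
rewrite !surrogateE (surrogate_gap Cm_gt0 (x_bound 0) (x_cov 0) A B Q Wpos Pp K).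
rewrite (surrogate_gap Cm_gt0 (x_bound 0) (x_cov 0) A B Q Wpos Pp G).
by rewrite subrr /gap mulmx0 mul0mx mxtrace0 addr0.
Qed.

Let gap_ge0' K : 0 <= gap K.
Proof. exact: (gap_ge0 Cm_gt0 (x_bound 0) (x_cov 0)). Qed.

(** The cost dominates lambda_min Q times the trace of [Sigma]. Positivity passes to [J0], by which
    [theta] divides. *)
Let Jst_gt0 : 0 < Jst.
Proof.
have [lQ_gt0 _ lQ] := lambda_minE n_gt0 Qpos.
rewrite surrogateE; apply: (@lt_le_trans _ _ (\tr (lambda_min Q *: (1%:M^T *m 1%:M) *m Sigma))).
  rewrite -scalemxAl linearZ /= mulr_gt0//.
  apply: lt_le_trans (tr_gram_ge Spos n_gt0 1%:M); rewrite mulr_gt0//.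
  rewrite lt_neqAle frob2_ge0 andbT eq_sym.
  apply/eqP => f0; have := sqn_mulmx_frob2 (1%:M : 'M[R]_n) (const_mx 1).
  by rewrite f0 mul0r mul1mx leNgt sqn_gt0 const_mx1_neq0.
apply: (tr_mono Cm_gt0 (x_bound 0) (x_cov 0)) => z.
rewrite quadZM trmx1 mul1mx quad1 (le_trans (lQ z))//.
exact: quad_Q_le_policy_cost.
Qed.

Let J0_gt0 : 0 < J0.
Proof. by rewrite JE ltr_wpDr. Qed.

Let th_ge2 : 2 <= th.
Proof. by rewrite /theta le_max lexx. Qed.

Let N_ge : 40 / (7 * mu * s2 * zeta) * th * J0 <= N%:R.
Proof.
rewrite /num_iterations; set z := _ * _ * _.
have c0 : (0 <= Num.ceil z).
  rewrite ceil_ge0 (lt_le_trans (ltrN10 _))//.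
  apply: mulr_ge0 (ltW J0_gt0); apply: mulr_ge0 (le_trans _ th_ge2) => //.
  apply: divr_ge0 => //; apply: mulr_ge0 (ltW zeta_gt0); apply: mulr_ge0 (sqr_ge0 _).
  by apply: mulr_ge0 (ltW mu_gt0).
by rewrite natr_absz (ger0_norm c0) ceil_ge.
Qed.

Let second_momentE :
  second_moment_bound Cm A B Q W sigma Pb (Ctilde p P h) = xi3 p P h.
Proof.
have C0 := ltW Cm_gt0.
have c3 : Cm ^+ 3 = (Cm `^ (3 / 2)) ^+ 2.
  by rewrite -!powR_mulrn ?powR_ge0// -powRrM divfK.
have c1 : Cm = (Cm `^ (1 / 2)) ^+ 2.
  by rewrite -powR_mulrn ?powR_ge0// -powRrM divfK// powRr1.
have c2 : Cm ^+ 2 = Cm `^ (3 / 2) * Cm `^ (1 / 2).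
  rewrite -powRD; last by apply/implyP => _; rewrite gt_eqF.
  by rewrite -powR_mulrn//; congr (_ `^ _); field.
rewrite /second_moment_bound c3 c2 {4}c1 /xi3 /xi1 /xi2 -/(cost_coef_x A B Q W Pb (Ctilde p P h)).
rewrite -/(cost_coef_eta B W Pb).
move: (cost_coef_x _ _ _ _ _ _) (cost_coef_eta _ _ _) (_ `^ _) (_ `^ _) => a b c e.
by ring.
Qed.

Let Ktilde K : J K <= 10 * zeta^-1 * J0 -> spectral_norm K ^+ 2 <= Ctilde p P h.
Proof.
move=> JK; have f0 := frob2_ge0 K.
have h1 : spectral_norm K ^+ 2 <= frob2 K.
  rewrite -[leRHS]sqr_sqrtr// ler_pow2 ?spectral_norm_ge0 ?sqrtr_ge0//.
  exact: spectral_norm_frob2.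
apply: (le_trans h1).
rewrite /Ctilde; have [_ -> _] := lambda_minE m_gt0 Wpos.
have [_ -> _] := lambda_minE n_gt0 Spos.
rewrite ler_pdivlMr ?mulr_gt0// mulrC [lS * _]mulrC.
apply: (le_trans (surrogate_ge Cm_gt0 (x_bound 0) (x_cov 0) A B Qpos Wpos Pp Spos n_gt0 m_gt0 K)).
by rewrite -surrogateE (le_trans JK)// lerDl ltW.
Qed.

Definition next_iterate i (K : 'M[R]_(m, n)) (z : 'cV[R]_n) (y : 'cV[R]_m) : 'M[R]_(m, n) :=
  K + (stepsize p P h i / sigma * observed_cost p P z (- (K *m z) + sigma *: y))
    *: (y *m z^T).

(** With [stepsize = 2 / (mu (i + th))] the contraction factor is 1 - 2/(i + th), and the noise
    [stepsize^2 (L / 2) xi3] is at most th J0 / (i + th)^2 because [th >= 2 L xi3 / (mu^2 J0)]. *)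
Let iterate_step i K : J K <= 10 * zeta^-1 * J0 -> exists2 e,
  has_mean Pr (fun w => gap (next_iterate i K (vec (x i w)) (vec (eta i w)) - G)) e &
  e <= (1 - 2 / (i%:R + th)) * gap (K - G) + th * J0 / (i%:R + th) ^+ 2.
Proof.
move=> JK.
have s0 : 0 < i%:R + th by rewrite ltr_wpDl// (lt_le_trans _ th_ge2).
have a0 : 0 <= stepsize p P h i.
  by rewrite /stepsize mulr_ge0 ?divr_ge0 ?(ltW mu_gt0) ?(ltW s0).
have indi : independent_systems Pr (generated_by (x i)) (generated_by (eta i)).
  apply: (independent_systems_sub _ _ (@draws_independent [set inl i] [set inr i] _)).
  - by move=> E xE; apply: sub_sigma_algebra; exists (inl i).
  - by move=> E xE; apply: sub_sigma_algebra; exists (inr i).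
  - by apply/disj_setPS => k [/= -> ].
have [e me le_e] := gap_step (eta_law i) Cm_gt0 (x_bound i) (x_mean i) (x_cov i) indi
  A B Qpos Wpos Pp Spos n_gt0 m_gt0 sigma_gt0 a0 P_le (Ktilde JK).
exists e; first exact: me.
apply: (le_trans le_e); rewrite second_momentE; apply: lerD.
  rewrite le_eqVlt; apply/orP; left; apply/eqP; congr (_ * _).
  by rewrite /stepsize muE; field; rewrite !gt_eqF.
have hL : hess_bound B W Pb * spectral_norm Sigma = cst_L p / 2.
  by rewrite /cst_L /cst_C3 /hess_bound; field.
have th3 : 2 * cst_L p * xi3 p P h / (mu ^+ 2 * J0) <= th by rewrite /theta le_max lexx orbT.
have mJ : 0 < mu ^+ 2 * J0 by rewrite mulr_gt0// exprn_gt0.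
rewrite ler_pdivrMr// in th3; rewrite hL.
have -> : stepsize p P h i ^+ 2 * (cst_L p / 2) * xi3 p P h =
   (2 * cst_L p * xi3 p P h) * (mu * (i%:R + th)) ^- 2.
  by rewrite /stepsize; field; rewrite !gt_eqF.
have -> : th * J0 / (i%:R + th) ^+ 2 = th * (mu ^+ 2 * J0) * (mu * (i%:R + th)) ^- 2.
  by field; rewrite !gt_eqF.
by rewrite ler_wpM2r// invr_ge0 sqr_ge0.
Qed.

Local Notation Phi := (potential J0 Jst mu s2 zeta th N).
Local Notation Psi i K := (Num.min 1 (Phi i (gap (K - G)))).

Let Psi_ge0 i K : (i <= N)%N -> 0 <= Psi i K.
Proof.
move=> iN; rewrite le_min ler01/=.
apply: (potential_ge0 J0_gt0 (ltW Jst_gt0) mu_gt0 _ zeta_gt0 th_ge2 N_ge) => //.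
by rewrite exprn_gt0.
Qed.

Let s2_gt0 : 0 < s2. Proof. by rewrite exprn_gt0. Qed.

Let measurable_Psi d' (T' : measurableType d') i (K : T' -> 'M[R]_(m, n)) :
  mx_measurable K -> measurable_fun setT (fun t => Psi i (K t)).
Proof.
move=> mK; apply: measurable_minr; first exact: measurable_cst.
under eq_fun do rewrite potential_affine.
apply: measurable_funD; first exact: measurable_cst.
apply: measurable_funM; first exact: measurable_cst.
have mD : mx_measurable (fun t => K t - G).
  by apply: mx_measurableD => //; exact: mx_measurable_cst.
apply: mx_measurable_mxtrace; apply: mx_measurableM; last exact: mx_measurable_cst.
apply: mx_measurableM => //; apply: mx_measurableM; last exact: mx_measurable_cst.
exact: mx_measurable_tr.
Qed.

Let measurable_next d' (T' : measurableType d') i (K : T' -> 'M[R]_(m, n)) z y :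
  mx_measurable K -> mx_measurable z -> mx_measurable y ->
  mx_measurable (fun t => next_iterate i (K t) (z t) (y t)).
Proof.
move=> mK mz my; have cst p' q' (M : 'M[R]_(p', q')) := @mx_measurable_cst _ T' R p' q' M.
have mu : mx_measurable (fun t => - (K t *m z t) + sigma *: y t).
  apply: mx_measurableD; last by apply: mx_measurableZ => //; exact: measurable_cst.
  by apply: mx_measurableN; exact: mx_measurableM.
apply: mx_measurableD => //; apply: mx_measurableZ; last first.
  by apply: mx_measurableM => //; exact: mx_measurable_tr.
apply: measurable_funM; first exact: measurable_cst.
apply: measurable_funD; first by apply: measurable_funD; exact: mx_measurable_quad.
by apply: mx_measurable_quad => //; apply: mx_measurableD; exact: mx_measurableM.
Qed.

Let mx_x i : mx_measurable (fun w => vec (x i w)).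
Proof. exact: mx_measurable_vec. Qed.

Let mx_eta i : mx_measurable (fun w => vec (eta i w)).
Proof. exact: mx_measurable_vec. Qed.

(** If the potential is at least 1, the truncated one equals 1 and cannot grow. Otherwise
    [potential_exit] puts the cost below 10 J0 / zeta, where the one-step estimate holds, and an
    affine function of the gap commutes with the expectation. *)
Let Psi_step i K : (i < N)%N ->
  (\int[Pr]_w (Psi i.+1 (next_iterate i K (vec (x i w)) (vec (eta i w))))%:E <= (Psi i K)%:E)%E.
Proof.
move=> iN.
have mPsi : measurable_fun setT (fun w =>
    (Psi i.+1 (next_iterate i K (vec (x i w)) (vec (eta i w))))%:E).
  apply/measurable_EFinP; apply: measurable_Psi.
  by apply: measurable_next => //; exact: mx_measurable_cst.
have int1 : (\int[Pr]_w (Psi i.+1 (next_iterate i K (vec (x i w)) (vec (eta i w))))%:E <= 1)%E.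
  have -> : (1 = \int[Pr]_(w in setT) (1%R)%:E)%E.
    by rewrite integral_cst// [X in (_ * X)%E]probability_setT mule1.
  apply: ge0_le_integral => //.
  - by move=> w _; rewrite lee_fin Psi_ge0.
  - by move=> w _; rewrite lee_fin ge_min lexx.
have [PhiK|PhiK] := leP 1 (Phi i (gap (K - G))); first by [].
have JK : J K <= 10 * zeta^-1 * J0.
  rewrite leNgt; apply/negP => JK.
  suff : 1 <= Phi i (gap (K - G)) by rewrite leNgt PhiK.
  apply: (potential_exit J0_gt0 mu_gt0 s2_gt0 zeta_gt0 th_ge2 N_ge) => //.
    exact: ltnW.
  by rewrite addrC -JE ltW.
have [e [ie me] le_e] := iterate_step i JK.
have [iP mP] : has_mean Pr
    (fun w => Phi i.+1 (gap (next_iterate i K (vec (x i w)) (vec (eta i w)) - G)))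
    (Phi i.+1 e).
  rewrite potential_affine; set c := (X in X * e).
  apply: has_mean_ext (has_meanD (has_mean_cst Pr _) (has_meanZ c (conj ie me))) => w.
  by rewrite [RHS]potential_affine.
apply: (@le_trans _ _ (Phi i.+1 e)%:E); last first.
  rewrite lee_fin.
  apply: le_trans (potential_step Jst J0_gt0 mu_gt0 s2_gt0 zeta_gt0 th_ge2 N_ge _ iN) => //.
  exact: (potential_mono Jst J0_gt0 mu_gt0 s2_gt0 zeta_gt0 th_ge2 N_ge).
rewrite -mP /Rintegral fineK ?(integrable_fin_num measurableT)//.
apply: ge0_le_integral => //.
- by move=> w _; rewrite lee_fin Psi_ge0.
- exact: (measurable_int Pr).
- by move=> w _; rewrite lee_fin ge_min lexx orbT.
Qed.

Local Notation Kit i w := (policy_iterate p P h (fun j => vec (x j w)) (fun j => vec (eta j w)) i).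
Local Notation past i := (\bigcup_(k in past_draws i) stage_draws k).

Let iterate_past_measurable i :
  mx_measurable (T := g_sigma_algebraType (past i)) (fun w => Kit i w).
Proof.
apply: (mx_measurable_policy_iterate Wpos surrogateE (P := fun=> P)) => //.
- move=> j ji; apply: mx_measurable_vec.
  by apply: (joint_measurable_fun (k := inl j)).
- move=> j ji; apply: mx_measurable_vec.
  by apply: (joint_measurable_fun (k := inr j)).
Qed.

Let past_measurable i : past i `<=` measurable.
Proof. by move=> E [k _ /stage_draws_measurable]. Qed.

Let Psi_descent i : (i < N)%N ->
  (\int[Pr]_w (Psi i.+1 (Kit i.+1 w))%:E <= \int[Pr]_w (Psi i (Kit i w))%:E)%E.
Proof.
move=> iN.
(* The identity into the sigma-algebra of the past makes all earlier draws one random element,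
   independent of the pair drawn now. *)
pose X : T -> g_sigma_algebraType (past i) := id.
have mX : measurable_fun setT X.
  exact: sub_sigma_measurable_fun (@past_measurable i) (@measurable_id _ _ _).
pose Y w := (x i w, eta i w).
have mY : measurable_fun setT Y by exact: measurable_fun_pair.
pose now : set (nat + nat) := [set inl i; inr i].
have XY : independent_systems Pr (generated_by X) (generated_by Y).
  apply: (independent_systems_sub _ _ (@draws_independent (past_draws i) now _)).
  - by apply: generated_by_sub; exact: measurable_id.
  - apply: generated_by_sub; apply: measurable_fun_pair.
      by apply: (joint_measurable_fun (k := inl i)) => //; left.
    by apply: (joint_measurable_fun (k := inr i)) => //; right.
  - by apply/disj_setPS => k [+ []] => /[swap] -> /=; rewrite /past_draws /= ltnn.
pose f (z : g_sigma_algebraType (past i) * (n.-tuple R * m.-tuple R)) :=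
  (Psi i.+1 (next_iterate i (Kit i z.1) (vec z.2.1) (vec z.2.2)))%:E.
have mf : measurable_fun setT f.
  apply/measurable_EFinP; apply: measurable_Psi; apply: measurable_next.
  - move=> k l; exact: (measurableT_comp (@iterate_past_measurable i k l) measurable_fst).
  - by apply: mx_measurable_vec; exact: (measurableT_comp measurable_fst measurable_snd).
  - by apply: mx_measurable_vec; exact: (measurableT_comp measurable_snd measurable_snd).
have f0 z : (0 <= f z)%E by rewrite lee_fin Psi_ge0.
have := ge0_integral_independent mX mY XY mf f0; rewrite {1}/f /= => ->.
apply: ge0_le_integral => //.
- by move=> w _; exact: integral_ge0.
- exact: measurable_independent_integral.
- apply/measurable_EFinP; apply: measurable_Psi => k l.
  exact: sub_sigma_measurable_fun (@past_measurable i) (@iterate_past_measurable i k l).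
- by move=> w _; exact: (@Psi_step i (Kit i w) iN).
Qed.

(** Markov's inequality in disguise: missing the target at the last iteration forces the potential
    to be at least 1, so the failure indicator is below [Psi N], whose mean is at most the starting
    value. *)
Lemma stage_failure :
  (Pr [set w | (s2 < frob2 (stage_policy p P h (fun j => vec (x j w))
     (fun j => vec (eta j w)) - G))%R] <= zeta%:E)%E.
Proof.
set fail := [set w | _].
have mK i : mx_measurable (fun w => Kit i w).
  move=> k l.
  exact: sub_sigma_measurable_fun (@past_measurable i) (@iterate_past_measurable i k l).
have mPsi i : measurable_fun setT (fun w => (Psi i (Kit i w))%:E).
  by apply/measurable_EFinP; exact: measurable_Psi.
have mfail : measurable fail.
  apply: measurable_superlevel.
  by apply: mx_measurable_frob2; apply: mx_measurableD; [exact: mK|exact: mx_measurable_cst].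
have descent i : (i <= N)%N ->
    (\int[Pr]_w (Psi i (Kit i w))%:E <= (Psi 0 (init_policy p h))%:E)%E.
  elim: i => [_|i IH iN]; last exact: le_trans (Psi_descent iN) (IH (ltnW iN)).
  rewrite (_ : (\int[Pr]_w _)%E =
    (\int[Pr]_(w in setT) (Psi 0 (init_policy p h))%:E)%E)//.
  by rewrite integral_cst// [X in (_ * X)%E]probability_setT mule1.
rewrite -[fail]setIT -integral_indic//.
apply: (@le_trans _ _ (\int[Pr]_w (Psi N (Kit N w))%:E)%E); last first.
  apply: le_trans (descent N (leqnn N)) _; rewrite lee_fin ge_min; apply/orP; right.
  apply: (potential_start J0_gt0 (ltW Jst_gt0) mu_gt0 s2_gt0 zeta_gt0 th_ge2 N_ge) => //.
  by rewrite addrC -JE.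
apply: ge0_le_integral => //.
- by apply/measurable_EFinP; exact: measurable_indic.
- move=> w _; rewrite lee_fin indicE; case: (boolP (w \in fail)) => [|_]; last exact: Psi_ge0.
  rewrite inE => fw; rewrite le_min lexx /=.
  apply: (potential_final J0_gt0 (ltW Jst_gt0) mu_gt0 s2_gt0 zeta_gt0 th_ge2 N_ge _ _ fw) => //.
  apply: le_trans (gap_ge Cm_gt0 (x_bound 0) (x_cov 0) B Wpos Pp Spos n_gt0 m_gt0 _).
  by rewrite (_ : mu / 4 = lW * lS)// muE; field.
Qed.

End stage.

(** * The whole algorithm *)

(** Each event is attached to the index [g k]; injectivity makes the fibre over that index a single
    point. *)
Lemma mutually_independent_comp d (T : measurableType d) (R : realType)
    (P : probability T R) (I I' : eqType) (F : I -> set_system T)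
    (F' : I' -> set_system T) (g : I' -> I) :
  injective g -> (forall k, F' k = F (g k)) ->
  mutually_independent P F -> mutually_independent P F'.
Proof.
move=> gI FE indF s E us sE.
pose E' i := \bigcap_(k in [set k | g k = i]) E k.
have E'g k : E' (g k) = E k.
  by apply/seteqP; split=> [w /(_ k erefl)//|w Ew l /= /gI ->].
have := indF [seq g k | k <- s] E'; rewrite map_inj_uniq// => /(_ us).
rewrite big_map; under eq_bigr do rewrite E'g.
move=> <-; last by move=> _ /mapP[k ks ->]; rewrite E'g -FE; exact: sE.
congr (P _); apply/seteqP; split=> w h.
  by move=> _ /= /mapP[k ks ->]; rewrite E'g; exact: h.
by move=> k /= ks; rewrite -E'g; apply: h; rewrite /= map_f.
Qed.

(** * Measurability of the spectral norm *)

Section measurable_spectral_norm.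
Context {R : realType}.

Lemma rational_approximation n (z : 'cV[R]_n) (e : R) : 0 < e ->
  exists q : 'cV[rat]_n, l2norm (z - map_mx ratr q) <= e.
Proof.
move=> e0; pose b := e / (n%:R + 1).
have n1 : 0 < n%:R + 1 :> R by rewrite ltr_wpDl.
have b0 : 0 < b by rewrite divr_gt0.
have ex i : exists q : rat, `|z i 0 - ratr q| <= b.
  have /rat_in_itvoo[q] : z i 0 - b < z i 0 + b by lra.
  by rewrite in_itv/= => /andP[h1 h2]; exists q; rewrite ler_norml; lra.
have [q qP] := choice ex.
exists (\col_i q i); rewrite l2normE -[leRHS]ger0_norm ?(ltW e0)// -sqrtr_sqr ler_wsqrtr//.
have -> : e ^+ 2 = (n%:R + 1) ^+ 2 * b ^+ 2 by rewrite /b; field; rewrite gt_eqF.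
rewrite (@le_trans _ _ (n%:R * b ^+ 2))//; last first.
  rewrite ler_wpM2r ?sqr_ge0//; have : 0 <= n%:R :> R by [].
  by nra.
rewrite (@le_trans _ _ (\sum_(i < n) b ^+ 2))//.
  apply: ler_sum => i _; rewrite !mxE -real_normK ?num_real// ler_pow2 ?(ltW b0)//.
by rewrite sumr_const card_ord mulr_natl lexx.
Qed.

Lemma spectral_norm_le_rational p q (M : 'M[R]_(p, q)) c : 0 <= c ->
  (forall z : 'cV[rat]_q, l2norm (M *m map_mx ratr z) <= c * l2norm (map_mx ratr z : 'cV[R]_q)) ->
  spectral_norm M <= c.
Proof.
move=> c0 h; apply: spectral_norm_le => // z; apply/ler_addgt0Pr => e e0.
have M0 := spectral_norm_ge0 M.
have k0 : 0 < spectral_norm M + c + 1 by lra.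
have [y zy] := rational_approximation z (divr_gt0 e0 k0).
set y' := map_mx ratr y in zy.
have h1 : l2norm (M *m z) <= l2norm (M *m (z - y')) + l2norm (M *m y').
  by rewrite (le_trans _ (l2normD _ _))// -mulmxDr subrK.
have h2 := l2norm_mulmx M (z - y'); have h3 := h y.
have h4 : l2norm y' <= l2norm z + l2norm (z - y').
  rewrite {1}(_ : y' = z + (- 1) *: (z - y')); last by rewrite scaleN1r opprB addrCA subrr addr0.
  by rewrite (le_trans (l2normD _ _))// l2normZ normrN1 mul1r.
have h5 : (spectral_norm M + c) * l2norm (z - y') <= e.
  rewrite (@le_trans _ _ ((spectral_norm M + c + 1) * (e / (spectral_norm M + c + 1))))//.
    by apply: ler_pM; rewrite ?l2norm_ge0//; lra.
  by rewrite mulrC divfK// gt_eqF.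
have h6 := ler_wpM2l c0 h4.
by lra.
Qed.

(** The norm is a supremum over uncountably many vectors; by continuity rational ones suffice, which
    leaves a countable intersection of polynomial conditions. *)
Lemma measurable_spectral_norm_le d (T : measurableType d) p q (f : T -> 'M[R]_(p, q)) c :
  0 <= c -> mx_measurable f -> measurable [set t | spectral_norm (f t) <= c].
Proof.
move=> c0 mf.
pose S (z : 'cV[rat]_q) := [set t |
  sqn (f t *m map_mx ratr z) <= c ^+ 2 * sqn (map_mx ratr z : 'cV[R]_q)].
have mS z : measurable (S z).
  apply: measurable_sublevel.
  by apply: mx_measurable_sqn; apply: mx_measurableM => //; exact: mx_measurable_cst.
rewrite (_ : [set _ | _] = \bigcap_k (if unpickle k is Some z then S z else setT)).
  by apply: bigcap_measurable => // k _; case: unpickle.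
apply/seteqP; split=> t /=.
  move=> h k _; case: unpickle => // z.
  rewrite /S /= (le_trans (sqn_mulmx _ _))// ler_wpM2r ?sqn_ge0//.
  by rewrite ler_pow2 ?spectral_norm_ge0.
move=> h; apply: spectral_norm_le_rational => // z.
have := h (pickle z) I; rewrite pickleK /S /=.
by rewrite -!l2norm_sqr -exprMn ler_pow2 ?mulr_ge0 ?l2norm_ge0.
Qed.

End measurable_spectral_norm.

(** * The choice of the horizon, and stability *)

Section horizon.
Context {R : realType} {n m : nat}.
Variables (A : 'M[R]_n) (B : 'M[R]_(n, m)) (Q : 'M[R]_n) (W : 'M[R]_m) (QN Pst : 'M[R]_n).
Variables (eps : R) (N : nat).
Hypotheses (Qpos : posdef Q) (Wpos : posdef W) (Ppos : posdef Pst).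
Hypotheses (Pare : solves_riccati A B Q W Pst) (QNge : possemidef (QN - Pst)).
Hypotheses (n_gt0 : (0 < n)%N) (m_gt0 : (0 < m)%N) (B_neq0 : B != 0) (QN_neq : QN != Pst)
  (eps_gt0 : 0 < eps) (N_gt0 : (0 < N)%N).
Local Notation Kst := (gain A B W Pst).
Local Notation AK := (A - B *m Kst).
Local Notation rho := (norm_wrt Pst AK).
Hypothesis AK_neq0 : AK != 0.

(** Take logarithms, with 0 < rho < 1. The exponent involves [N.-1] because the gain of time 0 is
    computed from the matrix reached after [N - 1] steps; this is the [+ 1] in the formula. *)
Lemma horizon_rate :
  N%:Z = Num.ceil
    (1 / 2 * (ln (2 * norm_wrt Pst (QN - Pst) * condition_number Pst
                    * spectral_norm AK * spectral_norm B / (eps * lambda_min W))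
              / ln (1 / norm_wrt Pst AK)) + 1) ->
  2 * norm_wrt Pst (QN - Pst) * condition_number Pst * spectral_norm AK
    * spectral_norm B * rho ^+ (2 * N.-1) <= eps * lambda_min W.
Proof.
move=> NE.
have [w0 _ _] := lambda_minE m_gt0 Wpos.
have r1 : rho < 1 by exact: (rho_lt1 Qpos Wpos Ppos Pare n_gt0).
have r0 : 0 < rho by exact: norm_wrt_gt0.
set c := 2 * _ * _ * _ * _ in NE *.
have c0 : 0 < c.
  have u0 : 0 < norm_wrt Pst (QN - Pst) by rewrite norm_wrt_gt0// subr_eq0.
  have k0 := lt_le_trans ltr01 (condition_number_ge1 n_gt0 Ppos).
  rewrite /c; apply: mulr_gt0 (spectral_norm_gt0 B_neq0).
  apply: mulr_gt0 (spectral_norm_gt0 AK_neq0); apply: mulr_gt0 k0.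
  exact: mulr_gt0.
have e0 : 0 < eps * lambda_min W by exact: mulr_gt0.
have l0 : 0 < ln (1 / rho) by rewrite ln_gt0// div1r invf_gt1.
have : 1 / 2 * (ln (c / (eps * lambda_min W)) / ln (1 / rho)) + 1 <= N%:R.
  by rewrite (_ : N%:R = (N%:Z)%:~R)// NE ceil_ge.
have N1 : N%:R = N.-1%:R + 1 :> R by rewrite natr1 prednK.
rewrite N1 lerD2r => h.
have {}h : ln (c / (eps * lambda_min W)) <= 2 * N.-1%:R * ln (1 / rho).
  rewrite -ler_pdivrMr// -ler_pdivrMl//; move: h; rewrite div1r; exact.
have : c / (eps * lambda_min W) <= (1 / rho) ^+ (2 * N.-1).
  rewrite -(@lnK _ (c / _)) ?posrE ?divr_gt0// -(@lnK _ (1 / rho)) ?posrE ?divr_gt0//.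
  by rewrite -expRM_natl ler_expR natrM.
rewrite ler_pdivrMr// div1r exprVn => h2.
rewrite -ler_pdivlMr ?exprn_gt0//.
by rewrite mulrC.
Qed.

(** The closed loop of [K] is [AK] plus [B (Kst - K)]; in the [Pst] norm the second part is at most
    the root of the condition number times |B| eps, which the threshold keeps below [1 - rho]. *)
Lemma near_optimal_stabilizing K : spectral_norm (K - Kst) <= eps ->
  eps < (1 - rho) / (Num.sqrt (condition_number Pst) * spectral_norm B) ->
  spectral_radius (A - B *m K) < 1.
Proof.
move=> Keps small; apply: (spectral_radius_lt1 Ppos).
have k0 := lt_le_trans ltr01 (condition_number_ge1 n_gt0 Ppos).
have s0 : 0 < Num.sqrt (condition_number Pst) by rewrite sqrtr_gt0.
have B0 := spectral_norm_gt0 B_neq0.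
have -> : A - B *m K = AK + B *m (Kst - K) by rewrite mulmxBr addrA subrK.
apply: (le_lt_trans (norm_wrt_triangle _ _ n_gt0 Ppos)).
have h1 := norm_wrt_le_spectral (B *m (Kst - K)) n_gt0 Ppos.
have h2 := spectral_normM B (Kst - K).
have h3 : spectral_norm (Kst - K) <= eps.
  apply: le_trans Keps; apply: spectral_norm_le; first exact: spectral_norm_ge0.
  move=> z; rewrite -opprB mulNmx -scaleN1r l2normZ normrN1 mul1r; exact: l2norm_mulmx.
rewrite ltr_pdivlMr ?mulr_gt0// in small.
have h4 : Num.sqrt (condition_number Pst) * spectral_norm (B *m (Kst - K)) <=
   Num.sqrt (condition_number Pst) * (spectral_norm B * eps).
  rewrite ler_wpM2l ?(ltW s0)// (le_trans h2)// ler_wpM2l// ltW//.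
by move: h1 h4 small; move: (Num.sqrt _) (spectral_norm _) (spectral_norm _) => a b e; lra.
Qed.

End horizon.

(** * Combining the stages *)

Section assembly.
Context {R : realType} {n m : nat} (p : rhpg_setting R n m).
Context d (Omega : measurableType d) (Pr : probability Omega R).
Variables (x : nat -> nat -> {RV Pr >-> n.-tuple R}) (eta : nat -> nat -> {RV Pr >-> m.-tuple R}).

Local Notation A := (sysA p).
Local Notation B := (sysB p).
Local Notation Q := (costQ p).
Local Notation W := (costR p).
Local Notation QN := (terminalQ p).
Local Notation Pst := (optimalP p).
Local Notation D := (init_law p).
Local Notation Sigma0 := (init_cov p).
Local Notation Cm := (init_bound p).
Local Notation eps := (accuracy p).
Local Notation zeta := (failure p).
Local Notation sigma := (smoothing p).
Local Notation N := (horizon p).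
Local Notation K0 := (init_policy p).
Local Notation Kst := (gain A B W Pst).
Local Notation AK := (A - B *m Kst).

Definition draws (k : ('I_N * nat) + ('I_N * nat)) : set_system Omega :=
  match k with
  | inl (h, i) => generated_by (x h i)
  | inr (h, i) => generated_by (eta h i)
  end.

Definition draw_stage (k : ('I_N * nat) + ('I_N * nat)) : 'I_N :=
  match k with inl (h, _) => h | inr (h, _) => h end.

Hypotheses (Qpos : posdef Q) (Wpos : posdef W) (Ppos : posdef Pst)
  (Pare : solves_riccati A B Q W Pst) (QNge : possemidef (QN - Pst)).
Hypotheses (mean0 : forall i, ('E_D[fun x => vec x i 0%R] = 0)%E)
  (cov0 : forall i j, ('E_D[fun x => (vec x i 0 * vec x j 0)%R] = (Sigma0 i j)%:E)%E)
  (Sigma0pos : posdef Sigma0) (Cm_gt0 : 0 < Cm)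
  (x0bound : {ae D, forall x, l2norm (vec x) ^+ 2 <= Cm}).
Hypotheses (eps_gt0 : 0 < eps) (zeta_gt0 : 0 < zeta) (sigma_gt0 : 0 < sigma)
  (A_neq0 : A != 0) (B_neq0 : B != 0) (QN_neq : QN != Pst) (N_gt0 : (0 < N)%N).
Hypotheses (x_law : forall h i, (h < N)%N ->
      forall U, measurable U -> distribution Pr (x h i) U = D U)
    (eta_law : forall h i, (h < N)%N -> standard_gaussian (distribution Pr (eta h i)))
    (draws_indep : mutually_independent Pr draws).

Let n_gt0 : (0 < n)%N := dim_state_gt0 A_neq0.
Let m_gt0 : (0 < m)%N := dim_input_gt0 B_neq0.

Let surrogateE P K : surrogate_cost p P K = \tr (policy_cost A B Q W P K *m Sigma0).
Proof. exact: (surrogate_cost_trE cov0 Cm_gt0 x0bound). Qed.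

(* k counts the stages already run: this is \widetilde P_{N-k}, and stage_gain k
   is \widetilde K_{N-k-1}. *)
Definition stage_value k w :=
  rhpg_P_after p (fun h i => vec (x h i w)) (fun h i => vec (eta h i w)) k.

Definition stage_gain k w := stage_policy p (stage_value k w) (N - k.+1)
  (fun i => vec (x (N - k.+1) i w)) (fun i => vec (eta (N - k.+1) i w)).

Definition stage_error k w := frob2 (stage_gain k w - gain A B W (stage_value k w)).

Definition accurate k := [set w | forall j, (j < k)%N ->
  stage_error j w <= target_accuracy p (N - j.+1) ^+ 2].

Let stage_value_possemidef k w : possemidef (stage_value k w).
Proof.
by apply: (stage_P_possemidef Qpos Wpos Ppos QNge (Pt := stage_value^~ w) (K := stage_gain^~ w)).
Qed.

Local Notation joint J := (\bigcup_(q in J) draws q).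

Let draws_measurable k : draws k `<=` measurable.
Proof. by case: k => -[h i]; apply: generated_by_measurable. Qed.

Let joint_measurable J : joint J `<=` measurable.
Proof. by move=> E [k _ /draws_measurable]. Qed.

Section filtration.
Variable J : set (('I_N * nat) + ('I_N * nat)).
Local Notation T := (g_sigma_algebraType (joint J)).

Let mx_draw_x (h : 'I_N) i : J (inl (h, i)) -> mx_measurable (T := T) (fun w => vec (x h i w)).
Proof.
by move=> Jh; apply: mx_measurable_vec; apply: (joint_measurable_fun (k := inl (h, i))).
Qed.

Let mx_draw_eta (h : 'I_N) i : J (inr (h, i)) -> mx_measurable (T := T) (fun w => vec (eta h i w)).
Proof.
by move=> Jh; apply: mx_measurable_vec; apply: (joint_measurable_fun (k := inr (h, i))).
Qed.

Let last_lt k : (N - k.+1 < N)%N. Proof. by rewrite ltn_subrL. Qed.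

Lemma mx_measurable_stage_gain k :
  (forall q, (N - k.+1 <= draw_stage q)%N -> J q) ->
  mx_measurable (T := T) (stage_value k) -> mx_measurable (T := T) (stage_gain k).
Proof.
move=> Jk mP; apply: (mx_measurable_stage_policy Wpos surrogateE mP) => //.
- by move=> j; apply: (mx_draw_x (h := Ordinal (last_lt k))); apply: Jk => /=.
- by move=> j; apply: (mx_draw_eta (h := Ordinal (last_lt k))); apply: Jk => /=.
Qed.

(** The first [k] stages to be run consume only draws of the stages [h >= N - k]. *)
Lemma mx_measurable_stage_value k :
  (forall q, (N - k <= draw_stage q)%N -> J q) -> mx_measurable (T := T) (stage_value k).
Proof.
elim: k => [_|k IH Jk]; first exact: mx_measurable_cst.
have mP : mx_measurable (T := T) (stage_value k).
  by apply: IH => q kq; apply: Jk; rewrite (leq_trans _ kq)// leq_sub2l.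
exact: (mx_measurable_policy_cost p mP (mx_measurable_stage_gain Jk mP)).
Qed.

Lemma measurable_stage_error k : (forall q, (N - k.+1 <= draw_stage q)%N -> J q) ->
  measurable_fun (setT : set T) (stage_error k).
Proof.
move=> Jk; have mP : mx_measurable (T := T) (stage_value k).
  by apply: mx_measurable_stage_value => q kq; apply: Jk; rewrite (leq_trans _ kq)// leq_sub2l.
apply: mx_measurable_frob2; apply: mx_measurableD.
  exact: mx_measurable_stage_gain.
by apply: mx_measurableN; apply: mx_measurable_gain.
Qed.

Lemma measurable_accurate k : (forall q, (N - k <= draw_stage q)%N -> J q) ->
  measurable (accurate k : set T).
Proof.
elim: k => [_|k IH Jk].
  by rewrite (_ : accurate 0 = setT)//; apply/seteqP; split.
rewrite (_ : accurate k.+1 = accurate k `&`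
    [set w | stage_error k w <= target_accuracy p (N - k.+1) ^+ 2]).
  apply: measurableI.
    by apply: IH => q kq; apply: Jk; rewrite (leq_trans _ kq)// leq_sub2l.
  exact: (measurable_sublevel _ (measurable_stage_error Jk)).
apply/seteqP; split=> w /=.
  by move=> h; split=> [j jk|]; apply: h => //; exact: leqW.
by move=> -[h hk] j; rewrite ltnS leq_eqVlt => /predU1P[->//|]; exact: h.
Qed.

End filtration.

Let measurable_error k : measurable_fun setT (stage_error k).
Proof.
exact: sub_sigma_measurable_fun (@joint_measurable setT)
  (@measurable_stage_error setT k (fun _ _ => I)).
Qed.

Lemma measurable_accurate_event k : measurable (accurate k).
Proof.
have := @measurable_accurate setT k (fun _ _ => I).
apply: smallest_sub; first exact: sigma_algebra_measurable.
exact: joint_measurable.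
Qed.

Let stage_draws_indep h : (h < N)%N -> mutually_independent Pr (stage_draws (x h) (eta h)).
Proof.
move=> hN; pose g (k : nat + nat) : ('I_N * nat) + ('I_N * nat) :=
  match k with inl i => inl (Ordinal hN, i) | inr i => inr (Ordinal hN, i) end.
apply: (mutually_independent_comp (g := g)) draws_indep.
  by move=> [i|i] [j|j] //= [->].
by case.
Qed.

Let fixed_value_failure k P : (k < N)%N -> possemidef P ->
  spectral_norm P <= cst_Pmax p + cst_a p ->
  (Pr [set w | (target_accuracy p (N - k.+1) ^+ 2 <
     frob2 (stage_policy p P (N - k.+1) (fun i => vec (x (N - k.+1) i w))
        (fun i => vec (eta (N - k.+1) i w)) - gain A B W P))%R] <= zeta%:E)%E.
Proof.
move=> kN Pp P_le; have hN : (N - k.+1 < N)%N by rewrite ltn_subrL.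
apply: (stage_failure (x := x (N - k.+1)) (eta := eta (N - k.+1)) n_gt0 m_gt0 Qpos Wpos
  Sigma0pos Cm_gt0 zeta_gt0 sigma_gt0 surrogateE) => //.
- by move=> i; exact: eta_law.
- by move=> i; apply: (law_x_bound x0bound); exact: x_law.
- by move=> i; apply: (law_x_mean mean0 Cm_gt0 x0bound); exact: x_law.
- by move=> i; apply: (law_x_cov cov0 Cm_gt0 x0bound); exact: x_law.
- exact: stage_draws_indep.
- by apply: target_accuracy_gt0.
Qed.

(** Draws of the stages already run, as opposed to those of the stage about to run. For [k < N] the
    two are disjoint, since [N - k.+1 < N - k] then holds in truncated subtraction. *)
Let later k : set (('I_N * nat) + ('I_N * nat)) := [set q | (N - k <= draw_stage q)%N].
Let now k : set (('I_N * nat) + ('I_N * nat)) := [set q | draw_stage q = (N - k.+1)%N :> nat].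

Lemma stage_loss k : (k < N)%N ->
  (Pr (accurate k `&` [set w | (target_accuracy p (N - k.+1) ^+ 2 < stage_error k w)%R])
    <= zeta%:E)%E.
Proof.
move=> kN; have hN : (N - k.+1 < N)%N by rewrite ltn_subrL.
pose T1 := g_sigma_algebraType (joint (later k)).
pose T2 := g_sigma_algebraType (joint (now k)).
pose X : Omega -> T1 := id; pose Y : Omega -> T2 := id.
have mX : measurable_fun setT X.
  exact: sub_sigma_measurable_fun (@joint_measurable (later k)) (@measurable_id _ _ _).
have mY : measurable_fun setT Y.
  exact: sub_sigma_measurable_fun (@joint_measurable (now k)) (@measurable_id _ _ _).
have XY : independent_systems Pr (generated_by X) (generated_by Y).
  apply: (independent_systems_sub (G' := joint_sigma draws (later k))
    (H' := joint_sigma draws (now k))).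
  - by apply: generated_by_sub; exact: measurable_id.
  - by apply: generated_by_sub; exact: measurable_id.
  apply: (joint_sigma_independent draws_measurable _ _ draws_indep).
  - by case=> -[h i]; exact: generated_by_setT.
  - by case=> -[h i]; exact: generated_by_setI.
  apply/disj_setPS => q [/= kq qE]; move: kq.
  by rewrite /later /= qE leqNgt ltn_sub2l.
pose K (z : T1 * T2) := stage_policy p (stage_value k z.1) (N - k.+1)
  (fun i => vec (x (N - k.+1) i z.2)) (fun i => vec (eta (N - k.+1) i z.2)).
pose E : set (T1 * T2) := (fst @^-1` accurate k) `&`
  [set z | target_accuracy p (N - k.+1) ^+ 2 < frob2 (K z - gain A B W (stage_value k z.1))].
have mE : measurable E.
  apply: measurableI.
    rewrite -[X in measurable X]setTI; apply: measurable_fst => //.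
    exact: measurable_accurate.
  have mP : mx_measurable (fun z : T1 * T2 => stage_value k z.1).
    have h := @mx_measurable_stage_value (later k) k (fun _ => id).
    by move=> i j; exact: (measurableT_comp (h i j) measurable_fst).
  have mK : mx_measurable K.
    apply: (mx_measurable_stage_policy Wpos surrogateE mP) => // [j|j].
      apply: mx_measurable_vec; apply: (measurableT_comp _ measurable_snd).
      by apply: (joint_measurable_fun (k := inl (Ordinal hN, j))).
    apply: mx_measurable_vec; apply: (measurableT_comp _ measurable_snd).
    by apply: (joint_measurable_fun (k := inr (Ordinal hN, j))).
  apply: measurable_superlevel; apply: mx_measurable_frob2; apply: mx_measurableD => //.
  by apply: mx_measurableN; exact: mx_measurable_gain.
pose f z := (\1_E z : R)%:E.
have mf : measurable_fun setT f by apply/measurable_EFinP; exact: measurable_indic.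
have f0 z : (0 <= f z)%E by rewrite lee_fin.
set bad := _ `&` _.
have mbad : measurable bad.
  apply: measurableI; first exact: measurable_accurate_event.
  exact: measurable_superlevel (measurable_error _).
have -> : Pr bad = (\int[Pr]_w f (X w, Y w))%E.
  rewrite -[in LHS](setIT bad) -integral_indic//.
rewrite (ge0_integral_independent mX mY XY mf f0).
have -> : zeta%:E = (\int[Pr]_(w in setT) zeta%:E)%E.
  by rewrite integral_cst// [X in (_ * X)%E]probability_setT mule1.
apply: ge0_le_integral => //.
- by move=> w _; exact: integral_ge0.
- exact: measurable_independent_integral.
move=> w _; have [accw|naccw] := pselect (accurate k w); last first.
  rewrite integral0_eq ?lee_fin ?ltW// => w' _.
  by rewrite /f indicE memNset// => -[].
have P_le : spectral_norm (stage_value k w) <= cst_Pmax p + cst_a p.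
  by apply: (stage_P_norm Qpos Wpos Ppos Pare QNge A_neq0 B_neq0 eps_gt0 N_gt0
   (Pt := stage_value^~ w) (K := stage_gain^~ w)).
pose Ew := (fun w' => (X w, Y w')) @^-1` E.
have mEw : measurable Ew.
  rewrite -[X in measurable X]setTI.
  by apply: (measurable_fun_pair (measurable_cst _) mY).
have -> : (\int[Pr]_w' f (X w, Y w') = \int[Pr]_w' (\1_Ew w' : R)%:E)%E by [].
rewrite integral_indic// setIT.
rewrite (_ : Ew = [set w' | target_accuracy p (N - k.+1) ^+ 2 <
   frob2 (K (w, w') - gain A B W (stage_value k w))]); last first.
  by apply/seteqP; split=> w' //= [].
exact: (fixed_value_failure kN (stage_value_possemidef k w) P_le).
Qed.

(** Union bound over the first inaccurate stage in running order, each costing at most [zeta]. *)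
Lemma accurate_probability : ((1 - N%:R * zeta)%:E <= Pr (accurate N))%E.
Proof.
have mA := measurable_accurate_event.
have loss k : (k <= N)%N -> (Pr (~` accurate k) <= (k%:R * zeta)%:E)%E.
  elim: k => [_|k IH kN].
    by rewrite (_ : accurate 0 = setT) ?setCT ?measure0 ?mul0r//; apply/seteqP; split.
  have mb : measurable [set w | target_accuracy p (N - k.+1) ^+ 2 < stage_error k w].
    exact: measurable_superlevel (measurable_error _).
  apply: (@le_trans _ _ (Pr (~` accurate k `|` (accurate k `&`
    [set w | target_accuracy p (N - k.+1) ^+ 2 < stage_error k w])))).
    apply: le_measure; rewrite ?inE//.
    - exact: measurableC.
    - by apply: measurableU; [exact: measurableC|exact: measurableI].
    move=> w /= nacc; have [acck|] := pselect (accurate k w); last by left.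
    right; split=> //=; rewrite ltNge; apply/negP => le_k; apply: nacc => j.
    by rewrite ltnS leq_eqVlt => /predU1P[->//|]; exact: acck.
  apply: le_trans (measureU2 _ _ _) _; [exact: measurableC|exact: measurableI|].
  rewrite -natr1 mulrDl mul1r EFinD; apply: leeD; first exact/IH/ltnW.
  exact: stage_loss.
rewrite -[accurate N]setCK probability_setC; last exact: measurableC.
by rewrite EFinB leeB// loss.
Qed.

Definition output w := rhpg_policy p (fun h i => vec (x h i w)) (fun h i => vec (eta h i w)) 0.

Lemma outputE w : output w = stage_gain N.-1 w.
Proof. by rewrite /output /rhpg_policy /stage_gain /stage_value prednK// subnn subn1. Qed.

Lemma measurable_success : measurable [set w | spectral_norm (output w - Kst) <= eps].
Proof.
apply: measurable_spectral_norm_le; first exact: ltW.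
apply: mx_measurableD; last exact: mx_measurable_cst.
have mG := @mx_measurable_stage_gain setT N.-1 (fun _ _ => I)
  (@mx_measurable_stage_value setT N.-1 (fun _ _ => I)).
rewrite (funext outputE) => i j.
exact: sub_sigma_measurable_fun (@joint_measurable setT) (mG i j).
Qed.

Lemma accurate_success :
  2 * norm_wrt Pst (QN - Pst) * condition_number Pst * spectral_norm AK
    * spectral_norm B * norm_wrt Pst AK ^+ (2 * N.-1) <= eps * lambda_min W ->
  accurate N `<=` [set w | spectral_norm (output w - Kst) <= eps].
Proof.
move=> rate w acc; rewrite /= outputE.
by apply: (accurate_stages_output Qpos Wpos Ppos Pare QNge A_neq0 B_neq0 eps_gt0 N_gt0
   (Pt := stage_value^~ w) (K := stage_gain^~ w)).
Qed.

End assembly.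

Theorem corollary5p1 (R : realType) (n m : nat)
    (A : 'M[R]_n) (B : 'M[R]_(n, m)) (Q : 'M[R]_n) (W : 'M[R]_m)
    (QN Pst : 'M[R]_n)
    (D : probability (n.-tuple R) R) (Sigma0 : 'M[R]_n) (Cm : R)
    (eps zeta sigma : R) (N : nat) (K0 : nat -> 'M[R]_(m, n))
    (d : measure_display) (Omega : measurableType d) (P : probability Omega R)
    (x0 : nat -> nat -> {RV P >-> n.-tuple R})
    (eta : nat -> nat -> {RV P >-> m.-tuple R})
    (* the linear-quadratic regulator *)
    (stabAB : stabilizable A B) (Qpos : posdef Q) (Wpos : posdef W)
    (Ppos : posdef Pst) (Pare : solves_riccati A B Q W Pst)
    (QNsym : QN^T = QN) (QNge : possemidef (QN - Pst))
    (* the initial state distribution *)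
    (mean0 : forall i, ('E_D[fun x => vec x i 0%R] = 0)%E)
    (cov0 : forall i j,
      ('E_D[fun x => (vec x i 0 * vec x j 0)%R] = (Sigma0 i j)%:E)%E)
    (Sigma0pos : posdef Sigma0)
    (Cm_gt0 : 0 < Cm) (x0bound : {ae D, forall x, l2norm (vec x) ^+ 2 <= Cm})
    (* the parameters of the algorithm *)
    (eps_gt0 : 0 < eps) (zeta01 : 0 < zeta < 1) (sigma_gt0 : 0 < sigma)
    (A_neq0 : A != 0) (B_neq0 : B != 0) (QN_neq : QN != Pst) (N_gt0 : (0 < N)%N)
    (N_def : let Kst := gain A B W Pst in let AK := A - B *m Kst in
      N%:Z = Num.ceil
        (1 / 2 * (ln (2 * norm_wrt Pst (QN - Pst) * condition_number Pst
                        * spectral_norm AK * spectral_norm B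
                      / (eps * lambda_min W))
                  / ln (1 / norm_wrt Pst AK)) + 1))
    (* the draws: x0 h i ~ D and eta h i ~ N(0, I_m), all independent *)
    (x0_law : forall h i, (h < N)%N ->
      forall U, measurable U -> distribution P (x0 h i) U = D U)
    (eta_law : forall h i, (h < N)%N ->
      standard_gaussian (distribution P (eta h i)))
    (draws_indep : mutually_independent P
      (fun k : ('I_N * nat) + ('I_N * nat) =>
         match k with
         | inl (h, i) => generated_by (x0 h i)
         | inr (h, i) => generated_by (eta h i)
         end)) :
  let Kst := gain A B W Pst in
  let setting :=
    RHPGSetting A B Q W QN Pst D Sigma0 Cm eps zeta sigma N K0 in
  let Kout := fun w => rhpg_policy setting
    (fun h i => vec (x0 h i w)) (fun h i => vec (eta h i w)) 0 in
  let success := [set w | spectral_norm (Kout w - Kst) <= eps] in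
  [/\ measurable success,
      ((1 - N%:R * zeta)%:E <= P success)%E
    & eps < (1 - norm_wrt Pst (A - B *m Kst))
            / (Num.sqrt (condition_number Pst) * spectral_norm B) ->
      forall w, success w -> spectral_radius (A - B *m Kout w) < 1].
Proof.
move=> Kst setting Kout success.
have n_gt0 := dim_state_gt0 (p := setting) A_neq0.
have m_gt0 := dim_input_gt0 (p := setting) B_neq0.
have AK_neq0 : A - B *m Kst != 0.
  by apply: (closed_loop_neq0 (p := setting)) => //; exact: posdef_possemidef.
have rate := horizon_rate (Q := Q) (QN := QN) Qpos Wpos Ppos Pare n_gt0 m_gt0
  B_neq0 QN_neq eps_gt0 N_gt0 AK_neq0 N_def.
have /andP[zeta_gt0 _] := zeta01.
have mS : measurable success.
  exact: (measurable_success (p := setting) x0 eta Qpos Wpos Ppos QNge cov0 Cm_gt0 x0bound).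
split=> //.
  have acc := accurate_success (p := setting) (x := x0) (eta := eta) Qpos Wpos Ppos Pare QNge
    eps_gt0 A_neq0 B_neq0 N_gt0 rate.
  apply: le_trans (le_measure P _ _ acc).
  - apply: (accurate_probability (p := setting)) => //.
  - by rewrite inE; apply: (measurable_accurate_event (p := setting)).
  - by rewrite inE.
move=> small w ws.
exact: (near_optimal_stabilizing Ppos n_gt0 B_neq0 ws small).
Qed.
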